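(* Any singular orbit of a cohomogeneity one action on the complex hyperbolic plane $\mathbb{C}H^2$ is totally geodesic.
   Context: An isometric action on a Riemannian manifold is of cohomogeneity one if its orbit space is one-dimensional; an orbit is singular if its codimension is at least $2$ (its dimension is smaller than that of the generic orbits). *)

(* Defs.v *)
From HB Require Import structures.
From mathcomp Require Import all_boot all_order all_algebra.
From mathcomp Require Import all_classical all_reals all_analysis.

Set Implicit Arguments.
Unset Strict Implicit.
Unset Printing Implicit Defensive.

Import Order.TTheory GRing.Theory Num.Theory.
Import numFieldNormedType.Exports.

Local Open Scope classical_set_scope.
Local Open Scope ring_scope.
Local Open Scope card_scope.

(** * Lebesgue covering dimension *)

Section CoveringDimension.
Variable X : topologicalType.

Definition open_cover (C : set (set X)) : Prop :=
  C `<=` open /\ \bigcup_(A in C) A = setT.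

Definition refines (C' C : set (set X)) : Prop :=
  forall B, C' B -> exists2 A, C A & B `<=` A.

Definition covering_dim_le (n : nat) : Prop :=
  forall C, open_cover C ->
  exists C', [/\ open_cover C', refines C' C
    & forall x, [set B | C' B /\ B x] #<= `I_n.+1].

(* [covering_dim_le] is monotone in [n], so excluding the predecessor pins the
   dimension to [n]. *)
Definition has_covering_dim (n : nat) : Prop :=
  covering_dim_le n /\ forall m, (m < n)%N -> ~ covering_dim_le m.

End CoveringDimension.

(** * Smooth maps on open subsets of R^n *)

(* Meaningful for [U] open and finite-dimensional [V]: only the values of [f]
   on [U] matter, and f is C^(k+1) iff it is differentiable with all its
   directional derivatives C^k. *)
Fixpoint C_on (R : realType) (V W : normedModType R) (k : nat) (U : set V)
    (f : V -> W) : Prop :=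
  match k with
  | 0%N => forall x, U x -> {for x, continuous f}
  | k'.+1 => (forall x, U x -> differentiable f x) /\
             forall v : V, C_on k' U (fun x => 'D_v f x)
  end.

Definition smooth_on (R : realType) (V W : normedModType R) (U : set V)
    (f : V -> W) : Prop := forall k, C_on k U f.

(** * Submanifolds of R^n *)

Section Submanifold.
Variables (R : realType) (n : nat).
Implicit Types N : set 'rV[R]_n.

Definition local_parametrization (k : nat) N (U : set 'rV[R]_k)
    (F : 'rV[R]_k -> 'rV[R]_n) : Prop :=
  [/\ open U,
      smooth_on U F,
      (forall x a, U x -> 'D_a F x = 0 -> a = 0) &
      exists W : set 'rV[R]_n, exists h : 'rV[R]_n -> 'rV[R]_k,
        [/\ open W, F @` U = N `&` W, {within N `&` W, continuous h}
          & forall x, U x -> h (F x) = x]].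

Definition embedded_submanifold (k : nat) N : Prop :=
  forall p, N p -> exists (U : set 'rV[R]_k) (F : 'rV[R]_k -> 'rV[R]_n),
    local_parametrization N U F /\ (F @` U) p.
End Submanifold.

Arguments embedded_submanifold {R n} k N.

(** * Riemannian geometry of an open subset D of R^n *)

Section Riemannian.
Variables (R : realType) (n : nat) (D : set 'rV[R]_n).
(* [g z u v] is the inner product at [z] of the tangent vectors [u] and [v]. *)
Variable g : 'rV[R]_n -> 'rV[R]_n -> 'rV[R]_n -> R.

(* Christoffel symbols of the first kind (Koszul formula for constant fields):
   for constant vector fields u, v, w this is g(nabla_u v, w) at z. *)
Definition christoffel (z u v w : 'rV[R]_n) : R :=
  2^-1 * ('D_u (fun y => g y v w) z + 'D_v (fun y => g y u w) z
          - 'D_w (fun y => g y u v) z).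

(* g(nabla_{d_a F} d_b F, w) at F x, for the Levi-Civita connection nabla. *)
Definition covariant_derivative_along (k : nat)
    (F : 'rV[R]_k -> 'rV[R]_n) (x a b : 'rV[R]_k) (w : 'rV[R]_n) : R :=
  g (F x) ('D_a (fun y => 'D_b F y) x) w
  + christoffel (F x) ('D_a F x) ('D_b F x) w.

Definition normal_vector (k : nat) (F : 'rV[R]_k -> 'rV[R]_n) (x : 'rV[R]_k)
    (xi : 'rV[R]_n) : Prop := forall c, g (F x) ('D_c F x) xi = 0.

Definition second_fundamental_form_vanishes (k : nat) (N : set 'rV[R]_n)
    : Prop :=
  forall (U : set 'rV[R]_k) (F : 'rV[R]_k -> 'rV[R]_n),
  local_parametrization N U F ->
  forall x, U x -> forall xi, normal_vector F x xi ->
  forall a b, covariant_derivative_along F x a b xi = 0.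

Definition totally_geodesic (N : set 'rV[R]_n) : Prop :=
  N `<=` D /\ exists k : nat,
    embedded_submanifold k N /\ second_fundamental_form_vanishes k N.

(* Surjectivity and smoothness of the inverse come for free for the elements of
   a group action. *)
Definition isometric_map (phi : D -> D) : Prop :=
  exists f : 'rV[R]_n -> 'rV[R]_n,
  [/\ smooth_on D f,
      forall p : D, set_val (phi p) = f (set_val p) &
      forall z u v, D z -> g (f z) ('D_u f z) ('D_v f z) = g z u v].

(* G is a bare group: its topology plays no role, and the action need not be
   effective. *)
Record isometric_action (G : groupType) := IsometricAction {
  act :> G -> D -> D;
  act1 : forall p, act 1%g p = p;
  actM : forall s t p, act (s * t)%g p = act s (act t p);
  act_isometric : forall s, isometric_map (act s) }.

Section Orbits.
Variables (G : groupType) (alpha : isometric_action G).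

Definition orbit (p : D) : set D := [set alpha s p | s in [set: G]].

Definition orbit_rel : rel D := fun p q => `[< orbit p q >].

Lemma orbit_rel_refl : reflexive orbit_rel.
Proof. by move=> p; apply/asboolP; exists 1%g => //; exact: act1. Qed.

Lemma orbit_rel_sym : symmetric orbit_rel.
Proof.
have imp p q : orbit p q -> orbit q p.
  case=> s _ <-; exists s^-1%g => //.
  by rewrite -actM mulVg act1.
by move=> p q; apply/asboolP/asboolP; exact: imp.
Qed.

Lemma orbit_rel_trans : transitive orbit_rel.
Proof.
move=> q p r /asboolP[s _ <-] /asboolP[t _ <-]; apply/asboolP.
by exists (t * s)%g => //; rewrite actM.
Qed.

Canonical orbit_equiv :=
  EquivRel orbit_rel orbit_rel_refl orbit_rel_sym orbit_rel_trans.

Definition orbit_space : topologicalType :=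
  quotient_topology {eq_quot orbit_equiv}%qT.

Definition cohomogeneity_one : Prop := has_covering_dim orbit_space 1.

(* The orbit through [p] as a subset of R^n. *)
Definition orbit_in_chart (p : D) : set 'rV[R]_n := set_val @` orbit p.

Definition singular_orbit (p : D) : Prop :=
  exists k : nat, (k + 2 <= n)%N /\ embedded_submanifold k (orbit_in_chart p).
End Orbits.

End Riemannian.

(** * The complex hyperbolic plane (ball model) *)

Section ComplexHyperbolicPlane.
Variable R : realType.

(* C^2 is 'rV[R]_(2 + 2): x + i y is [row_mx x y] with x, y : 'rV[R]_2. *)
Definition dot (u v : 'rV[R]_(2 + 2)) : R := \sum_i u 0 i * v 0 i.

Definition mul_i (u : 'rV[R]_(2 + 2)) : 'rV[R]_(2 + 2) :=
  row_mx (- rsubmx u) (lsubmx u).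

Definition CH2 : set 'rV[R]_(2 + 2) := [set z | dot z z < 1].

(* The Bergman metric, of constant holomorphic sectional curvature -1:
   4 Re((1 - |z|^2) <u, v> + <u, z> <z, v>) / (1 - |z|^2)^2, where the real
   part of <u, z> <z, v> is (u.z)(v.z) + (u.iz)(v.iz). *)
Definition bergman (z u v : 'rV[R]_(2 + 2)) : R :=
  4 * ((1 - dot z z) * dot u v
       + (dot u z * dot v z + dot u (mul_i z) * dot v (mul_i z)))
  / (1 - dot z z) ^+ 2.

End ComplexHyperbolicPlane.

Arguments CH2 : clear implicits.
Arguments bergman : clear implicits.

(* Main.v *)
(* A ball automorphism moves a point of the orbit to the origin. An isometry of
   the ball fixing the origin is unitary or antiunitary, because artanh of a
   linear coordinate does not increase distances. Let K be the closure of the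
   isotropy group at the origin and nu the normal space of the orbit.

   K is transitive on the unit sphere of nu: otherwise the distance to the orbit
   and the distance to the orbit of a normal vector would separate the opposite
   sides of a square mapped to the orbit space, which by Sperner's lemma is
   impossible in covering dimension one. So a 1-dimensional orbit, with tangent
   line R v, cannot exist: K preserves the two lines R v and R i v.

   A 2-dimensional orbit has an element of K equal to -1 on nu. If nu is not a
   complex line, this element is 1 or -1 on the tangent plane as well, and the
   equivariance of the second fundamental form makes it vanish. If nu is a complex
   line, the orbit is a complex curve and its second fundamental form is complex
   bilinear; if it does not vanish, K contains the maps (c, c^2) with |c| = 1 in
   coordinates adapted to the splitting tangent plus normal. The same holds at all
   points of the orbit. Comparing, at the image z of a point x under (c, c^2), the
   tangent direction of the rotations about the origin with that of the rotations
   about x gives two vectors on one complex line; but their determinant is a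
   nonzero multiple of (1 - c)^3. *)

Require Import Defs.
From HB Require Import structures.
From mathcomp Require Import all_boot all_order all_algebra.
From mathcomp Require Import all_classical all_reals all_analysis.
From mathcomp Require Import complex ring lra.

Set Implicit Arguments.
Unset Strict Implicit.
Unset Printing Implicit Defensive.

Import Order.TTheory GRing.Theory Num.Theory.
Import numFieldNormedType.Exports.

Local Open Scope classical_set_scope.
Local Open Scope ring_scope.
Local Open Scope complex_scope.

(** * The Hermitian form on C^2 *)

(** The group carries no topology, so no one-parameter subgroups, Killing fields or slices are at
    hand. They are replaced by linear isometries that are uniform limits of group elements on the
    ball; such a limit need not come from the group and is only known to preserve the closure of the
    orbit. Every geometric statement is therefore put in a form that survives limits: normal
    components are bounded by the square of the distance to the base point, second fundamental forms
    are compared through 2-jets, and tangent vectors are limits of secants. Secants may be rescaled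
    by complex numbers because a rotation (c, c^2) with c near 1 moves a point by nearly c - 1 times
    a fixed vector. The maps (c, c^2) arise by squaring: an isotropy element that multiplies the
    normal line by d multiplies the tangent line by a square root of d, so its square is (d, d^2)
    and no root has to be chosen. Recentring also removes the connection: the first derivatives of
    the Bergman metric vanish at the origin, so the covariant derivative becomes an ordinary second
    derivative there. *)

HB.lock Definition cscale (R : realType) (c : R[i]) (u : 'rV[R]_(2 + 2)) :
  'rV[R]_(2 + 2) := complex.Re c *: u + complex.Im c *: mul_i u.

Section Hermitian.
Variable R : realType.
Local Notation V := 'rV[R]_(2 + 2).
Implicit Types (u v w z p : V) (a : R) (c d : R[i]).

Lemma dotC u v : dot u v = dot v u.
Proof. by apply: eq_bigr => i _; rewrite mulrC. Qed.

Lemma dotDl u v w : dot (u + v) w = dot u w + dot v w.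
Proof. by rewrite -big_split; apply: eq_bigr => i _; rewrite mxE mulrDl. Qed.

Lemma dotZl a u w : dot (a *: u) w = a * dot u w.
Proof. by rewrite /dot mulr_sumr; apply: eq_bigr => i _; rewrite mxE mulrA. Qed.

Lemma dotDr w u v : dot w (u + v) = dot w u + dot w v.
Proof. by rewrite dotC dotDl !(dotC w). Qed.

Lemma dotZr a w u : dot w (a *: u) = a * dot w u.
Proof. by rewrite dotC dotZl (dotC w). Qed.

Lemma dotNl u w : dot (- u) w = - dot u w.
Proof. by rewrite -scaleN1r dotZl mulN1r. Qed.

Lemma dotNr w u : dot w (- u) = - dot w u.
Proof. by rewrite -scaleN1r dotZr mulN1r. Qed.

Lemma dotBl u v w : dot (u - v) w = dot u w - dot v w.
Proof. by rewrite dotDl dotNl. Qed.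

Lemma dotBr w u v : dot w (u - v) = dot w u - dot w v.
Proof. by rewrite dotDr dotNr. Qed.

Lemma dot0l u : dot 0 u = 0.
Proof. by rewrite -(scale0r 0) dotZl mul0r. Qed.

Lemma dot0r u : dot u 0 = 0.
Proof. by rewrite dotC dot0l. Qed.

Definition dot_simp := (dotDl, dotDr, dotBl, dotBr, dotNl, dotNr, dotZl, dotZr,
  dot0l, dot0r).

Lemma dot_ge0 u : 0 <= dot u u.
Proof. by apply: sumr_ge0 => i _; rewrite -expr2 sqr_ge0. Qed.

Lemma dot_eq0 u : (dot u u == 0) = (u == 0).
Proof.
apply/idP/eqP => [|->]; last by rewrite dot0l.
rewrite psumr_eq0 => [/allP h|i _]; last by rewrite -expr2 sqr_ge0.
apply/rowP => i; rewrite mxE.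
by have := h i (mem_index_enum i); rewrite -expr2 sqrf_eq0 => /eqP.
Qed.

Lemma dot_gt0 u : (0 < dot u u) = (u != 0).
Proof. by rewrite lt_def dot_ge0 andbT dot_eq0. Qed.

Lemma dot_inj u v : (forall w, dot w u = dot w v) -> u = v.
Proof.
by move=> h; apply/eqP; rewrite -subr_eq0 -dot_eq0 dotBr h subrr.
Qed.

Lemma dot_split u v :
  dot u v = \sum_i lsubmx u 0 i * lsubmx v 0 i
          + \sum_i rsubmx u 0 i * rsubmx v 0 i.
Proof.
by rewrite /dot big_split_ord; congr (_ + _); apply: eq_bigr => i _; rewrite !mxE.
Qed.

Lemma mul_iD u v : mul_i (u + v) = mul_i u + mul_i v.
Proof. by rewrite /mul_i !linearD /= add_row_mx. Qed.

Lemma mul_iZ a u : mul_i (a *: u) = a *: mul_i u.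
Proof. by rewrite /mul_i !linearZ /= scale_row_mx scalerN. Qed.

Lemma mul_iN u : mul_i (- u) = - mul_i u.
Proof. by rewrite -scaleN1r mul_iZ scaleN1r. Qed.

Lemma mul_iB u v : mul_i (u - v) = mul_i u - mul_i v.
Proof. by rewrite mul_iD mul_iN. Qed.

Lemma mul_i0 : mul_i 0 = 0 :> V.
Proof. by rewrite -(scale0r (0 : V)) mul_iZ !scale0r. Qed.

Lemma mul_iK u : mul_i (mul_i u) = - u.
Proof.
by rewrite /mul_i row_mxKr row_mxKl -[in RHS](hsubmxK u) opp_row_mx.
Qed.

Lemma dot_mul_i u v : dot (mul_i u) (mul_i v) = dot u v.
Proof.
rewrite !dot_split /mul_i !row_mxKl !row_mxKr addrC; congr (_ + _).
by apply: eq_bigr => i _; rewrite !mxE mulrNN.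
Qed.

Lemma dotJl u v : dot (mul_i u) v = - dot u (mul_i v).
Proof. by rewrite -dot_mul_i mul_iK dotNl. Qed.

Lemma dotJJ u : dot u (mul_i u) = 0.
Proof.
apply/eqP; have := dotJl u u; rewrite dotC => /eqP.
by rewrite -addr_eq0 -mulr2n mulrn_eq0.
Qed.

(** The standard Hermitian form of C^2, linear in the first and conjugate linear in the second
    argument. *)
Definition herm u v : R[i] := dot u v +i* dot u (mul_i v).

Lemma hermDl u v w : herm (u + v) w = herm u w + herm v w.
Proof. by rewrite /herm !dotDl. Qed.

Lemma hermC u v : herm v u = conjc (herm u v).
Proof. by rewrite /herm [dot v u]dotC [dot v _]dotC dotJl. Qed.

Lemma hermDr u v w : herm w (u + v) = herm w u + herm w v.
Proof. by rewrite /herm mul_iD !dotDr. Qed.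

Lemma conj_herm u v : conjc (herm u v) = herm v u.
Proof. by rewrite [RHS]hermC. Qed.

Lemma hermNl u v : herm (- u) v = - herm u v.
Proof. by rewrite /herm !dotNl. Qed.

Lemma hermNr u v : herm u (- v) = - herm u v.
Proof. by rewrite /herm mul_iN !dotNr. Qed.

Lemma hermBl u v w : herm (u - v) w = herm u w - herm v w.
Proof. by rewrite hermDl hermNl. Qed.

Lemma hermBr u v w : herm w (u - v) = herm w u - herm w v.
Proof. by rewrite hermDr hermNr. Qed.

Lemma hermCl c u v : herm (cscale c u) v = c * herm u v.
Proof.
rewrite /herm cscale.unlock !dot_simp !dotJl mul_iK dotNr; case: c => x y /=.
by apply/eqP; rewrite eq_complex /=; apply/andP; split; apply/eqP; ring.
Qed.

Lemma conjM c d : conjc (c * d) = conjc c * conjc d. Proof. exact: rmorphM. Qed.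
Lemma conjD c d : conjc (c + d) = conjc c + conjc d. Proof. exact: rmorphD. Qed.
Lemma conjB c d : conjc (c - d) = conjc c - conjc d. Proof. exact: rmorphB. Qed.
Lemma conjN c : conjc (- c) = - conjc c. Proof. exact: rmorphN. Qed.
Lemma conjV c : conjc (c^-1) = (conjc c)^-1. Proof. exact: fmorphV. Qed.
Lemma conjR a : conjc (a%:C) = a%:C. Proof. by rewrite /= oppr0. Qed.
Lemma conj1 : conjc (1 : R[i]) = 1. Proof. exact: rmorph1. Qed.

Definition conj_simp := (conjM, conjD, conjB, conjN, conjV, conj1).

Lemma hermCr c u v : herm u (cscale c v) = conjc c * herm u v.
Proof. rewrite hermC hermCl conjM.
by rewrite -hermC. Qed.

Lemma hermZl a u v : herm (a *: u) v = a%:C * herm u v.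
Proof. by rewrite -hermCl cscale.unlock /= scale0r addr0. Qed.

Lemma hermZr a u v : herm u (a *: v) = a%:C * herm u v.
Proof. by rewrite /herm mul_iZ !dotZr; apply/eqP; rewrite eq_complex /= !mul0r subr0 addr0 !eqxx. Qed.

Lemma herm0l u : herm 0 u = 0.
Proof. by rewrite /herm !dot0l. Qed.

Lemma herm0r u : herm u 0 = 0.
Proof. by rewrite /herm mul_i0 !dot0r. Qed.

Lemma hermuu u : herm u u = (dot u u)%:C.
Proof. by rewrite /herm dotJJ. Qed.

Lemma hermuu_eq0 u : (herm u u == 0) = (u == 0).
Proof. by rewrite hermuu -dot_eq0 eq_complex /= eqxx andbT. Qed.

Definition herm_simp := (hermDl, hermDr, hermBl, hermBr, hermNl, hermNr,
  hermCl, hermCr, hermZl, hermZr, herm0l, herm0r).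

(** Extensionality through the form: pairing with an arbitrary vector turns a vector identity with
    complex coefficients into a [ring] or [field] goal in [R[i]]. [dot_inj] plays the same part for
    real coefficients. *)
Lemma herm_inj u v : (forall w, herm u w = herm v w) -> u = v.
Proof.
by move=> h; apply/eqP; rewrite -subr_eq0 -hermuu_eq0 hermBl h subrr.
Qed.

Lemma mul_iE u : mul_i u = cscale 'i u.
Proof. by rewrite cscale.unlock /= scale0r add0r scale1r. Qed.

Lemma hermJl u v : herm (mul_i u) v = 'i * herm u v.
Proof. by rewrite mul_iE hermCl. Qed.

Lemma cscaleDl c d u : cscale (c + d) u = cscale c u + cscale d u.
Proof. by apply: herm_inj => w; rewrite !herm_simp mulrDl. Qed.

Lemma cscaleDr c u v : cscale c (u + v) = cscale c u + cscale c v.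
Proof. by apply: herm_inj => w; rewrite !herm_simp mulrDr. Qed.

Lemma cscaleA c d u : cscale c (cscale d u) = cscale (c * d) u.
Proof. by apply: herm_inj => w; rewrite !herm_simp mulrA. Qed.

Lemma cscale1 u : cscale 1 u = u.
Proof. by apply: herm_inj => w; rewrite !herm_simp mul1r. Qed.

Lemma cscale0l u : cscale 0 u = 0.
Proof. by apply: herm_inj => w; rewrite !herm_simp mul0r. Qed.

Lemma cscale0r c : cscale c 0 = 0.
Proof. by apply: herm_inj => w; rewrite !herm_simp mulr0. Qed.

Lemma cscaleR a u : cscale a%:C u = a *: u.
Proof. by rewrite cscale.unlock /= scale0r addr0. Qed.

(* Cauchy-Schwarz for the Hermitian form, through the Gram determinant. *)
Lemma sqr_herm_le u v : complex.Re (herm u v) ^+ 2 + complex.Im (herm u v) ^+ 2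
  <= dot u u * dot v v.
Proof.
have [->|v0] := eqVneq v 0.
  by rewrite herm0r !dot0r /= mulr0 expr0n addr0.
have vp : 0 < dot v v by rewrite dot_gt0.
(* This vector is |v|^2 times the component of [u] orthogonal to the complex line of [v]. *)
have := dot_ge0 (dot v v *: u - cscale (herm u v) v).
rewrite /herm cscale.unlock /= !dot_simp !dotJl !mul_iK !dot_simp !dotJJ.
have -> : dot v (mul_i u) = - dot u (mul_i v) by rewrite dotC dotJl.
rewrite (dotC v u).
set x := dot u v; set y := dot u (mul_i v); set n := dot u u; set m := dot v v in vp *.
move=> h; rewrite -(ler_pM2l vp).
move: h; nra.
Qed.

Lemma dot_CS u v : dot u v ^+ 2 <= dot u u * dot v v.
Proof.
apply: le_trans (sqr_herm_le u v) => /=.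
by rewrite lerDl sqr_ge0.
Qed.

Definition nrm u := Num.sqrt (dot u u).

Lemma nrm_ge0 u : 0 <= nrm u. Proof. exact: sqrtr_ge0. Qed.

Lemma sqr_nrm u : nrm u ^+ 2 = dot u u.
Proof. by rewrite sqr_sqrtr // dot_ge0. Qed.

Lemma dot_le_nrm u v : `|dot u v| <= nrm u * nrm v.
Proof.
rewrite -ler_sqr ?nnegrE ?mulr_ge0 ?nrm_ge0 //.
by rewrite real_normK ?num_real // exprMn !sqr_nrm dot_CS.
Qed.

Lemma nrmD u v : nrm (u + v) <= nrm u + nrm v.
Proof.
rewrite -ler_sqr ?nnegrE ?addr_ge0 ?nrm_ge0 //.
rewrite sqrrD !sqr_nrm !dot_simp (dotC v u).
have := le_trans (ler_norm _) (dot_le_nrm u v); lra.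
Qed.

Lemma nrm0 : nrm 0 = 0. Proof. by rewrite /nrm dot0l sqrtr0. Qed.

Lemma nrm_eq0 u : (nrm u == 0) = (u == 0).
Proof. by rewrite -sqrf_eq0 sqr_nrm dot_eq0. Qed.

Lemma nrm_gt0 u : (0 < nrm u) = (u != 0).
Proof. by rewrite lt_def nrm_ge0 andbT nrm_eq0. Qed.

Lemma nrmN u : nrm (- u) = nrm u.
Proof. by rewrite /nrm dotNl dotNr opprK. Qed.

Lemma nrmZ a u : nrm (a *: u) = `|a| * nrm u.
Proof. by rewrite /nrm dotZl dotZr mulrA -expr2 sqrtrM ?sqr_ge0 // sqrtr_sqr. Qed.

Lemma nrmB u v : nrm (u - v) = nrm (v - u).
Proof. by rewrite -nrmN opprB. Qed.

Lemma nrm_triangle v u w : nrm (u - w) <= nrm (u - v) + nrm (v - w).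
Proof. by apply: le_trans (nrmD _ _); rewrite addrA subrK. Qed.

(** A modulus with values in [R], comparable with [nrm]; [cnE] ties it to the norm of [R[i]]. *)
Definition cn c : R := Num.sqrt (complex.Re c ^+ 2 + complex.Im c ^+ 2).

Lemma cnE c : (cn c)%:C = `|c|. Proof. by rewrite normc_def. Qed.

Lemma cnM c d : cn (c * d) = cn c * cn d.
Proof. by apply: (@complexI R); rewrite rmorphM /= !cnE normrM. Qed.

Lemma cnD c d : cn (c + d) <= cn c + cn d.
Proof. by rewrite -lecR rmorphD /= !cnE ler_normD. Qed.

Lemma cn_ge0 c : 0 <= cn c. Proof. exact: sqrtr_ge0. Qed.

Lemma cn_eq0 c : (cn c == 0) = (c == 0).
Proof. by rewrite -(inj_eq (@complexI R)) cnE normr_eq0. Qed.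

Lemma cn_gt0 c : (0 < cn c) = (c != 0).
Proof. by rewrite lt_def cn_ge0 andbT cn_eq0. Qed.

Lemma cn1 : cn 1 = 1. Proof. by apply: (@complexI R); rewrite cnE normr1. Qed.

Lemma cnN c : cn (- c) = cn c.
Proof. by apply: (@complexI R); rewrite !cnE normrN. Qed.

Lemma cnV c : cn c^-1 = (cn c)^-1.
Proof. by apply: (@complexI R); rewrite fmorphV /= !cnE normfV. Qed.

Lemma cnJ c : cn (conjc c) = cn c.
Proof. by rewrite /cn; case: c => x y /=; rewrite sqrrN. Qed.

Lemma cnR a : cn a%:C = `|a|.
Proof. by rewrite /cn /= expr0n addr0 sqrtr_sqr. Qed.

Lemma sqr_cn c : (cn c ^+ 2)%:C = c * conjc c.
Proof.
rewrite rmorphXn /= cnE -add_Re2_Im2; case: c => x y /=.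
by apply/eqP; rewrite eq_complex /=; apply/andP; split; apply/eqP; ring.
Qed.

Lemma Re_le_cn c : `|complex.Re c| <= cn c.
Proof.
rewrite -ler_sqr ?nnegrE ?cn_ge0 // real_normK ?num_real // /cn sqr_sqrtr.
  by rewrite lerDl sqr_ge0.
by rewrite addr_ge0 ?sqr_ge0.
Qed.

Lemma cn_herm u v : cn (herm u v) <= nrm u * nrm v.
Proof.
rewrite -ler_sqr ?nnegrE ?mulr_ge0 ?nrm_ge0 ?cn_ge0 //.
rewrite exprMn !sqr_nrm /cn sqr_sqrtr ?sqr_herm_le //.
by rewrite addr_ge0 ?sqr_ge0.
Qed.

Lemma nrm_cscale c u : nrm (cscale c u) = cn c * nrm u.
Proof.
apply/eqP; rewrite -(@eqrXn2 _ 2) ?mulr_ge0 ?cn_ge0 ?nrm_ge0 // exprMn !sqr_nrm.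
rewrite -(inj_eq (@complexI R)) -hermuu hermCl hermCr hermuu rmorphM /= sqr_cn.
by rewrite mulrA.
Qed.
End Hermitian.

(** * Automorphisms of the ball *)

(* [Lm p] is the identity on the complex line of [p] and [sqrt (1 - |p|^2)] on its
   orthogonal complement, written without dividing by [|p|^2]. *)
HB.lock Definition Lm (R : realType) (p u : 'rV[R]_(2 + 2)) : 'rV[R]_(2 + 2) :=
  Num.sqrt (1 - dot p p) *: u
  + cscale (((1 + Num.sqrt (1 - dot p p))^-1)%:C * herm u p) p.

(** The negative of the classical involutive automorphism exchanging 0 and [p]. With this sign it
    sends [p] to 0, and its inverse is [moeb (- p)]. *)
HB.lock Definition moeb (R : realType) (p z : 'rV[R]_(2 + 2)) : 'rV[R]_(2 + 2) :=
  cscale (1 - herm z p)^-1 (Lm p (z - p)).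

HB.lock Definition dmoeb (R : realType) (p z u : 'rV[R]_(2 + 2)) :
  'rV[R]_(2 + 2) :=
  cscale (1 - herm z p)^-1 (Lm p u + cscale (herm u p) (moeb p z)).

Section Moebius.
Variable R : realType.
Local Notation V := 'rV[R]_(2 + 2).
Implicit Types (u v w z p : V) (a : R) (c d : R[i]).

Lemma ballE z : CH2 R z = (dot z z < 1). Proof. by []. Qed.

Lemma nrm_lt1 z : CH2 R z -> nrm z < 1.
Proof.
by rewrite ballE => h; rewrite -(ltr_sqr (nrm_ge0 _)) ?nnegrE // expr1n sqr_nrm.
Qed.

Lemma ballN p : CH2 R p -> CH2 R (- p).
Proof. by rewrite !ballE dotNl dotNr opprK. Qed.

Lemma ball0 : CH2 R 0. Proof. by rewrite ballE dot0l. Qed.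

Lemma cn_lb z p : 1 - nrm z * nrm p <= cn (1 - herm z p).
Proof.
have h1 := le_trans (ler_norm _) (Re_le_cn (1 - herm z p)).
apply: le_trans h1; rewrite raddfB /= lerB //.
exact: le_trans (ler_norm _) (dot_le_nrm z p).
Qed.

Lemma den_gt0 z p : CH2 R z -> CH2 R p -> 0 < 1 - nrm z * nrm p.
Proof.
move=> /nrm_lt1 hz /nrm_lt1 hp; rewrite subr_gt0.
by rewrite mulr_ilt1 ?nrm_ge0.
Qed.

Lemma den_neq0 z p : CH2 R z -> CH2 R p -> 1 - herm z p != 0.
Proof.
by move=> hz hp; rewrite -cn_gt0 (lt_le_trans _ (cn_lb z p)) // den_gt0.
Qed.

Definition ms p : R := Num.sqrt (1 - dot p p).

Lemma ms_gt0 p : CH2 R p -> 0 < ms p.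
Proof. by rewrite ballE => h; rewrite sqrtr_gt0 subr_gt0. Qed.

Lemma ms_sqr p : CH2 R p -> ms p ^+ 2 = 1 - dot p p.
Proof. by rewrite ballE => h; rewrite sqr_sqrtr // subr_ge0 ltW. Qed.

Lemma LmE p u : Lm p u = ms p *: u + cscale (((1 + ms p)^-1)%:C * herm u p) p.
Proof. by rewrite Lm.unlock. Qed.

Lemma moebE p z : moeb p z = cscale (1 - herm z p)^-1 (Lm p (z - p)).
Proof. by rewrite moeb.unlock. Qed.

Lemma dmoebE p z u : dmoeb p z u =
  cscale (1 - herm z p)^-1 (Lm p u + cscale (herm u p) (moeb p z)).
Proof. by rewrite dmoeb.unlock. Qed.

Lemma LmD p u v : Lm p (u + v) = Lm p u + Lm p v.
Proof. by rewrite !LmE scalerDr hermDl mulrDr cscaleDl addrACA. Qed.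

Lemma LmC p c u : Lm p (cscale c u) = cscale c (Lm p u).
Proof.
apply: herm_inj => w; rewrite !LmE !herm_simp; ring.
Qed.

Lemma LmR p a u : Lm p (a *: u) = a *: Lm p u.
Proof. by rewrite -cscaleR LmC cscaleR. Qed.

Lemma LmN p u : Lm p (- u) = - Lm p u.
Proof. by rewrite -scaleN1r LmR scaleN1r. Qed.

Lemma LmB p u v : Lm p (u - v) = Lm p u - Lm p v.
Proof. by rewrite LmD LmN. Qed.

Lemma Lm_opp p u : Lm (- p) u = Lm p u.
Proof.
have e : ms (- p) = ms p by rewrite /ms dotNl dotNr opprK.
by apply: herm_inj => w; rewrite !LmE e !herm_simp; ring.
Qed.

Section Base.
Variable p : V.
Hypothesis hp : CH2 R p.
Let s := ms p.
Let s0 : (1 + s)%:C != 0 :> R[i].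
Proof.
by rewrite eq_complex /= negb_and gt_eqF // ltr_wpDl // ms_gt0.
Qed.
Let S : R[i] := s%:C.
Let S0 : 1 + S != 0. Proof. by have := s0; rewrite rmorphD rmorph1. Qed.
Let hpp : herm p p = 1 - S ^+ 2.
Proof. by rewrite hermuu -rmorphXn /= ms_sqr // rmorphB rmorph1 opprB addrC subrK. Qed.
Let LE u : Lm p u = cscale S u + cscale ((1 + S)^-1 * herm u p) p.
Proof. by rewrite cscaleR LmE fmorphV rmorphD rmorph1. Qed.

Definition mdel : R[i] := (1 - dot p p)%:C.
Let deltaE : mdel = S ^+ 2.
Proof. by rewrite -rmorphXn /= ms_sqr. Qed.

Lemma mdel_neq0 : mdel != 0.
Proof. by rewrite /mdel eq_complex /= negb_and gt_eqF // subr_gt0 -ballE. Qed.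

Let conjS : conjc S = S. Proof. exact: conjR. Qed.

Lemma herm_Lm u v : herm (Lm p u) (Lm p v) = mdel * herm u v + herm u p * herm p v.
Proof.
rewrite deltaE !LE !herm_simp !conj_simp conjS conj_herm hpp; field.
exact: S0.
Qed.

Lemma herm_Lm_p u : herm (Lm p u) p = herm u p.
Proof. by rewrite LE !herm_simp hpp; field; exact: S0. Qed.

Lemma Lm_p : Lm p p = p.
Proof.
apply: herm_inj => w; rewrite LE !herm_simp hpp; field; exact: S0.
Qed.

Lemma LmK u : Lm p (Lm p u) = cscale mdel u + cscale (herm u p) p.
Proof.
apply: herm_inj => w; rewrite [Lm p (Lm p u)]LE !herm_simp  herm_Lm_p LE deltaE !herm_simp.
by field; exact: S0.
Qed.

Lemma Lm_inj u : Lm p u = 0 -> u = 0.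
Proof.
move=> h; apply/eqP; rewrite -hermuu_eq0.
have h1 : herm u p = 0 by rewrite -herm_Lm_p h herm0l.
have := herm_Lm u u; rewrite h herm0l h1 mul0r addr0 => /esym/eqP.
by rewrite mulf_eq0 (negbTE mdel_neq0).
Qed.

Lemma herm_moeb_p z : CH2 R z ->
  herm (moeb p z) p = (herm z p - 1 + mdel) / (1 - herm z p).
Proof.
move=> hz; rewrite !moebE !herm_simp  !(herm_Lm_p, herm_simp) hpp deltaE.
by field; exact: den_neq0.
Qed.

(** The classical transformation rule of 1 - <z, w>. On the diagonal it shows that the ball is
    preserved; it is also behind the invariance of the metric and of the two-point function [Bq]. *)
Lemma moeb_den z w : CH2 R z -> CH2 R w ->
  1 - herm (moeb p z) (moeb p w) =
  mdel * (1 - herm z w) / ((1 - herm z p) * (1 - herm p w)).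
Proof.
move=> hz hw; rewrite !moebE !herm_simp herm_Lm !herm_simp !conj_simp conj_herm hpp deltaE.
field; rewrite ?den_neq0 //=.
Qed.

Lemma moeb_ball z : CH2 R z -> CH2 R (moeb p z).
Proof.
move=> hz; have := moeb_den hz hz; rewrite hermuu -[herm p z]conj_herm.
have -> : 1 - conjc (herm z p) = conjc (1 - herm z p) by rewrite conjB conj1.
rewrite -sqr_cn hermuu /mdel -(rmorph1 (real_complex R)) -!rmorphB.
rewrite -rmorphM -fmorphV -rmorphM => /(@complexI R) h.
rewrite ballE -subr_gt0 h divr_gt0 ?mulr_gt0 ?subr_gt0 -?ballE //.
all: by rewrite cn_gt0 rmorph1 den_neq0.
Qed.

(** An exact increment: it differs from the derivative [dmoeb p z u] only by the denominator, taken
    at [z + u] instead of [z]. *)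
Lemma moeb_incr z u : CH2 R z -> CH2 R (z + u) ->
  moeb p (z + u) - moeb p z =
  cscale (1 - herm (z + u) p)^-1 (Lm p u + cscale (herm u p) (moeb p z)).
Proof.
move=> hz hzu; have h1 := den_neq0 hz hp; have h2 := den_neq0 hzu hp.
apply: herm_inj => w; rewrite !moebE !LmD !LmN !herm_simp.
by field; rewrite h1 /=; move: h2; rewrite hermDl.
Qed.

Lemma moebK z : CH2 R z -> moeb (- p) (moeb p z) = z.
Proof.
move=> hz; have hd := den_neq0 hz hp.
rewrite [moeb (- p) _]moebE Lm_opp hermNr !opprK LmD Lm_p herm_moeb_p // moebE.
rewrite LmC LmK; apply: herm_inj => w; rewrite !herm_simp hpp !deltaE; field.
by rewrite hd (_ : _ + _ = mdel) ?mdel_neq0 // deltaE; ring.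
Qed.

Lemma moeb_pp : moeb p p = 0.
Proof. by rewrite moebE subrr -(cscale0r 0) LmC !cscale0l cscale0r. Qed.

Lemma moeb_p0 : moeb p 0 = - p.
Proof. by rewrite moebE sub0r LmN Lm_p herm0l subr0 invr1 cscale1. Qed.

Lemma herm_Lm_moeb z u : CH2 R z -> herm (Lm p u) (moeb p z) =
  mdel * herm u z / (1 - herm p z) - herm u p.
Proof.
move=> hz; rewrite moebE !herm_simp herm_Lm !herm_simp !conj_simp conj_herm hpp deltaE.
by field; rewrite den_neq0.
Qed.

Lemma herm_moeb_Lm z u : CH2 R z -> herm (moeb p z) (Lm p u) =
  mdel * herm z u / (1 - herm z p) - herm p u.
Proof.
move=> hz; rewrite hermC herm_Lm_moeb // !conj_simp !conj_herm.
by rewrite conjR.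
Qed.

(** The numerator of the Bergman metric, in Hermitian form, is multiplied by the square of the
    factor by which [moeb_den] multiplies 1 - |z|^2; hence the quotient is invariant. *)
Lemma dmoeb_form z u v : CH2 R z ->
  (1 - herm (moeb p z) (moeb p z)) * herm (dmoeb p z u) (dmoeb p z v) +
  herm (dmoeb p z u) (moeb p z) * herm (moeb p z) (dmoeb p z v) =
  (mdel / ((1 - herm z p) * (1 - herm p z))) ^+ 2 *
  ((1 - herm z z) * herm u v + herm u z * herm z v).
Proof.
move=> hz; have hd := den_neq0 hz hp; have hd' := den_neq0 hp hz.
rewrite !dmoebE !herm_simp herm_Lm herm_Lm_moeb // herm_moeb_Lm //.
rewrite !conj_simp !conj_herm -[herm (moeb p z) (moeb p z)](subKr 1) moeb_den //.
by field; rewrite hd hd'.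
Qed.
End Base.

Lemma bergmanE z u v : bergman R z u v =
  4 * complex.Re ((1 - herm z z) * herm u v + herm u z * herm z v)
  / (1 - dot z z) ^+ 2.
Proof.
rewrite /bergman hermuu -(rmorph1 (real_complex R)) -rmorphB /herm /=.
rewrite (dotC z v) (dotC z (mul_i v)) dotJl; congr (4 * _ / _); ring.
Qed.

Lemma Re_realM a c : complex.Re (a%:C * c) = a * complex.Re c.
Proof. by case: c => x y /=; rewrite mul0r subr0. Qed.

Lemma bergman_dmoeb p z u v : CH2 R p -> CH2 R z ->
  bergman R (moeb p z) (dmoeb p z u) (dmoeb p z v) = bergman R z u v.
Proof.
move=> hp hz; rewrite !bergmanE dmoeb_form //.
have e : 1 - herm p z = conjc (1 - herm z p) by rewrite conjB conj1 conj_herm.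
have d0 : cn (1 - herm z p) != 0 by rewrite cn_eq0 den_neq0.
have h := moeb_den hp hz hz; move: h; rewrite e -sqr_cn !hermuu /mdel.
rewrite -(rmorph1 (real_complex R)) -!rmorphB -!fmorphV -!rmorphM => /(@complexI R) ->.
rewrite -rmorphXn Re_realM; field.
rewrite d0 /= !lt0r_neq0 // subr_gt0 -?ballE //.
Qed.
End Moebius.

(** * Derivatives with explicit moduli *)

Lemma differentiable_eps (R : numFieldType) (V W : normedModType R) (f : V -> W) x :
  differentiable f x -> forall e : R, 0 < e -> exists2 d : R, 0 < d &
  forall u, `|u| < d -> `|f (x + u) - f x - 'd f x u| <= e * `|u|.
Proof.
move=> df e e0.
have /diff_locally/eqaddoP/(_ e e0) := df.
move=> /nbhs_ballP[d /= d0 h]; exists d => // u ud.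
have := h u; rewrite -ball_normE /= sub0r normrN => /(_ ud).
by rewrite !fctE /= [u + x]addrC opprD addrA.
Qed.

Lemma is_derive_eps (R : realType) (f : R -> R) x a :
  (forall e : R, 0 < e -> exists2 d : R, 0 < d &
    forall h, `|h| < d -> `|f (x + h) - f x - a * h| <= e * `|h|) ->
  is_derive x 1 f a.
Proof.
move=> hf.
have h : h^-1 *: ((f \o shift x) (h *: 1) - f x) @[h --> 0^'] --> a.
  apply/cvgrPdist_le => e e0; have [d d0 hd] := hf e e0.
  rewrite near_withinE; apply/nbhs_ballP; exists d => // h.
  rewrite -ball_normE /= sub0r normrN => hh h0.
  have := hd h hh; rewrite -[h *: 1]/(h * 1) mulr1 [x + h]addrC.
  have hp : 0 < `|h| by rewrite normr_gt0.
  have -> : a - h^-1 *: (f (h + x) - f x) = - ((f (h + x) - f x - a * h) / h).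
    by rewrite -[_ *: _]/(_ * _); field.
  by rewrite normrN normrM normfV ler_pdivrMr.
by split; [apply/cvg_ex; exists a | apply: cvg_lim].
Qed.

Lemma is_derive_epsP (R : realType) (f : R -> R) (x a : R) :
  is_derive x 1 f a ->
  forall e : R, 0 < e -> exists2 d : R, 0 < d &
    forall h, `|h| < d -> `|f (x + h) - f x - a * h| <= e * `|h|.
Proof.
move=> [df <-] e e0.
have dif : differentiable f x by apply/derivable1_diffP.
have [d d0 hd] := differentiable_eps dif e0; exists d => // h hh.
have := hd h hh; rewrite deriveE //.
have -> : 'd f x h = 'd f x 1 * h; last by [].
by rewrite -[X in 'd f x X = _](mulr1 h) -[h * 1]/(h *: 1) linearZ /= [_ *: _]mulrC.
Qed.

Section EpsCalculus.
Variable R : realType.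
Local Notation V := 'rV[R]_(2 + 2).
Implicit Types (u v w z p : V) (a e d : R) (f g M N : V -> V).

Lemma coord_le_nrm u i : `|u 0 i| <= nrm u.
Proof.
rewrite -ler_sqr ?nnegrE ?nrm_ge0 // sqr_nrm real_normK ?num_real //.
rewrite /dot (bigD1 i) //= -expr2 lerDl; apply: sumr_ge0 => j _.
by rewrite -expr2 sqr_ge0.
Qed.

Lemma norm_le_nrm u : `|u| <= nrm u.
Proof.
rewrite [`|u|]mx_normrE; apply: bigmax_le; first exact: nrm_ge0.
by move=> [i j] _ /=; rewrite (ord1 i) coord_le_nrm.
Qed.

Lemma nrm_le_norm u : nrm u <= 2 * `|u|.
Proof.
rewrite -ler_sqr ?nnegrE ?nrm_ge0 ?mulr_ge0 // sqr_nrm exprMn.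
have hc i : u 0 i * u 0 i <= `|u| ^+ 2.
  rewrite -expr2 -real_normK ?num_real // ler_sqr ?nnegrE //.
  rewrite [leRHS]mx_normrE; exact: (le_bigmax _ (fun ij : 'I_1 * 'I_(2 + 2) => `|u ij.1 ij.2|) (0, i)).
apply: le_trans (ler_sum _ (fun i _ => hc i)) _.
by rewrite sumr_const card_ord -natrX mulr_natl.
Qed.

Definition is_lin M :=
  (forall u v, M (u + v) = M u + M v) /\ (forall a u, M (a *: u) = a *: M u).

Lemma is_lin_bounded M : is_lin M -> exists2 C, 0 < C & forall u, nrm (M u) <= C * nrm u.
Proof.
move=> [hD hZ]; have h0 : M 0 = 0 by rewrite -(scale0r (0 : V)) hZ !scale0r.
exists (1 + \sum_i nrm (M (delta_mx 0 i))).
  by rewrite ltr_pwDl // sumr_ge0 // => i _; exact: nrm_ge0.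
move=> u.
have -> : M u = \sum_i u 0 i *: M (delta_mx 0 i).
  rewrite {1}(row_sum_delta u) (big_morph M hD h0).
  by apply: eq_bigr => i _; rewrite hZ.
apply: (@le_trans _ _ (\sum_i `|u 0 i| * nrm (M (delta_mx 0 i)))).
  elim/big_ind2: _ => [|x1 x2 y1 y2 h1 h2|i _]; first by rewrite nrm0.
    exact: le_trans (nrmD _ _) (lerD h1 h2).
  by rewrite nrmZ.
rewrite mulrDl mul1r mulr_suml; apply: ler_wpDl; first exact: nrm_ge0.
apply: ler_sum => i _; rewrite mulrC ler_wpM2l ?nrm_ge0 //; exact: coord_le_nrm.
Qed.

(** Frechet differentiability for [nrm] with the derivative given as a bare function, so that
    formulas such as [dmoeb p z] and composites can stand in its place without being packaged as
    linear maps. *)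
Definition hasd f z M := is_lin M /\ forall e : R, 0 < e -> exists2 d : R, 0 < d &
  forall u, nrm u < d -> nrm (f (z + u) - f z - M u) <= e * nrm u.

Lemma differentiable_hasd f z : differentiable f z -> hasd f z ('d f z).
Proof.
move=> df; split.
  by split=> [u v|a u]; [rewrite linearD|rewrite linearZ].
move=> e e0; have e2 : 0 < e / 2 by rewrite divr_gt0.
have [d d0 hd] := differentiable_eps df e2; exists d => // u hu.
have := hd u (le_lt_trans (norm_le_nrm u) hu) => h.
apply: le_trans (nrm_le_norm _) _; apply: le_trans (ler_wpM2l _ h) _ => //.
rewrite mulrA mulrCA divff // mulr1 ler_wpM2l ?(ltW e0) //; exact: norm_le_nrm.
Qed.

Lemma hasd_cont f z M : hasd f z M -> forall e : R, 0 < e -> exists2 d : R, 0 < d &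
  forall u, nrm u < d -> nrm (f (z + u) - f z) < e.
Proof.
move=> [hl hM] e e0; have [C C0 hC] := is_lin_bounded hl.
have [d d0 hd] := hM 1 ltr01.
have C1 : 0 < C + 1 by rewrite addr_gt0.
exists (Num.min d (e / (C + 1))); first by rewrite lt_min d0 divr_gt0.
move=> u; rewrite lt_min => /andP[h1 h2].
have := hd u h1; rewrite mul1r => h3.
have := nrmD (f (z + u) - f z - M u) (M u); rewrite subrK => h4.
apply: le_lt_trans h4 _; apply: le_lt_trans (lerD h3 (hC u)) _.
by move: h2; rewrite ltr_pdivlMr // mulrDr mulr1 addrC (mulrC C).
Qed.

Lemma hasd_comp f g z M N : hasd f z M -> hasd g (f z) N ->
  hasd (g \o f) z (N \o M).
Proof.
move=> hf hg; have [[lM1 lM2] hM] := hf; have [lN hN] := hg.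
split; first by case: (lN) => n1 n2; split=> [u v|a u] /=; rewrite ?lM1 ?lM2 ?n1 ?n2.
move=> e e0; have [C C0 hC] := is_lin_bounded (conj lM1 lM2).
have [K K0 hK] := is_lin_bounded lN.
have e1 : 0 < e / (2 * (C + 1)) by rewrite divr_gt0 ?mulr_gt0 ?addr_gt0.
have e2 : 0 < e / (2 * K) by rewrite divr_gt0 ?mulr_gt0.
have [d1 d10 h1] := hN _ e1.
have [d2 d20 h2] := hasd_cont hf d10.
have [d3 d30 h3] := hM _ e2.
have [d4 d40 h4] := hM _ ltr01.
exists (Num.min d2 (Num.min d3 d4)); first by rewrite !lt_min d20 d30 d40.
move=> u; rewrite !lt_min => /and3P[u2 u3 u4] /=.
set k := f (z + u) - f z.
have fe : f (z + u) = f z + k by rewrite [RHS]addrC subrK.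
have hk := h1 k (h2 u u2).
have kb : nrm k <= (C + 1) * nrm u.
  have := nrmD (k - M u) (M u); rewrite subrK => h5.
  apply: le_trans h5 _; rewrite mulrDl [leRHS]addrC; apply: lerD => //.
  exact: h4.
have hl := h3 u u3.
rewrite fe (_ : _ - _ = (g (f z + k) - g (f z) - N k) + N (k - M u)); last first.
  have -> : N (k - M u) = N k - N (M u).
    by case: lN => n1 n2; rewrite n1 -scaleN1r n2 scaleN1r.
  by rewrite subrKA.
apply: le_trans (nrmD _ _) _.
rewrite [e]splitr mulrDl; apply: lerD.
  apply: le_trans hk _; apply: le_trans (ler_wpM2l (ltW e1) kb) _.
  rewrite (_ : _ * (_ * nrm u) = e / 2 * nrm u) //; field.
  by rewrite gt_eqF // addr_gt0.
apply: le_trans (hK _) _; apply: le_trans (ler_wpM2l (ltW K0) hl) _.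
by rewrite (_ : K * _ = e / 2 * nrm u) //; field; rewrite gt_eqF.
Qed.

Lemma hasd_dot f z M v : hasd f z M -> forall w t, z = t *: w ->
  is_derive t 1 (fun s : R => dot v (f (s *: w))) (dot v (M w)).
Proof.
move=> [[_ hZ] hM] w t zE; apply: is_derive_eps => e e0.
pose q := (1 + nrm v) * (1 + nrm w).
have v1 : 0 < 1 + nrm v by rewrite ltr_pwDl ?nrm_ge0.
have w1 : 0 < 1 + nrm w by rewrite ltr_pwDl ?nrm_ge0.
have q0 : 0 < q by rewrite mulr_gt0.
have [d d0 hd] := hM (e / q) (divr_gt0 e0 q0).
exists (d / (1 + nrm w)); first by rewrite divr_gt0.
move=> h; rewrite ltr_pdivlMr // => hh.
have wh : nrm (h *: w) <= `|h| * (1 + nrm w).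
  by rewrite nrmZ ler_wpM2l // lerDr.
have := hd (h *: w) (le_lt_trans wh hh).
rewrite hZ zE -scalerDl => hb.
rewrite [_ * h]mulrC -dotZr -!dotBr.
apply: le_trans (dot_le_nrm _ _) _.
apply: le_trans (ler_wpM2l (nrm_ge0 _) hb) _.
apply: le_trans (ler_wpM2l (nrm_ge0 _) (ler_wpM2l (ltW (divr_gt0 e0 q0)) wh)) _.
have -> : nrm v * (e / q * (`|h| * (1 + nrm w))) = (nrm v / (1 + nrm v)) * (e * `|h|).
  by rewrite /q; field; rewrite !gt_eqF.
rewrite ler_piMl ?mulr_ge0 ?(ltW e0) // ler_pdivrMr // mul1r lerDr //.
Qed.

Lemma is_lin_dmoeb p z : is_lin (dmoeb p z).
Proof.
split=> [u v|a u]; rewrite !dmoebE.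
  by rewrite -cscaleDr LmD hermDl cscaleDl; congr cscale; rewrite addrACA.
by apply: herm_inj => w; rewrite LmR !herm_simp; ring.
Qed.

Let ballE z : CH2 R z = (dot z z < 1). Proof. by []. Qed.

Lemma CH2_open_nrm z : CH2 R z -> exists2 d, 0 < d & forall u, nrm u < d -> CH2 R (z + u).
Proof.
move=> /nrm_lt1 hz; exists (1 - nrm z); first by rewrite subr_gt0.
move=> u; rewrite ltrBrDl => hu.
have h := le_lt_trans (nrmD _ _) hu.
by rewrite ballE -sqr_nrm expr_lt1 ?nrm_ge0.
Qed.

Lemma hasd_moeb p z : CH2 R p -> CH2 R z -> hasd (moeb p) z (dmoeb p z).
Proof.
move=> hp hz; have lin := is_lin_dmoeb p z; split=> // e e0.
have [C C0 hC] := is_lin_bounded lin.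
have [d d0 hd] := CH2_open_nrm hz.
set m := 1 - nrm z; have m0 : 0 < m by rewrite subr_gt0 nrm_lt1.
have hp1 := nrm_lt1 hp.
exists (Num.min d (Num.min (m / 2) (e * (m / 2) / C))).
  by rewrite !lt_min d0 !(divr_gt0, mulr_gt0).
move=> u; rewrite !lt_min => /and3P[u1 u2 u3].
have hzu := hd u u1; have dz := den_neq0 hz hp; have dzu := den_neq0 hzu hp.
(* The remainder is the derivative itself times <u, p> / (1 - <z + u, p>), hence quadratic in
   [u]. *)
have -> : moeb p (z + u) - moeb p z - dmoeb p z u =
    cscale ((1 - herm (z + u) p)^-1 * herm u p) (dmoeb p z u).
  rewrite moeb_incr // dmoebE; apply: herm_inj => w; rewrite !herm_simp; field.
  by rewrite dz /= -hermDl.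
rewrite nrm_cscale cnM cnV.
have lb : m / 2 <= cn (1 - herm (z + u) p).
  apply: le_trans (cn_lb _ _).
  have h1 : nrm (z + u) * nrm p <= nrm z + nrm u.
    apply: le_trans (nrmD _ _); rewrite ler_piMr ?nrm_ge0 //; exact: ltW.
  by move: h1 u2; rewrite /m; lra.
have m2 : 0 < m / 2 by rewrite divr_gt0.
have hup : cn (herm u p) <= nrm u.
  apply: le_trans (cn_herm _ _) _; rewrite ler_piMr ?nrm_ge0 //; exact: ltW.
apply: (@le_trans _ _ ((m / 2)^-1 * nrm u * (C * nrm u))).
  apply: ler_pM => //; rewrite ?nrm_ge0 ?mulr_ge0 ?invr_ge0 ?cn_ge0 //.
  apply: ler_pM => //; rewrite ?invr_ge0 ?cn_ge0 //.
  by rewrite lef_pV2 ?posrE // (lt_le_trans m2).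
rewrite mulrA ler_wpM2r ?nrm_ge0 // -mulrA ler_pdivrMl // [leRHS]mulrC.
by rewrite -ler_pdivlMr // ltW.
Qed.

End EpsCalculus.

Section RealDerivatives.
Variables (R : realType) (f g : R -> R) (x df dg : R).
Hypotheses (hf : is_derive x 1 f df) (hg : is_derive x 1 g dg).

Lemma is_derive_mul : is_derive x 1 (fun t => f t * g t) (df * g x + f x * dg).
Proof.
have h := is_deriveM hf hg; apply: (is_derive_eq h).
by rewrite -[_ *: dg]/(_ * _) -[_ *: df]/(_ * _); ring.
Qed.

Lemma is_derive_sub : is_derive x 1 (fun t => f t - g t) (df - dg).
Proof. exact: is_deriveB. Qed.

Lemma is_derive_inv : f x != 0 -> is_derive x 1 (fun t => (f t)^-1) (- df / f x ^+ 2).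
Proof.
move=> h; have [d e] := hf; split; first exact: derivableV.
by rewrite deriveV // e -[_ *: df]/(_ * _); field.
Qed.

Lemma is_derive_scl a : is_derive x 1 (fun t : R => t * a) a.
Proof.
have h := is_deriveM (is_derive_id x (1 : R)) (is_derive_cst a x (1 : R)).
apply: (is_derive_eq h); rewrite scaler0 add0r -[_ *: 1]/(_ * _) mulr1 //.
Qed.
End RealDerivatives.

Lemma MVT_cc (R : realType) (f df : R -> R) (a b : R) : a < b ->
  (forall x, a <= x <= b -> is_derive x 1 f (df x)) ->
  exists2 c, a < c < b & f b - f a = df c * (b - a).
Proof.
move=> ab h.
have h1 x : x \in `]a, b[%R -> is_derive x 1 f (df x).
  by rewrite in_itv /= => /andP[h1 h2]; apply: h; rewrite !ltW.
have h2 : {within `[a, b], continuous f}.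
  by apply: derivable_within_continuous => x; rewrite in_itv /= => /h[].
by have [c] := MVT ab h1 h2; rewrite in_itv /= => hc e; exists c.
Qed.

Lemma is_derive_near (R : realType) (f g : R -> R) (x a b : R) :
  is_derive x 1 f a -> is_derive x 1 g b ->
  (exists2 d : R, 0 < d & forall h, `|h| < d -> f (x + h) = g (x + h)) -> a = b.
Proof.
move=> hf hg [d d0 hd]; have [_ <-] := hg.
suff: is_derive x 1 g a by case=> _ <-.
apply: is_derive_eps => e e0; have [d1 d10 h1] := is_derive_epsP hf e0.
exists (Num.min d d1); first by rewrite lt_min d0.
move=> h; rewrite lt_min => /andP[hh1 hh2].
have gx : f x = g x by have := hd 0; rewrite normr0 addr0; apply.
by rewrite -gx -hd // h1.
Qed.

(** * Isometries fixing the origin *)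

Section Classification.
Variable R : realType.
Local Notation V := 'rV[R]_(2 + 2).
Implicit Types (u v w z p eta : V) (a t : R) (H : V -> V) (DH : V -> V -> V).

Let ballE z : CH2 R z = (dot z z < 1). Proof. by []. Qed.

(* Says that [artanh (dot eta z)] is 1-Lipschitz for the metric [bergman / 4]. *)
Lemma klein_le eta u z : dot eta eta = 1 -> CH2 R z ->
  dot eta u ^+ 2 * (1 - dot z z) ^+ 2 <=
  (1 - dot eta z ^+ 2) ^+ 2 * ((1 - dot z z) * dot u u + dot u z ^+ 2).
Proof.
rewrite ballE => e1 hz.
have := dot_CS (u - dot eta u *: eta) (z - dot eta z *: eta).
have := dot_ge0 (u - dot eta u *: eta); have := dot_ge0 (z - dot eta z *: eta).
rewrite !dot_simp e1 !(dotC _ eta).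
set a := dot eta z; set b := dot eta u; set q := dot u z in hz *.
set n := dot z z in hz *; set l := dot u u.
(* [m] and [n'] are the squared lengths of the parts of [z] and [u] orthogonal to [eta], and [r] is
   the product of these parts, so that [cs] reads r^2 <= n' m. *)
pose m := n - a ^+ 2; pose k := 1 - a ^+ 2; pose n' := l - b ^+ 2; pose r := q - a * b.
have -> : n - a * a + (- (a * a) - a * - (a * 1)) = m by rewrite /m; ring.
have -> : l - b * b + (- (b * b) - b * - (b * 1)) = n' by rewrite /n'; ring.
have -> : q - a * b + (- (b * a) - b * - (a * 1)) = r by rewrite /r; ring.
move=> m0 n0 cs.
have km : 0 < k - m by rewrite /k /m; lra.
have -> : 1 - n = k - m by rewrite /k /m; ring.
have -> : l = b ^+ 2 + n' by rewrite /n'; ring.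
have -> : q = a * b + r by rewrite /r; ring.
have k0 : 0 < k by lra.
have [me|mn] := eqVneq m 0.
  have r0 : r = 0.
    by move: cs; rewrite me mulr0 => h; apply/eqP; rewrite -sqrf_eq0 eq_le h sqr_ge0.
  rewrite me r0 subr0 addr0 -subr_ge0.
  rewrite (_ : _ - _ = k ^+ 3 * n'); last by rewrite /k; ring.
  by rewrite mulr_ge0 // exprn_ge0 // ltW.
have mp : 0 < m by rewrite lt_def mn m0.
(* [E] is [m] times the last factor of the right-hand side with n' m replaced by its lower bound
   r^2; as a quadratic in [r] it is estimated by completing the square. *)
pose E := k * r ^+ 2 + 2 * m * a * b * r + m * b ^+ 2 * (1 - m).
have kE : m * b ^+ 2 * (k - m) <= k * E.
  rewrite -subr_ge0 (_ : _ - _ = (k * r + m * a * b) ^+ 2) ?sqr_ge0 //.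
  by rewrite /E /k; ring.
rewrite -(ler_pM2l mp).
apply: (@le_trans _ _ (k ^+ 2 * E)).
  apply: (@le_trans _ _ (k * (m * b ^+ 2 * (k - m)))); last first.
    by rewrite [k ^+ 2]expr2 -[leRHS]mulrA; apply: ler_wpM2l; [exact: ltW|].
  rewrite -subr_ge0 (_ : _ - _ = m ^+ 2 * b ^+ 2 * (k - m)); last by ring.
  by rewrite mulr_ge0 ?(ltW km) // mulr_ge0 ?sqr_ge0.
rewrite mulrCA ler_wpM2l ?sqr_ge0 // -subr_ge0.
rewrite (_ : _ - _ = (k - m) * (n' * m - r ^+ 2)); last by rewrite /E /k; ring.
by rewrite mulr_ge0 ?(ltW km) // subr_ge0.
Qed.

Definition isom H DH := forall z, CH2 R z -> [/\ CH2 R (H z), hasd H z (DH z) &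
  forall u v, bergman R (H z) (DH z u) (DH z v) = bergman R z u v].

Lemma ballZ t z : CH2 R z -> 0 <= t <= 1 -> CH2 R (t *: z).
Proof.
rewrite !ballE dotZl dotZr mulrA => hz /andP[t0 t1]; apply: le_lt_trans hz.
by rewrite ler_piMl ?dot_ge0 // mulr_ile1.
Qed.

Lemma bergman_ray t z : CH2 R z -> 0 <= t <= 1 ->
  bergman R (t *: z) z z = 4 * dot z z / (1 - t ^+ 2 * dot z z) ^+ 2.
Proof.
move=> hz ht; have := ballZ hz ht; rewrite ballE => h.
rewrite /bergman mul_iZ !dot_simp dotJJ; congr (_ / _); last by congr (_ ^+ 2); ring.
by ring.
Qed.

Section Ray.
Variables (H : V -> V) (DH : V -> V -> V).
Hypotheses (isoH : isom H DH) (H0 : H 0 = 0).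

Lemma isom_speed z t : CH2 R z -> 0 <= t <= 1 ->
  let c := H (t *: z) in let c' := DH (t *: z) z in
  (1 - dot c c) * dot c' c' + (dot c' c ^+ 2 + dot c' (mul_i c) ^+ 2) =
  (1 - dot c c) ^+ 2 * (dot z z / (1 - t ^+ 2 * dot z z) ^+ 2).
Proof.
move=> hz ht c c'; have htz := ballZ hz ht; have [hc _ hb] := isoH htz.
have := hb z z; rewrite bergman_ray // /bergman -/c -/c' => h.
have c0 : (1 - dot c c) ^+ 2 != 0.
  by rewrite expf_neq0 // subr_eq0 gt_eqF // -ballE.
have h4 : (4 : R) != 0 by rewrite pnatr_eq0.
apply: (mulfI h4); rewrite !expr2 -!expr2 !mulrA in h *.
move: h => /(canRL (mulfVK c0)) ->.
by ring.
Qed.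

(** [klein_le] applied to the velocity of the image of a ray, whose length the isometry prescribes.
    The last factor is the derivative of artanh (t |z|). *)
Lemma isom_dir_le z t eta : CH2 R z -> 0 <= t <= 1 -> dot eta eta = 1 ->
  dot eta (DH (t *: z) z) <=
  (1 - dot eta (H (t *: z)) ^+ 2) * (nrm z / (1 - (t * nrm z) ^+ 2)).
Proof.
move=> hz ht he; have htz := ballZ hz ht; have [hc _ hb] := isoH htz.
have := isom_speed hz ht; have := klein_le (DH (t *: z) z) he hc.
rewrite exprMn sqr_nrm /=.
set c := H _ in hc *; set c' := DH _ _.
have y1 : dot eta c ^+ 2 < 1.
  by apply: le_lt_trans (dot_CS _ _) _; rewrite he mul1r -ballE.
have tz1 : 0 < 1 - t ^+ 2 * dot z z.
  by move: htz; rewrite ballE !dot_simp mulrA -expr2 subr_gt0.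
move=> k1 k2.
have c1 : 0 < (1 - dot c c) ^+ 2 by rewrite exprn_gt0 // subr_gt0 -ballE.
apply: le_trans (ler_norm _) _.
rewrite -ler_sqr ?nnegrE ?normr_ge0 //; last first.
  by rewrite mulr_ge0 ?divr_ge0 ?nrm_ge0 ?subr_ge0 ?(ltW y1) // -subr_ge0 ltW.
rewrite real_normK ?num_real // exprMn expr_div_n sqr_nrm -(ler_pM2r c1).
apply: le_trans k1 _; rewrite -[leRHS]mulrA ler_wpM2l ?sqr_ge0 // [leRHS]mulrC -k2.
by rewrite addrA lerDl sqr_ge0.
Qed.

Lemma isom_contract_dir z eta : CH2 R z -> dot eta eta = 1 -> dot eta (H z) <= nrm z.
Proof.
move=> hz he; set s := nrm z; have s1 : s < 1 by exact: nrm_lt1.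
have s0 : 0 <= s by exact: nrm_ge0.
pose y t := dot eta (H (t *: z)); pose y' t := dot eta (DH (t *: z) z).
have dy t : 0 <= t <= 1 -> is_derive t 1 y (y' t).
  by move=> ht; have [_ hd _] := isoH (ballZ hz ht); exact: hasd_dot hd _ _ _.
have yb t : 0 <= t <= 1 -> y t ^+ 2 < 1.
  move=> ht; have [hc _ _] := isoH (ballZ hz ht).
  by apply: le_lt_trans (dot_CS _ _) _; rewrite he mul1r -ballE.
have ys t : 0 <= t <= 1 -> 0 < 1 - y t * (t * s).
  move=> ht; have := yb t ht; have ts : (t * s) ^+ 2 < 1.
    have /andP[t0 t1] := ht; rewrite expr_lt1 ?mulr_ge0 //.
    by apply: le_lt_trans s1; rewrite ler_piMl.
  by move: ts; nra.
(* [M] is the hyperbolic tangent of artanh (y t) - artanh (t s), by the addition formula; working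
   with it avoids artanh. It starts at 0 and [isom_dir_le] makes it nonincreasing. *)
pose M t := (y t - t * s) / (1 - y t * (t * s)).
pose M' t := ((y' t - s) * (1 - y t * (t * s)) + (y t - t * s) * (y' t * (t * s) + y t * s))
   / (1 - y t * (t * s)) ^+ 2.
have dM t : 0 <= t <= 1 -> is_derive t 1 M (M' t).
  move=> ht; have dyt := dy t ht; have yst := ys t ht.
  have dts := is_derive_scl t s.
  have dy1 := is_derive_mul dyt dts.
  have d1 := is_derive_sub (is_derive_cst (1 : R) t (1 : R)) dy1.
  have d2 := is_derive_inv d1 (lt0r_neq0 yst).
  have d3 := is_derive_mul (is_derive_sub dyt dts) d2.
  apply: (is_derive_eq d3); rewrite /M' /cst; field.
  exact: lt0r_neq0.
have M'0 t : 0 <= t <= 1 -> M' t <= 0.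
  move=> ht; rewrite /M' pmulr_lle0; last by rewrite invr_gt0 exprn_gt0 // ys.
  have /andP[t0 t1] := ht; have ts : 0 < 1 - (t * s) ^+ 2.
    rewrite subr_gt0 expr_lt1 ?mulr_ge0 //.
    by apply: le_lt_trans s1; rewrite ler_piMl.
  have := isom_dir_le hz ht he; rewrite -/(y t) -/(y' t) -/s [leRHS]mulrA ler_pdivlMr //.
  move=> h.
  rewrite [leLHS](_ : _ = y' t * (1 - (t * s) ^+ 2) - (1 - y t ^+ 2) * s); last by ring.
  by rewrite subr_le0.
have [c /andP[c0 c1]] := MVT_cc ltr01 dM.
have H00 : y 0 = 0 by rewrite /y scale0r H0 dot0r.
have M0 : M 0 = 0 by rewrite /M H00 !mul0r subrr mul0r.
rewrite M0 !subr0 mulr1.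
have : M' c <= 0 by apply: M'0; rewrite !ltW.
move=> /[swap] <-; rewrite /M mul1r pmulr_lle0.
  by rewrite subr_le0 /y scale1r.
have := ys 1; rewrite mul1r invr_gt0; apply; by rewrite ler01 lexx.
Qed.

Lemma isom_contract z : CH2 R z -> dot (H z) (H z) <= dot z z.
Proof.
move=> hz; rewrite -!sqr_nrm ler_sqr ?nnegrE ?nrm_ge0 //.
have [->|Hz0] := eqVneq (H z) 0; first by rewrite nrm0 nrm_ge0.
have n0 : 0 < nrm (H z) by rewrite nrm_gt0.
have := @isom_contract_dir z ((nrm (H z))^-1 *: H z) hz.
rewrite !dot_simp -sqr_nrm; set n := nrm (H z) in n0 *.
rewrite expr2 mulKf ?mulVf ?gt_eqF //; exact.
Qed.
End Ray.

Lemma hasd_lin z M : is_lin M -> hasd M z M.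
Proof.
move=> hl; split=> // e e0; exists 1 => // u _.
by have [hD _] := hl; rewrite hD [M z + _]addrC addrK subrr nrm0 mulr_ge0 ?nrm_ge0 ?ltW.
Qed.

Lemma hasd_eq f g z M N : hasd f z M -> hasd g z N ->
  (exists2 d : R, 0 < d & forall u, nrm u < d -> f (z + u) = g (z + u)) ->
  forall u, M u = N u.
Proof.
move=> [[_ hM] hf] [[_ hN] hg] [d d0 hd] u.
apply/eqP; rewrite -subr_eq0 -nrm_eq0 eq_le nrm_ge0 andbT.
apply/ler_addgt0Pl => e e0; rewrite addr0.
have n1 : 0 < 1 + nrm u by rewrite ltr_pwDl ?nrm_ge0.
have e1 : 0 < e / (2 * (1 + nrm u)) by rewrite divr_gt0 ?mulr_gt0.
have [d1 d10 h1] := hf _ e1; have [d2 d20 h2] := hg _ e1.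
pose m := Num.min d (Num.min d1 d2); have m0 : 0 < m by rewrite !lt_min d0 d10.
pose t := m / (1 + nrm u) / 2.
have t0 : 0 < t by rewrite !divr_gt0.
have : nrm (t *: u) < m.
  rewrite nrmZ gtr0_norm //; apply: (@le_lt_trans _ _ (t * (1 + nrm u))).
    by apply: ler_wpM2l; [exact: ltW | rewrite lerDr].
  by rewrite /t mulrAC divfK ?gt_eqF // ltr_pdivrMr // mulr_natr mulr2n ltrDl.
rewrite !lt_min => /and3P[u0 u1 u2].
have := h1 _ u1; have := h2 _ u2; rewrite -hd // hM hN.
have <- : f z = g z by have := hd 0; rewrite nrm0 addr0; apply.
rewrite nrmZ gtr0_norm //. set k := f _ - f z. rewrite [nrm (k - t *: N u)]nrmB => hh2 hh1.
have := le_trans (nrmD _ _) (lerD hh2 hh1).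
rewrite addrA subrK -scalerBr nrmZ gtr0_norm // nrmB => hh.
rewrite -(ler_pM2l t0); apply: le_trans hh _.
rewrite [leLHS](_ : _ = t * (e * (nrm u / (1 + nrm u)))); last first.
  by field; rewrite gt_eqF.
rewrite ler_pM2l // ler_piMr ?(ltW e0) // ler_pdivrMr // mul1r lerDr //.
Qed.

Lemma hasd_sqr f z M w t : hasd f z M -> z = t *: w ->
  is_derive t 1 (fun s : R => dot (f (s *: w)) (f (s *: w))) (2 * dot (f z) (M w)).
Proof.
move=> hf ze; have hi i : is_derive t 1 (fun s : R => f (s *: w) 0 i * f (s *: w) 0 i)
    (2 * (f z 0 i * M w 0 i)).
  have dE v : dot (delta_mx 0 i) v = v 0 i.
    rewrite /dot (bigD1 i) //= big1 ?addr0 => [|j ji]; rewrite !mxE eqxx.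
      by rewrite eqxx mul1r.
    by rewrite (negbTE ji) mul0r.
  have h := hasd_dot (delta_mx 0 i) hf ze; rewrite dE in h.
  have -> : (fun s => f (s *: w) 0 i * f (s *: w) 0 i) =
    (fun s => dot (delta_mx 0 i) (f (s *: w)) * dot (delta_mx 0 i) (f (s *: w))).
    by apply/funext => s; rewrite dE.
  by apply: (is_derive_eq (is_derive_mul h h)); rewrite dE -ze; ring.
rewrite /dot mulr_sumr; have := is_derive_sum hi.
by rewrite (_ : \sum_i _ = fun s => dot (f (s *: w)) (f (s *: w))) // /dot;
  apply/funext => s; rewrite fct_sumE.
Qed.

Section Rigid.
Variables (H H' : V -> V) (DH DH' : V -> V -> V).
Hypotheses (isoH : isom H DH) (isoH' : isom H' DH').
Hypotheses (HK : forall z, CH2 R z -> H' (H z) = z) (H0 : H 0 = 0).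

Lemma isom_norm z : CH2 R z -> dot (H z) (H z) = dot z z.
Proof.
move=> hz; have [hHz _ _] := isoH hz.
have H'0 : H' 0 = 0 by rewrite -[X in H' X]H0 HK //; exact: ball0.
apply/eqP; rewrite eq_le (isom_contract isoH H0 hz) /=.
by have := isom_contract isoH' H'0 hHz; rewrite HK.
Qed.

(** Differentiating |H (t z)|^2 = t^2 |z|^2 gives the radial part of the velocity c'; the speed
    identity then forces |c'| <= |z|, and the squared length of t c' - c comes out as t^2 (|c'|^2 -
    |z|^2) <= 0. *)
Lemma isom_radial z t : CH2 R z -> 0 < t -> t <= 1 -> t *: DH (t *: z) z = H (t *: z).
Proof.
move=> hz t0 t1; have ht : 0 <= t <= 1 by rewrite ltW.
have htz := ballZ hz ht; have [_ hd _] := isoH htz.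
have := isom_speed isoH hz ht; set c := H _; set c' := DH _ _ => /=.
have cc : dot c c = t ^+ 2 * dot z z by rewrite isom_norm // !dot_simp; ring.
have c'c : dot c' c = t * dot z z.
  have hq := hasd_sqr hd (erefl (t *: z)).
  have hs := is_derive_mul (is_derive_mul (is_derive_id t (1 : R)) (is_derive_id t (1 : R)))
    (is_derive_cst (dot z z) t (1 : R)).
  have := is_derive_near hq hs; rewrite /cst -/c -/c' => h.
  have h2 : (2 : R) != 0 by rewrite pnatr_eq0.
  apply: (mulfI h2); rewrite dotC h; first by ring.
  have [d d0 hdd] := CH2_open_nrm htz.
  exists (d / (1 + nrm z)); first by rewrite divr_gt0 // ltr_pwDl ?nrm_ge0.
  move=> k; rewrite ltr_pdivlMr ?ltr_pwDl ?nrm_ge0 // => hk.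
  rewrite isom_norm ?dotZl ?dotZr; first by ring.
  rewrite scalerDl; apply: hdd; rewrite nrmZ; apply: le_lt_trans hk.
  by rewrite ler_wpM2l // lerDr.
rewrite cc c'c.
have r1 : 0 < 1 - t ^+ 2 * dot z z by rewrite -cc subr_gt0 /c -ballE; case: (isoH htz).
rewrite mulrCA divff ?expf_neq0 ?gt_eqF // mulr1 => e.
have c'n : dot c' c' <= dot z z.
  rewrite -(ler_pM2l r1) -subr_ge0.
  rewrite (_ : _ - _ = dot c' (mul_i c) ^+ 2) ?sqr_ge0 //.
  rewrite [LHS](_ : _ = dot z z - t ^+ 2 * dot z z ^+ 2 - (1 - t ^+ 2 * dot z z) * dot c' c'); last by ring.
  by rewrite -{1}e; ring.
apply/eqP; rewrite -subr_eq0 -dot_eq0 eq_le dot_ge0 andbT !dot_simp (dotC c) c'c cc.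
rewrite [leLHS](_ : _ = t ^+ 2 * (dot c' c' - dot z z)); last by ring.
by rewrite pmulr_rle0 ?exprn_gt0 // subr_le0.
Qed.

(** By [isom_radial], H (s z) / s has derivative 0 in s. *)
Lemma isom_homog z t : CH2 R z -> 0 < t -> t <= 1 -> H (t *: z) = t *: H z.
Proof.
move=> hz t0; rewrite le_eqVlt => /predU1P[->|t1]; first by rewrite !scale1r.
apply: dot_inj => w; rewrite dotZr.
pose m s := dot w (H (s *: z)) * s^-1.
have dm s : t <= s <= 1 -> is_derive s 1 m 0.
  move=> /andP[ts s1]; have s0 : 0 < s := lt_le_trans t0 ts.
  have hs : 0 <= s <= 1 by rewrite s1 ltW.
  have [_ hd _] := isoH (ballZ hz hs).
  have h1 := hasd_dot w hd (erefl (s *: z)).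
  have h2 := is_derive_inv (is_derive_id s (1 : R)) (lt0r_neq0 s0).
  apply: (is_derive_eq (is_derive_mul h1 h2)).
  rewrite -(isom_radial hz s0 s1) dotZr; field; exact: lt0r_neq0.
have [c _ ] := MVT_cc t1 dm.
rewrite mul0r /m invr1 mulr1 scale1r => /eqP; rewrite subr_eq0 => /eqP ->.
by rewrite mulrC divfK // gt_eqF.
Qed.

(** By homogeneity the error at z is the error at t z divided by t, which is arbitrarily small by
    differentiability at 0. *)
Lemma isom_linear z : CH2 R z -> H z = DH 0 z.
Proof.
move=> hz; have [_ [[hD hZ] hd] _] := isoH (ball0 R).
apply/eqP; rewrite -subr_eq0 -nrm_eq0 eq_le nrm_ge0 andbT.
apply/ler_addgt0Pl => e e0; rewrite addr0.
have n1 : 0 < 1 + nrm z by rewrite ltr_pwDl ?nrm_ge0.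
have [d d0 h] := hd _ (divr_gt0 e0 n1).
pose t := Num.min 1 (d / (2 * (1 + nrm z))).
have t0 : 0 < t by rewrite lt_min ltr01 divr_gt0 // mulr_gt0.
have t1 : t <= 1 by rewrite ge_min lexx.
have tz : nrm (t *: z) < d.
  rewrite nrmZ gtr0_norm //; apply: (@le_lt_trans _ _ (d / 2)).
    apply: (@le_trans _ _ (d / (2 * (1 + nrm z)) * (1 + nrm z))).
      by apply: ler_pM; rewrite ?nrm_ge0 ?(ltW t0) ?ge_min ?lexx ?orbT // lerDr.
    by rewrite invfM mulrA divfK // gt_eqF.
  by rewrite ltr_pdivrMr // mulr_natr mulr2n ltrDl.
have := h _ tz; rewrite add0r H0 subr0 hZ isom_homog // -scalerBr !nrmZ gtr0_norm //.
rewrite mulrCA ler_pM2l // => hh; apply: le_trans hh _.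
rewrite -mulrA ler_piMr ?(ltW e0) // mulrC ler_pdivrMr // mul1r lerDr //.
Qed.

Lemma isom_diff z u : CH2 R z -> DH z u = DH 0 u.
Proof.
move=> hz; have [_ [[hD hZ] _] _] := isoH (ball0 R).
have [_ hd _] := isoH hz.
have [d d0 hdd] := CH2_open_nrm hz.
apply: (hasd_eq hd (hasd_lin z (conj hD hZ))); exists d => // v hv.
by rewrite isom_linear //; exact: hdd.
Qed.

Lemma isom_dot u v : dot (DH 0 u) (DH 0 v) = dot u v.
Proof.
have [_ _ /(_ u v)] := isoH (ball0 R).
rewrite H0 /bergman mul_i0 !dot0r !mul0r !addr0 subr0 !mul1r expr1n !divr1.
by apply: mulfI; rewrite pnatr_eq0.
Qed.

(** Away from the origin the metric singles out the direction i z: its invariance on i z gives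
    equality in Cauchy-Schwarz between A (i z) and i A z, so these agree up to a sign. The sign does
    not depend on z, since an additive group is not the union of two proper subgroups. *)
Lemma isom_mul_i : (forall u, DH 0 (mul_i u) = mul_i (DH 0 u)) \/
  (forall u, DH 0 (mul_i u) = - mul_i (DH 0 u)).
Proof.
have [_ [[hD hZ] _] _] := isoH (ball0 R); set A := DH 0 in hD hZ *.
have hb z : CH2 R z -> A (mul_i z) = mul_i (A z) \/ A (mul_i z) = - mul_i (A z).
  move=> hz; have [_ _ /(_ (mul_i z) (mul_i z))] := isoH hz.
  rewrite isom_linear // !isom_diff // -/A /bergman !isom_dot => h.
  have z1 : (1 - dot z z) ^+ 2 != 0 by rewrite expf_neq0 // subr_eq0 gt_eqF.
  have h4 : (4 : R) != 0 by rewrite pnatr_eq0.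
  move: h => /(canRL (mulfVK z1)); rewrite divfK // => /(mulfI h4)/addrI/addrI/eqP.
  rewrite -!expr2 dot_mul_i eqf_sqr.
  have n1 : dot (A (mul_i z)) (A (mul_i z)) = dot z z by rewrite isom_dot dot_mul_i.
  have n2 : dot (mul_i (A z)) (mul_i (A z)) = dot z z by rewrite dot_mul_i isom_dot.
  case/orP => /eqP e; [left|right]; apply/eqP.
    rewrite -subr_eq0 -dot_eq0 !dot_simp n1 n2 (dotC (mul_i _)) e.
    by apply/eqP; ring.
  rewrite -subr_eq0 opprK -dot_eq0 !dot_simp n1 n2 (dotC (mul_i (A z))) e.
  by apply/eqP; ring.
have ha z : A (mul_i z) = mul_i (A z) \/ A (mul_i z) = - mul_i (A z).
  pose k := (1 + nrm z)^-1; have k0 : 0 < k by rewrite invr_gt0 ltr_pwDl ?nrm_ge0.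
  have : CH2 R (k *: z).
    rewrite ballE -sqr_nrm nrmZ gtr0_norm // expr_lt1 ?mulr_ge0 ?nrm_ge0 ?(ltW k0) //.
    by rewrite mulrC ltr_pdivrMr ?ltr_pwDl ?nrm_ge0 // mul1r ltrDr.
  have kn : k != 0 by rewrite gt_eqF.
  case/hb; rewrite mul_iZ !hZ mul_iZ -?scalerN => /(scalerI kn) e; [by left|by right].
have [hl|hl] := pselect (forall u, A (mul_i u) = mul_i (A u)); first by left.
right=> u; have [e|//] := ha u.
move/existsNP: hl => [w hw]; have [//|ew] := ha w.
have := ha (u + w); rewrite mul_iD !hD e ew mul_iD opprD.
case=> [/addrI e2|/addIr //].
by case: hw; rewrite ew.
Qed.
End Rigid.

Definition uni A := [/\ is_lin A, (forall u v, dot (A u) (A v) = dot u v) &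
  (forall u, A (mul_i u) = mul_i (A u)) \/ (forall u, A (mul_i u) = - mul_i (A u))].

Lemma isom_uni H H' DH DH' : isom H DH -> isom H' DH' ->
  (forall z, CH2 R z -> H' (H z) = z) -> H 0 = 0 ->
  exists2 A, uni A & forall z, CH2 R z -> H z = A z.
Proof.
move=> h h' hK h0; exists (DH 0); last by move=> z; exact: (isom_linear h h' hK h0).
split.
- by have [_ [hl _] _] := h 0 (ball0 R).
- exact: (isom_dot h h0).
- exact: (isom_mul_i h h' hK h0).
Qed.

Lemma isom_comp H1 H2 D1 D2 : isom H1 D1 -> isom H2 D2 ->
  isom (H2 \o H1) (fun z => D2 (H1 z) \o D1 z).
Proof.
move=> h1 h2 z hz; have [b1 d1 g1] := h1 z hz; have [b2 d2 g2] := h2 _ b1.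
split=> //; first exact: hasd_comp.
by move=> u v /=; rewrite g2.
Qed.

Lemma isom_moeb p : CH2 R p -> isom (moeb p) (dmoeb p).
Proof.
move=> hp z hz; split; [exact: moeb_ball | exact: hasd_moeb |].
by move=> u v; exact: bergman_dmoeb.
Qed.
End Classification.

(** * Squares in the orbit space *)

Local Open Scope card_scope.

Section Sperner.
Variables (n : nat) (l : nat -> nat -> nat).
Hypotheses (l3 : forall i j, (l i j < 3)%N)
  (lleft : forall j, (j <= n)%N -> l 0 j = 0%N)
  (lright : forall j, (j <= n)%N -> l n j <> 0%N)
  (lbottom : forall i, (i <= n)%N -> l i 0 <> 2%N)
  (ltop : forall i, (i <= n)%N -> l i n <> 1%N).

Let e (a b : nat) : bool := (a == 0%N) && (b == 1%N) || (a == 1%N) && (b == 0%N).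

Let e_tri a b c : (a < 3)%N -> (b < 3)%N -> (c < 3)%N ->
  ~~ uniq [:: a; b; c] -> e a b (+) e b c (+) e a c = false.
Proof. by case: a b c => [|[|[|//]]] [|[|[|//]]] [|[|[|//]]]. Qed.

(* The parity of the number of edges labelled {0, 1} does not depend on the row. *)
Let row j m := \big[addb/false]_(i < m) e (l i j) (l i.+1 j).

(** Cells are cut by the diagonal from (i, j) to (i + 1, j + 1). A triangle without three distinct
    labels has an even number of edges labelled {0, 1}, and the left and right columns have no such
    edge, so without a three-labelled triangle the top and bottom rows would have the same parity.
    The top row avoids the label 1, while the bottom row uses only 0 and 1 and changes from 0 to
    1. *)
Lemma sperner_square : exists i j, [/\ (i < n)%N, (j < n)%N &
  uniq [:: l i j; l i.+1 j; l i.+1 j.+1] || uniq [:: l i j; l i j.+1; l i.+1 j.+1]].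
Proof.
apply: contrapT => hno.
have hcell i j : (i < n)%N -> (j < n)%N ->
    e (l i j) (l i.+1 j) (+) e (l i j.+1) (l i.+1 j.+1) =
    e (l i j) (l i j.+1) (+) e (l i.+1 j) (l i.+1 j.+1).
  move=> hi hj; have [/negP h1 /negP h2] : ~ uniq [:: l i j; l i.+1 j; l i.+1 j.+1] /\
     ~ uniq [:: l i j; l i j.+1; l i.+1 j.+1].
    by split=> h; apply: hno; exists i, j; split=> //; rewrite h ?orbT.
  have := e_tri (l3 _ _) (l3 _ _) (l3 _ _) h1; have := e_tri (l3 _ _) (l3 _ _) (l3 _ _) h2.
  by do 5![case: (e _ _)].
have hrow j m : (j < n)%N -> (m <= n)%N ->
    row j m (+) row j.+1 m = e (l 0 j) (l 0 j.+1) (+) e (l m j) (l m j.+1).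
  move=> hj; elim: m => [|m IH] hm.
    by rewrite /row !big_ord0 !addbb.
  rewrite /row !big_ord_recr /= -/(row _ _) -/(row _ _) addbACA IH ?(ltnW hm) //.
  by rewrite hcell //; do 3![case: (e _ _)].
have hrows j : (j <= n)%N -> row j n = row 0 n.
  elim: j => // j IH hj; rewrite -IH ?(ltnW hj) //.
  have := hrow j n hj (leqnn n).
  rewrite (lleft (ltnW hj)) (lleft hj) {2}/e.
  have := lright (ltnW hj); have := lright hj.
  case: (l n j) => [//|a]; case: (l n j.+1) => [//|b] _ _.
  by rewrite andbF /=; case: (row j n); case: (row j.+1 n).
have top : row n n = false.
  rewrite /row big1 // => i _; rewrite /e.
  have /eqP/negbTE h1 := ltop (ltnW (ltn_ord i)).
  have /eqP/negbTE h2 := ltop (ltn_ord i).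
  by rewrite h1 h2 andbF.
have bot m : (m <= n)%N -> row 0 m = (l m 0 == 1%N).
  elim: m => [|m IH] hm; first by rewrite /row big_ord0 lleft.
  rewrite /row big_ord_recr -/(row 0 m) IH ?(ltnW hm) // /e.
  have := lbottom hm; have := lbottom (ltnW hm); have := l3 m 0; have := l3 m.+1 0.
  by move: (l m 0) (l m.+1 0) => [|[|[|//]]] [|[|[|//]]].
have := hrows n (leqnn n); rewrite top bot //.
have := lright (leq0n n); have := lbottom (leqnn n); have := l3 n 0.
by move: (l n 0) => [|[|[|//]]].
Qed.
End Sperner.

Section Square.
Variable R : realType.

Definition usquare : set (R * R) := [set x | (0 <= x.1 <= 1) && (0 <= x.2 <= 1)].

Lemma compact_usquare : compact usquare.
Proof.
have -> : usquare = `[0, 1]%classic `*` `[0, 1]%classic.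
  by apply/seteqP; split=> [[a b]|[a b]] /=; rewrite !in_itv /= => /andP.
by apply: compact_setX; exact: segment_compact.
Qed.

(** Lebesgue's number lemma, from compactness in its near-covering form with the radius tending to 0
    from the right as parameter. *)
Lemma lebesgue_square (U : set (set (R * R))) : U `<=` open ->
  usquare `<=` \bigcup_(A in U) A ->
  exists2 e : R, 0 < e & forall x, usquare x -> exists2 A, U A & ball x e `<=` A.
Proof.
move=> Uo Uc.
have /compact_near_coveringP/(_ _ (0 : R)^'+ (fun e x => exists2 A, U A & ball x e `<=` A)) := compact_usquare.
case.
  move=> x /Uc[A UA Ax].
  have /nbhs_ballP[r /= r0 rA] : nbhs x A by apply: open_nbhs_nbhs; split=> //; exact: Uo.
  exists (ball x (r / 2), [set e : R | 0 < e < r / 2]) => /=.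
    split; first by apply: nbhsx_ballx; rewrite divr_gt0.
    near=> e; apply/andP; split; near: e; first exact: nbhs_right_gt.
    by apply: nbhs_right_lt; rewrite divr_gt0.
  move=> [y e] /= [xy /andP[e0 er]]; exists A => // z yz; apply: rA.
  by rewrite [r]splitr; apply: ball_triangle xy _; exact: le_ball (ltW er) _ yz.
move=> e /= e0 h; exists (e / 2); first by rewrite divr_gt0.
apply: h => /=; last by rewrite divr_gt0.
by rewrite sub0r normrN gtr0_norm ?divr_gt0 // ltr_pdivrMr // mulr_natr mulr2n ltrDl.
Unshelve. all: by end_near. Qed.

Variables (X : topologicalType) (S : R * R -> X).
Hypothesis Sc : continuous S.
Variables Lu Hu Lv Hv : set X.
Hypotheses (oLu : open Lu) (oHu : open Hu) (oLv : open Lv) (oHv : open Hv)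
  (cu : forall x, Lu x \/ Hu x) (cv : forall x, Lv x \/ Hv x)
  (Sleft : forall b, ~ Hu (S (0, b))) (Sright : forall b, ~ Lu (S (1, b)))
  (Sbottom : forall a, ~ Hv (S (a, 0))) (Stop : forall a, ~ Lv (S (a, 1))).

(** A refinement of the four intersections in which no point lies in three sets is impossible: none
    of its sets meets two opposite sides of the square, so on a fine grid Sperner's lemma produces
    three different sets with a common point. The sides are whole lines because [S] is defined on
    the plane. *)
Lemma covering_dim_square : ~ covering_dim_le X 1.
Proof.
move=> dim1.
pose C : set (set X) := [set A | exists P Q, [/\ P = Lu \/ P = Hu, Q = Lv \/ Q = Hv &
  A = P `&` Q]].
have Co : open_cover C.
  split.
    by move=> _ [P [Q [hP hQ ->]]]; apply: openI; [case: hP|case: hQ] => ->.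
  apply/seteqP; split=> // x _.
  have [P hP Px] : exists2 P, P = Lu \/ P = Hu & P x.
    by have [h|h] := cu x; [exists Lu|exists Hu] => //; [left|right].
  have [Q hQ Qx] : exists2 Q, Q = Lv \/ Q = Hv & Q x.
    by have [h|h] := cv x; [exists Lv|exists Hv] => //; [left|right].
  by exists (P `&` Q) => //; exists P, Q.
have [C' [[oC' cC'] rC' card2]] := dim1 C Co.
have noL B : C' B -> (exists b, B (S (0, b))) -> forall b, ~ B (S (1, b)).
  move=> /rC'[_ [P [Q [hP _ ->]]] BA] [b /BA[h1 _]] b' /BA[h2 _].
  by case: hP h1 h2 => -> h1 h2; [exact: Sright h2|exact: Sleft h1].
have noB B : C' B -> (exists a, B (S (a, 0))) -> forall a, ~ B (S (a, 1)).
  move=> /rC'[_ [P [Q [_ hQ ->]]] BA] [a /BA[_ h1]] a' /BA[_ h2].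
  by case: hQ h1 h2 => -> h1 h2; [exact: Stop h2|exact: Sbottom h1].
pose U := [set S @^-1` B | B in C'].
have [e e0 he] : exists2 e : R, 0 < e & forall x, usquare x ->
    exists2 A, U A & ball x e `<=` A.
  apply: lebesgue_square => [_ [B hB <-]|x _].
    by move/continuousP: Sc; apply; exact: oC'.
  have : setT (S x) by []; rewrite -cC' => -[B hB Bx].
  by exists (S @^-1` B) => //; exists B.
pose n := (Num.truncn e^-1).+1.
have n0 : (0 < n%:R :> R) by rewrite ltr0n.
have ne : n%:R^-1 < e.
  by rewrite invf_plt ?posrE // ?truncnS_gt.
pose pt (i j : nat) : R * R := (i%:R / n%:R, j%:R / n%:R).
have ptS i j : (i <= n)%N -> (j <= n)%N -> usquare (pt i j).
  move=> hi hj; rewrite /usquare /=.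
  by rewrite !divr_ge0 ?ler0n // !ler_pdivrMr // !mul1r !ler_nat hi hj.
have /choice[c hc] : forall ij : nat * nat, exists B, (ij.1 <= n)%N -> (ij.2 <= n)%N ->
    C' B /\ ball (pt ij.1 ij.2) e `<=` S @^-1` B.
  move=> [i j] /=; have [/andP[hi hj]|h] := boolP ((i <= n)%N && (j <= n)%N).
    by have [_ [B hB <-] h] := he _ (ptS _ _ hi hj); exists B.
  by exists setT => hi hj; rewrite hi hj in h.
(* The label records a side met by the chosen set: 0 for the left side, otherwise 1 for the bottom
   side, otherwise 2. *)
pose l i j : nat := let B := c (minn i n, minn j n) in
  if `[< exists b, B (S (0, b)) >] then 0%N
  else if `[< exists a, B (S (a, 0)) >] then 1%N else 2%N.
(* Neighbouring vertices are closer than the Lebesgue number, so the set chosen at a vertex contains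
   the images of its neighbours; the three sets of a triangle thus share the image of its corner (i,
   j). *)
have cP i j : (i <= n)%N -> (j <= n)%N -> C' (c (i, j)) /\
  forall i' j', (i' <= n)%N -> (j' <= n)%N -> (i' <= i.+1)%N -> (i <= i'.+1)%N ->
  (j' <= j.+1)%N -> (j <= j'.+1)%N -> c (i, j) (S (pt i' j')).
  move=> hi hj; have [h1 h2] := hc (i, j) hi hj; split=> //= i' j' hi' hj' a1 a2 b1 b2.
  apply: h2; suff hh x y : (x <= y.+1)%N -> (y <= x.+1)%N ->
      `|x%:R / n%:R - y%:R / n%:R| < e.
    by split => /=; exact: hh.
  move=> xy yx; rewrite -mulrBl normrM [X in _ * X]gtr0_norm ?invr_gt0 //.
  apply: le_lt_trans ne; rewrite ler_piMl ?invr_ge0 ?ler0n // ler_norml.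
  move: xy yx; rewrite -!(ler_nat R) -!natr1 => xy yx.
  by apply/andP; split; lra.
have l3 i j : (l i j < 3)%N by rewrite /l; case: ifP => // _; case: ifP.
have lE i j : (i <= n)%N -> (j <= n)%N -> l i j =
    if `[< exists b, c (i, j) (S (0, b)) >] then 0%N
    else if `[< exists a, c (i, j) (S (a, 0)) >] then 1%N else 2%N.
  by move=> hi hj; rewrite /l (minn_idPl hi) (minn_idPl hj).
have own i j : (i <= n)%N -> (j <= n)%N -> C' (c (i, j)) /\ c (i, j) (S (pt i j)).
  by move=> hi hj; have [h1 h2] := cP _ _ hi hj; split=> //; apply: h2.
have pt0l j : pt 0 j = (0, j%:R / n%:R) by rewrite /pt mul0r.
have pt0r i : pt i 0 = (i%:R / n%:R, 0) by rewrite /pt mul0r.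
have ptnl j : pt n j = (1, j%:R / n%:R) by rewrite /pt divff ?gt_eqF.
have ptnr i : pt i n = (i%:R / n%:R, 1) by rewrite /pt divff ?gt_eqF.
have [|||| i [j [hi hj hu]]] := @sperner_square n l l3.
- move=> j hj; rewrite lE //; case: asboolP => // -[].
  by exists (j%:R / n%:R); rewrite -pt0l; case: (own 0%N j (leq0n n) hj).
- move=> j hj; rewrite lE //; have [h1 h2] := own n j (leqnn n) hj.
  case: asboolP => [h|_]; last by case: ifP.
  by move: h2; rewrite ptnl => /(noL _ h1 h).
- move=> i hi; rewrite lE //; have [h1 h2] := own i 0%N hi (leq0n n).
  case: asboolP => // _; case: asboolP => // -[].
  by exists (i%:R / n%:R); rewrite -pt0r.
- move=> i hi; rewrite lE //; have [h1 h2] := own i n hi (leqnn n).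
  case: asboolP => // _; case: asboolP => // h.
  by move: h2; rewrite ptnr => /(noB _ h1 h).
have lc i1 j1 i2 j2 : l i1 j1 != l i2 j2 -> c (minn i1 n, minn j1 n) != c (minn i2 n, minn j2 n).
  by apply: contra => /eqP h; rewrite /l h.
have three B1 B2 B3 x : C' B1 -> C' B2 -> C' B3 -> B1 x -> B2 x -> B3 x ->
    B1 != B2 -> B1 != B3 -> B2 != B3 -> False.
  move=> c1 c2 c3 b1 b2 b3 n12 n13 n23.
  have /pcard_leP/unsquash f := card2 x.
  have fi B : C' B -> B x -> (f B < 2)%N.
    by move=> cB Bx; have := @funS _ _ _ _ f B (conj cB Bx).
  have finj := @inj _ _ [set B | C' B /\ B x] f.
  have i12 : f B1 <> f B2.
    by move=> /finj h; move/eqP: n12; apply; apply: h; rewrite inE.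
  have i13 : f B1 <> f B3.
    by move=> /finj h; move/eqP: n13; apply; apply: h; rewrite inE.
  have i23 : f B2 <> f B3.
    by move=> /finj h; move/eqP: n23; apply; apply: h; rewrite inE.
  have := fi _ c1 b1; have := fi _ c2 b2; have := fi _ c3 b3.
  by case: (f B1) (f B2) (f B3) i12 i13 i23 => [|[|//]] [|[|//]] [|[|//]].
have n2 k : (k <= k.+2)%N by rewrite leqW // leqnSn.
have hi' := ltnW hi; have hj' := ltnW hj.
have [ci1 ci2] := cP i j hi' hj'.
case/orP: hu => /=; rewrite !inE !negb_or andbT => /andP[/andP[h1 h2] h3].
  have [cj1 cj2] := cP i.+1 j hi hj'; have [ck1 ck2] := cP i.+1 j.+1 hi hj.
  have := three _ _ _ (S (pt i j)) ci1 cj1 ck1; apply.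
  - by apply: ci2; rewrite ?leqnn ?leqnSn ?n2 ?hi' ?hj'.
  - by apply: cj2; rewrite ?leqnn ?leqnSn ?n2 ?hi' ?hj'.
  - by apply: ck2; rewrite ?leqnn ?leqnSn ?n2 ?hi' ?hj'.
  - by have := lc _ _ _ _ h1; rewrite (minn_idPl hi) (minn_idPl hi') (minn_idPl hj').
  - by have := lc _ _ _ _ h2; rewrite (minn_idPl hi) (minn_idPl hi') (minn_idPl hj) (minn_idPl hj').
  - by have := lc _ _ _ _ h3; rewrite (minn_idPl hi) (minn_idPl hj) (minn_idPl hj').
have [cj1 cj2] := cP i j.+1 hi' hj; have [ck1 ck2] := cP i.+1 j.+1 hi hj.
have := three _ _ _ (S (pt i j)) ci1 cj1 ck1; apply.
- by apply: ci2; rewrite ?leqnn ?leqnSn ?n2 ?hi' ?hj'.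
- by apply: cj2; rewrite ?leqnn ?leqnSn ?n2 ?hi' ?hj'.
- by apply: ck2; rewrite ?leqnn ?leqnSn ?n2 ?hi' ?hj'.
- by have := lc _ _ _ _ h1; rewrite (minn_idPl hi') (minn_idPl hj) (minn_idPl hj').
- by have := lc _ _ _ _ h2; rewrite (minn_idPl hi) (minn_idPl hi') (minn_idPl hj) (minn_idPl hj').
- by have := lc _ _ _ _ h3; rewrite (minn_idPl hi) (minn_idPl hi') (minn_idPl hj).
Qed.
End Square.

Section OrbitSquare.
Variables (R : realType) (n : nat) (D : set 'rV[R]_n)
  (g : 'rV[R]_n -> 'rV[R]_n -> 'rV[R]_n -> R) (G : groupType)
  (alpha : isometric_action D g G).

Definition invariant_open (O : set 'rV[R]_n) := (forall p : D, O (set_val p) ->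
  exists2 A, open A & A (set_val p) /\ A `&` D `<=` O) /\
  forall s (p : D), O (set_val p) -> O (set_val (alpha s p)).

(** The invariant sets descend to the orbit space through representatives: by invariance the
    representative is immaterial, and the preimage under the projection is relatively open. *)
Lemma orbit_square (S : R * R -> 'rV[R]_n) (Lu Hu Lv Hv : set 'rV[R]_n) :
  covering_dim_le (orbit_space alpha) 1 ->
  continuous S -> (forall x, D (S x)) ->
  invariant_open Lu -> invariant_open Hu -> invariant_open Lv -> invariant_open Hv ->
  (forall x, D x -> Lu x \/ Hu x) -> (forall x, D x -> Lv x \/ Hv x) ->
  (forall b, ~ Hu (S (0, b))) -> (forall b, ~ Lu (S (1, b))) ->
  (forall a, ~ Hv (S (a, 0))) -> (forall a, ~ Lv (S (a, 1))) -> False.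
Proof.
move=> dim1 Sc SD iLu iHu iLv iHv cu cv s1 s2 s3 s4.
pose q : D -> orbit_space alpha := \pi_(orbit_space alpha)%qT.
have SDi x : S x \in D by rewrite inE.
pose S' x : D := exist _ (S x) (SDi x).
pose lift (O : set 'rV[R]_n) : set (orbit_space alpha) :=
  [set x | O (set_val (repr x))].
have qlift O (p : D) : invariant_open O -> lift O (q p) <-> O (set_val p).
  move=> [_ iO]; rewrite /lift /=.
  have : orbit_rel alpha (repr (q p)) p.
    by apply/(@eqmodP _ (orbit_equiv alpha)); rewrite reprK.
  move=> /asboolP[s _ e]; split=> h; first by have := iO s _ h; rewrite e.
  have <- : alpha s^-1%g p = repr (q p) by rewrite -[X in alpha _ X]e -actM mulVg act1.
  exact: iO.
have olift O : invariant_open O -> open (lift O).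
  move=> iO; rewrite /open /= /quotient_open.
  exists (\bigcup_(A in [set A | open A /\ A `&` D `<=` O]) A).
    by apply: bigcup_open => A [].
  apply/seteqP; split=> p /=.
    move=> [A [oA hA] Ap]; apply/(qlift _ _ iO); apply: hA; split=> //.
    by have := valP p; rewrite inE.
  by move=> /(qlift _ _ iO) Op; have [A oA [Ap hA]] := iO.1 p Op; exists A.
have S'c : continuous S'.
  apply/continuousP => _ [A oA <-]; rewrite -comp_preimage.
  by move/continuousP: Sc => /(_ A oA).
have qc : continuous (q \o S').
  by move=> x; apply: continuous_comp; [exact: S'c | exact: pi_continuous].
have cover A B x : (forall x, D x -> A x \/ B x) -> lift A x \/ lift B x.
  by apply; have := valP (repr x); rewrite inE.
have push A x : invariant_open A -> ~ A (S x) -> ~ lift A ((q \o S') x).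
  by move=> iA nA /(qlift _ _ iA).
apply: (covering_dim_square qc (olift _ iLu) (olift _ iHu) (olift _ iLv) (olift _ iHv)) dim1.
- by move=> x; exact: cover.
- by move=> x; exact: cover.
- by move=> b; apply: push.
- by move=> b; apply: push.
- by move=> b; apply: push.
- by move=> b; apply: push.
Qed.
End OrbitSquare.

Local Open Scope complex_scope.

(** * The recentred action *)

Section TwoPoint.
Variable R : realType.
Local Notation V := 'rV[R]_(2 + 2).
Implicit Types (u v w x z p eta : V) (a t : R) (A : V -> V).

Let ballE z : CH2 R z = (dot z z < 1). Proof. by []. Qed.

(* [Bq z w] is the squared hyperbolic cosine of half the distance of [z], [w]. *)
Definition Bq z w : R := cn (1 - herm z w) ^+ 2 / ((1 - dot z z) * (1 - dot w w)).

Lemma sqr_cn_den z w : cn (1 - herm z w) ^+ 2 = (1 - dot z w) ^+ 2 + dot z (mul_i w) ^+ 2.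
Proof.
by rewrite /cn sqr_sqrtr ?addr_ge0 ?sqr_ge0 //= sub0r sqrrN.
Qed.

(** By [moeb_den], numerator and denominator acquire the same factor. *)
Lemma Bq_moeb p z w : CH2 R p -> CH2 R z -> CH2 R w ->
  Bq (moeb p z) (moeb p w) = Bq z w.
Proof.
move=> hp hz hw.
have h q : CH2 R q -> 1 - dot (moeb p q) (moeb p q) =
    (1 - dot p p) * (1 - dot q q) / cn (1 - herm q p) ^+ 2.
  move=> hq; have := moeb_den hp hq hq.
  have -> : 1 - herm p q = conjc (1 - herm q p) by rewrite conjB conj1 conj_herm.
  rewrite -sqr_cn !hermuu /mdel -(rmorph1 (real_complex R)) -!rmorphB.
  by rewrite -rmorphM -fmorphV -rmorphM => /(@complexI R).
have d0 x : CH2 R x -> 1 - dot x x != 0 by move=> hx; rewrite subr_eq0 gt_eqF // -ballE.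
have c0 x y : CH2 R x -> CH2 R y -> cn (1 - herm x y) != 0.
  by move=> hx hy; rewrite cn_eq0 den_neq0.
have cS : cn (1 - herm p w) = cn (1 - herm w p).
  by rewrite -cnJ conjB conj1 conj_herm.
rewrite /Bq !h // moeb_den // !cnM cnV cnM cS.
have -> : cn (mdel p) = 1 - dot p p by rewrite cnR gtr0_norm // subr_gt0 -ballE.
field.
by rewrite !d0 // !c0.
Qed.

Lemma uni_herm A : uni A -> (forall u v, herm (A u) (A v) = herm u v) \/
  (forall u v, herm (A u) (A v) = conjc (herm u v)).
Proof.
case=> _ hd [hJ|hJ]; [left|right] => u v; rewrite /herm hd /=.
  by rewrite -hJ hd.
by rewrite -[mul_i (A v)]opprK -hJ dotNr hd.
Qed.

Lemma uni_dot A u v : uni A -> dot (A u) (A v) = dot u v.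
Proof. by case. Qed.

Lemma uni_nrm A u : uni A -> nrm (A u) = nrm u.
Proof. by move=> hA; rewrite /nrm uni_dot. Qed.

Lemma uni_ball A z : uni A -> CH2 R z -> CH2 R (A z).
Proof. by move=> hA; rewrite !ballE uni_dot. Qed.

Lemma uni_lin A : uni A -> is_lin A. Proof. by case. Qed.

Lemma uniD A u v : uni A -> A (u + v) = A u + A v. Proof. by case=> -[]. Qed.
Lemma uniZ A a u : uni A -> A (a *: u) = a *: A u. Proof. by case=> -[]. Qed.
Lemma uniN A u : uni A -> A (- u) = - A u.
Proof. by move=> h; rewrite -scaleN1r uniZ // scaleN1r. Qed.
Lemma uniB A u v : uni A -> A (u - v) = A u - A v.
Proof. by move=> h; rewrite uniD // uniN. Qed.
Lemma uni0 A : uni A -> A 0 = 0.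
Proof. by move=> h; rewrite -(scale0r (0 : V)) uniZ // !scale0r. Qed.

Lemma Bq_uni A z w : uni A -> Bq (A z) (A w) = Bq z w.
Proof.
move=> hA; rewrite /Bq !uni_dot //; congr (_ ^+ 2 / _).
have [e|e] := uni_herm hA; rewrite e //.
by rewrite -cnJ conjB conj1 -[conjc (conjc _)]/(conjc (conjc (herm z w))) -conj_herm !conj_herm.
Qed.

Lemma Bq0 x : Bq x 0 = (1 - dot x x)^-1.
Proof. by rewrite /Bq herm0r subr0 cn1 expr1n dot0l subr0 mulr1 mul1r. Qed.

(** Turns values of [Bq] close to 1 into Euclidean closeness. *)
Lemma Bq_ge x w : CH2 R x -> CH2 R w -> 1 + dot (x - w) (x - w) <= Bq x w.
Proof.
rewrite !ballE => hx hw.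
have m0 : 0 < (1 - dot x x) * (1 - dot w w) by rewrite mulr_gt0 // subr_gt0.
rewrite /Bq sqr_cn_den ler_pdivlMr // !dot_simp (dotC w x).
have n0 := dot_ge0 x; have k0 := dot_ge0 w; have hd := dot_ge0 (x - w).
move: hd; rewrite !dot_simp (dotC w x).
move: (dot x x) (dot w w) (dot x w) (dot x (mul_i w)) hx hw n0 k0 m0 => n m a b hx hw n0 k0 m0 hd.
rewrite -subr_ge0.
rewrite (_ : _ - _ = (a - n) ^+ 2 + b ^+ 2 + m * ((1 - n) * (n - a - (a - m)))); last by ring.
rewrite addr_ge0 ?addr_ge0 ?sqr_ge0 //; apply: mulr_ge0 => //; apply: mulr_ge0; lra.
Qed.

(** The error is relative and uniform in [w], since [Bq x w] is unbounded as [w] approaches the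
    sphere and infima over whole orbits will be taken. *)
Lemma Bq_cont x e : CH2 R x -> 0 < e -> exists2 d, 0 < d &
  forall x', nrm (x' - x) < d -> CH2 R x' /\
    forall w, CH2 R w -> `|Bq x' w - Bq x w| <= e * Bq x w.
Proof.
move=> hx e0; have x1 := nrm_lt1 hx.
set m := 1 - nrm x; have m0 : 0 < m by rewrite subr_gt0.
have [d1 d10 hd1] := CH2_open_nrm hx.
(* A displacement of relative size [r] changes the numerator by a factor between (1 - r)^2 and (1 +
   r)^2 and 1 - |x|^2 by one between 1 - 2 r and 1 + 2 r. For r < 1/5 one has (1 + r)^2 <= (1 + 8 r)
   (1 - 2 r), so the relative error is at most 8 r. *)
pose r0 := Num.min (1 / 5) (e / 8); have r00 : 0 < r0 by rewrite lt_min !divr_gt0.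
exists (Num.min d1 (m * r0)); first by rewrite lt_min d10 mulr_gt0.
move=> x'; rewrite lt_min => /andP[h1 h2].
have hx' : CH2 R x' by rewrite -(subrK x x') addrC; exact: hd1.
split=> // w hw; have w1 := nrm_lt1 hw.
pose r := nrm (x' - x) / m.
have rr : r < r0 by rewrite /r ltr_pdivrMr // mulrC.
have r_ge0 : 0 <= r by rewrite divr_ge0 ?nrm_ge0 // ltW.
have re : nrm (x' - x) = r * m by rewrite /r divfK // gt_eqF.
set b := cn (1 - herm x w); set b' := cn (1 - herm x' w).
have mb : m <= b.
  by apply: le_trans (cn_lb _ _); rewrite /m lerB // ler_piMr ?nrm_ge0 // ltW.
have rmb : r * m <= r * b by rewrite ler_wpM2l.
have cd : cn (herm (x' - x) w) <= r * m.
  by rewrite -re; apply: le_trans (cn_herm _ _) _; rewrite ler_piMr ?nrm_ge0 // ltW.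
have bb1 : b' <= b + r * b.
  have -> : b' = cn ((1 - herm x w) - herm (x' - x) w).
    by congr cn; rewrite hermBl; ring.
  apply: le_trans (cnD _ _) _; rewrite cnN lerD2l; exact: le_trans cd rmb.
have bb2 : b - r * b <= b'.
  rewrite lerBlDr.
  have -> : b = cn ((1 - herm x' w) + herm (x' - x) w).
    by congr cn; rewrite hermBl; ring.
  apply: le_trans (cnD _ _) _; rewrite lerD2l.
  apply: le_trans cd _; apply: le_trans rmb _.
  by rewrite /b (_ : 1 - herm x w = (1 - herm x' w) + herm (x' - x) w) // hermBl; ring.
pose k := 1 - dot x x; pose k' := 1 - dot x' x'.
have k0 : 0 < k by rewrite subr_gt0 -ballE.
have k'0 : 0 < k' by rewrite subr_gt0 -ballE.
have mk : m <= k.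
  by rewrite /m /k lerB // -sqr_nrm expr2 ler_piMr ?nrm_ge0 // ltW.
have x'1 := nrm_lt1 hx'.
have kk : `|k' - k| <= 2 * r * k.
  have -> : k' - k = - dot (x' - x) (x' + x).
    by rewrite /k /k' !dot_simp (dotC x x'); ring.
  rewrite normrN; apply: le_trans (dot_le_nrm _ _) _; rewrite re.
  have h3 : nrm (x' + x) <= 2 by apply: le_trans (nrmD _ _) _; lra.
  apply: (@le_trans _ _ (r * m * 2)).
    by rewrite ler_wpM2l // mulr_ge0 // ltW.
  by rewrite mulrC mulrA ler_wpM2l // mulr_ge0.
move: kk; rewrite ler_norml => /andP[kk1 kk2].
have b0 : 0 < b by exact: lt_le_trans mb.
have l0 : 0 < 1 - dot w w by rewrite subr_gt0 -ballE.
have [r5 r8] : r < 1 / 5 /\ r * 8 < e.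
  by move: rr; rewrite lt_min => /andP[? ?]; split=> //; rewrite -ltr_pdivlMr.
rewrite /Bq -/b -/b' -/k -/k'.
have -> : b' ^+ 2 / (k' * (1 - dot w w)) - b ^+ 2 / (k * (1 - dot w w)) =
    (b' ^+ 2 / k' - b ^+ 2 / k) / (1 - dot w w).
  by field; rewrite !gt_eqF.
have -> : e * (b ^+ 2 / (k * (1 - dot w w))) = e * (b ^+ 2 / k) / (1 - dot w w).
  by field; rewrite !gt_eqF.
rewrite normrM.
rewrite [`|(1 - _)^-1|]gtr0_norm ?invr_gt0 // ler_pM2r ?invr_gt0 //.
have b2k : 0 <= b ^+ 2 / k by rewrite divr_ge0 ?sqr_ge0 // ltW.
apply: (@le_trans _ _ (8 * r * (b ^+ 2 / k))); last first.
  by rewrite ler_wpM2r // mulrC ltW.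
have b'b : (1 - r) ^+ 2 * b ^+ 2 <= b' ^+ 2 <= (1 + r) ^+ 2 * b ^+ 2.
  rewrite -!exprMn !ler_sqr ?nnegrE ?cn_ge0 // ?mulr_ge0 ?(ltW b0) //; last 2 first.
  - lra.
  - lra.
  by apply/andP; split; lra.
have /andP[g1 g2] := b'b.
rewrite ler_norml lerBrDr lerBlDr; apply/andP; split.
  rewrite ler_pdivlMr //.
  have -> : - (8 * r * (b ^+ 2 / k)) + b ^+ 2 / k = (1 - 8 * r) * (b ^+ 2 / k) by ring.
  have [hneg|hpos] : 1 - 8 * r <= 0 \/ 0 <= 1 - 8 * r by apply/orP; exact: le_total.
    apply: le_trans (sqr_ge0 b'); apply: mulr_le0_ge0; last exact: ltW.
    exact: mulr_le0_ge0.
  apply: (@le_trans _ _ ((1 - 8 * r) * (b ^+ 2 / k) * ((1 + 2 * r) * k))).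
    apply: ler_wpM2l; first by rewrite mulr_ge0 // ltW.
    lra.
  rewrite [leLHS](_ : _ = (1 - 8 * r) * (1 + 2 * r) * b ^+ 2); last first.
    by field; rewrite gt_eqF.
  apply: le_trans g1; apply: ler_wpM2r; rewrite ?sqr_ge0 //; nra.
rewrite ler_pdivrMr //.
have -> : 8 * r * (b ^+ 2 / k) + b ^+ 2 / k = (1 + 8 * r) * (b ^+ 2 / k) by ring.
apply: (@le_trans _ _ ((1 + 8 * r) * (b ^+ 2 / k) * ((1 - 2 * r) * k))).
  rewrite [leRHS](_ : _ = (1 + 8 * r) * (1 - 2 * r) * b ^+ 2); last first.
    by field; rewrite gt_eqF.
  apply: le_trans g2 _; apply: ler_wpM2r; rewrite ?sqr_ge0 //; nra.
apply: ler_wpM2l; first by rewrite mulr_ge0 //; lra.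
lra.
Qed.

(* The hypothesis holds for a small vector [x] normal at the origin to an orbit through [w];
   the conclusion then says that the origin is the point of this orbit nearest to [x]. *)
Lemma Bq_slice x w : CH2 R x -> CH2 R w -> dot x w <= dot w w / 4 ->
  1 + dot w w / 2 <= Bq x w * (1 - dot x x).
Proof.
move=> hx hw h.
have l0 : 0 < 1 - dot w w by rewrite subr_gt0 -ballE.
have k0 : 0 < 1 - dot x x by rewrite subr_gt0 -ballE.
rewrite /Bq sqr_cn_den.
rewrite [leRHS](_ : _ = ((1 - dot x w) ^+ 2 + dot x (mul_i w) ^+ 2) / (1 - dot w w)); last first.
  by field; rewrite !gt_eqF.
rewrite ler_pdivlMr //; have := sqr_ge0 (dot x (mul_i w)); have := sqr_ge0 (dot x w).
have := dot_ge0 w; nra.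
Qed.
End TwoPoint.

Section Centred.
Variables (R : realType) (G : groupType)
  (alpha : isometric_action (CH2 R) (bergman R) G).
Local Notation V := 'rV[R]_(2 + 2).
Implicit Types (u v w x z eta : V) (s t : G).

Let ballE z : CH2 R z = (dot z z < 1). Proof. by []. Qed.

Definition gmap s : V -> V := sval (cid (act_isometric alpha s)).

Lemma gmapP s : [/\ smooth_on (CH2 R) (gmap s),
  forall q : CH2 R, set_val (alpha s q) = gmap s (set_val q) &
  forall z u v, CH2 R z ->
    bergman R (gmap s z) ('D_u (gmap s) z) ('D_v (gmap s) z) = bergman R z u v].
Proof. exact: svalP (cid (act_isometric alpha s)). Qed.

Definition inCH z (hz : CH2 R z) : CH2 R := exist _ z (mem_set hz).

Lemma set_valP (q : CH2 R) : CH2 R (set_val q).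
Proof. by have := valP q; rewrite inE. Qed.

Lemma gmap_act s z (hz : CH2 R z) : gmap s z = set_val (alpha s (inCH hz)).
Proof. by have [_ -> _] := gmapP s. Qed.

Lemma gmap_ball s z : CH2 R z -> CH2 R (gmap s z).
Proof. by move=> hz; rewrite (gmap_act s hz); exact: set_valP. Qed.

Lemma gmapM s t z : CH2 R z -> gmap (s * t)%g z = gmap s (gmap t z).
Proof.
by move=> hz; rewrite (gmap_act _ hz) actM; have [_ -> _] := gmapP s; rewrite (gmap_act t hz).
Qed.

Lemma gmap1 z : CH2 R z -> gmap 1%g z = z.
Proof. by move=> hz; rewrite (gmap_act _ hz) act1. Qed.

Lemma isom_gmap s : isom (gmap s) (fun z => 'd (gmap s) z).
Proof.
move=> z hz; have [hs _ hb] := gmapP s.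
have df : differentiable (gmap s) z by have [h _] := hs 1%N; exact: h.
split; [exact: gmap_ball | exact: differentiable_hasd |].
by move=> u v; have := hb z u v hz; rewrite !deriveE.
Qed.

Variable p : V.
Hypothesis hp : CH2 R p.

(* The action conjugated so that [p] becomes the origin. *)
Definition hmap s z : V := moeb p (gmap s (moeb (- p) z)).

Let hNp : CH2 R (- p). Proof. exact: ballN. Qed.

Lemma hmap_ball s z : CH2 R z -> CH2 R (hmap s z).
Proof. by move=> hz; apply: moeb_ball => //; apply: gmap_ball; exact: moeb_ball. Qed.

Lemma moebNK z : CH2 R z -> moeb p (moeb (- p) z) = z.
Proof. by move=> hz; have := moebK hNp hz; rewrite opprK. Qed.

Lemma hmapM s t z : CH2 R z -> hmap (s * t)%g z = hmap s (hmap t z).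
Proof.
move=> hz; have h1 := moeb_ball hNp hz.
by rewrite /hmap gmapM // moebK //; exact: gmap_ball.
Qed.

Lemma hmap1 z : CH2 R z -> hmap 1%g z = z.
Proof. by move=> hz; rewrite /hmap gmap1 ?moebNK //; exact: moeb_ball. Qed.

Lemma hmapVK s z : CH2 R z -> hmap s^-1%g (hmap s z) = z.
Proof. by move=> hz; rewrite -hmapM // mulVg hmap1. Qed.

Lemma hmapKV s z : CH2 R z -> hmap s (hmap s^-1%g z) = z.
Proof. by move=> hz; rewrite -hmapM // mulgV hmap1. Qed.

(** Moving [hmap s 0] back to the origin by a ball automorphism gives an isometry fixing the origin,
    whose inverse comes from [s^-1]; the classification makes it linear. *)
Lemma hmap_form s : exists2 A, uni A &
  forall z, CH2 R z -> hmap s z = moeb (- hmap s 0) (A z).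
Proof.
have ih r : isom (hmap r) _ := isom_comp (isom_comp (isom_moeb hNp) (isom_gmap r)) (isom_moeb hp).
have hy := hmap_ball s (ball0 R); have hNy := ballN hy.
have i1 := isom_comp (ih s) (isom_moeb hy).
have i2 := isom_comp (isom_moeb hNy) (ih s^-1%g).
have hK z : CH2 R z -> (hmap s^-1%g \o moeb (- hmap s 0)) ((moeb (hmap s 0) \o hmap s) z) = z.
  by move=> hz /=; rewrite moebK //; [exact: hmapVK | exact: hmap_ball].
have h0 : (moeb (hmap s 0) \o hmap s) 0 = 0 by rewrite /= moeb_pp.
have [A hA e] := isom_uni i1 i2 hK h0; exists A => // z hz.
by rewrite -e //= moebK //; exact: hmap_ball.
Qed.

Lemma Bq_hmap s z w : CH2 R z -> CH2 R w -> Bq (hmap s z) (hmap s w) = Bq z w.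
Proof.
move=> hz hw; have [A hA e] := hmap_form s; rewrite (e z hz) (e w hw) Bq_moeb ?Bq_uni //.
- by apply: ballN; apply: hmap_ball; exact: ball0.
- exact: uni_ball.
- exact: uni_ball.
Qed.

Definition inv_open (O : set V) :=
  (forall z, CH2 R z -> O z -> exists2 d : R, 0 < d & forall z', nrm (z' - z) < d -> O z') /\
  (forall s z, CH2 R z -> O z -> O (hmap s z)).

Lemma hasd_continuous f z M : hasd f z M -> {for z, continuous f}.
Proof.
move=> hf A /nbhs_ballP[e /= e0 hA]; have [d d0 hd] := hasd_cont hf e0.
apply/nbhs_ballP; exists (d / 2); first by rewrite /= divr_gt0.
move=> w; rewrite -ball_normE /= distrC => hw; apply: hA; rewrite -ball_normE /=.
apply: le_lt_trans (norm_le_nrm _) _; rewrite nrmB.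
have := hd (w - z); rewrite (addrC z) subrK; apply.
by apply: le_lt_trans (nrm_le_norm _) _; rewrite mulrC -ltr_pdivlMr.
Qed.

Lemma inv_openW O : inv_open O ->
  invariant_open alpha [set z | CH2 R z /\ O (moeb p z)].
Proof.
move=> [oO iO]; split=> [q [hq Oq]|s q [hq Oq]].
  have hmq := moeb_ball hp hq; have [d d0 hd] := oO _ hmq Oq.
  have [c c0 hc] := hasd_cont (hasd_moeb hp hq) d0.
  exists (ball (set_val q) (c / 2)); first exact: ball_open.
  split; first by apply: ballxx; rewrite divr_gt0.
  move=> z [+ hz]; rewrite -ball_normE /= distrC => qz; split=> //; apply: hd.
  have := hc (z - set_val q); rewrite (addrC (set_val q)) subrK; apply.
  by apply: le_lt_trans (nrm_le_norm _) _; rewrite mulrC -ltr_pdivlMr.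
split; first exact: set_valP.
have [_ -> _] := gmapP s; have := iO s _ (moeb_ball hp hq) Oq.
by rewrite /hmap moebK.
Qed.

Lemma centred_square (S : R * R -> V) (Lu Hu Lv Hv : set V) :
  covering_dim_le (orbit_space alpha) 1 ->
  continuous S -> (forall x : R * R, CH2 R (S x)) ->
  inv_open Lu -> inv_open Hu -> inv_open Lv -> inv_open Hv ->
  (forall z, CH2 R z -> Lu z \/ Hu z) -> (forall z, CH2 R z -> Lv z \/ Hv z) ->
  (forall b, ~ Hu (S (0, b))) -> (forall b, ~ Lu (S (1, b))) ->
  (forall a, ~ Hv (S (a, 0))) -> (forall a, ~ Lv (S (a, 1))) -> False.
Proof.
move=> dim1 Sc SD iLu iHu iLv iHv cu cv s1 s2 s3 s4.
have bn (x : R * R) : moeb p (moeb (- p) (S x)) = S x by rewrite moebNK.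
apply: (orbit_square dim1 (S := moeb (- p) \o S) _ _ (inv_openW iLu) (inv_openW iHu)
  (inv_openW iLv) (inv_openW iHv)).
- move=> x; apply: continuous_comp; first exact: Sc.
  exact: hasd_continuous (hasd_moeb hNp (SD x)).
- by move=> x; exact: moeb_ball.
- by move=> z hz; have [h|h] := cu _ (moeb_ball hp hz); [left|right].
- by move=> z hz; have [h|h] := cv _ (moeb_ball hp hz); [left|right].
- by move=> b [_]; rewrite /= bn; exact: s1.
- by move=> b [_]; rewrite /= bn; exact: s2.
- by move=> b [_]; rewrite /= bn; exact: s3.
- by move=> b [_]; rewrite /= bn; exact: s4.
Qed.

(** [Low] and [High] say that the infimum of [Bq z] over the orbit of [q] is below, respectively
    above, [c]; the margin [c'] in [High] expresses strictness for the infimum. *)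
Definition Low q c : set V := [set z | exists s, Bq z (hmap s q) < c].
Definition High q c : set V := [set z | exists2 c', c < c' & forall s, c' <= Bq z (hmap s q)].

Lemma inv_open_Low q c : CH2 R q -> inv_open (Low q c).
Proof.
move=> hq; split=> [z hz [s hs]|s z hz [t ht]]; last first.
  by exists (s * t)%g; rewrite hmapM // Bq_hmap //; exact: hmap_ball.
have hsq := hmap_ball s hq.
have B1 : 0 < Bq z (hmap s q).
  by apply: lt_le_trans (Bq_ge hz hsq); rewrite ltr_pwDl // dot_ge0.
pose e := (c / Bq z (hmap s q) - 1) / 2.
have e0 : 0 < e by rewrite divr_gt0 // subr_gt0 ltr_pdivlMr // mul1r.
have [d d0 hd] := Bq_cont hz e0; exists d => // z' /hd[hz' /(_ _ hsq)].
rewrite ler_norml => /andP[_]; rewrite lerBlDr => h; exists s.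
apply: le_lt_trans h _; rewrite /e.
rewrite [ltLHS](_ : _ = (c + Bq z (hmap s q)) / 2); last by field; rewrite gt_eqF.
by rewrite ltr_pdivrMr // mulr_natr mulr2n ltrD2l.
Qed.

(** Openness needs one neighbourhood of [z] for all orbit points at once, which the uniformity of
    [Bq_cont] supplies. *)
Lemma inv_open_High q c : CH2 R q -> 0 < c -> inv_open (High q c).
Proof.
move=> hq c0; split=> [z hz [c' cc' hs]|s z hz [c' cc' ht]]; last first.
  exists c' => // t; have := ht (s^-1 * t)%g; rewrite hmapM // -[X in _ -> _ <= Bq _ X](hmapKV s).
    by rewrite Bq_hmap //; apply: hmap_ball; exact: hmap_ball.
  exact: hmap_ball.
have c'0 : 0 < c' by exact: lt_trans cc'.
pose e := (1 - c / c') / 2.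
have e0 : 0 < e by rewrite divr_gt0 // subr_gt0 ltr_pdivrMr // mul1r.
have [d d0 hd] := Bq_cont hz e0; exists d => // z' /hd[hz' h].
exists ((c + c') / 2); first by rewrite ltr_pdivlMr // mulr_natr mulr2n ltrD2l.
move=> s; have := h _ (hmap_ball s hq); rewrite ler_norml => /andP[+ _].
rewrite lerBrDr; apply: le_trans.
have -> : (c + c') / 2 = (1 - e) * c' by rewrite /e; field; rewrite gt_eqF.
have e1 : e < 1 by rewrite /e ltr_pdivrMr //; have := divr_gt0 c0 c'0; lra.
have := hs s; have : 0 < 1 - e by rewrite subr_gt0.
move: (Bq z _) => b e2 h2; rewrite [leRHS](_ : _ = (1 - e) * b); last by ring.
by rewrite ler_pM2l.
Qed.
End Centred.

(** * Transitivity of the isotropy group on normal directions *)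

Section UniLimit.
Variable R : realType.
Local Notation V := 'rV[R]_(2 + 2).
Implicit Types (u v w x z eta : V) (A B : V -> V).

Let ballE z : CH2 R z = (dot z z < 1). Proof. by []. Qed.

Lemma nrm_mul_i u : nrm (mul_i u) = nrm u.
Proof. by rewrite /nrm dot_mul_i. Qed.

Lemma le_eps_eq0 (x M : R) : (forall e : R, 0 < e -> e <= 1 -> `|x| <= e * M) -> x = 0.
Proof.
move=> h; apply/eqP; rewrite -normr_eq0 eq_le normr_ge0 andbT.
apply/ler_addgt0Pl => e e0; rewrite addr0.
have M0 : 0 <= M by have := h 1 ltr01 (lexx _); rewrite mul1r; exact: le_trans.
have M1 : 0 < 1 + M by rewrite ltr_pwDl.
apply: le_trans (h (Num.min 1 (e / (1 + M))) _ _) _.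
- by rewrite lt_min ltr01 divr_gt0.
- by rewrite ge_min lexx.
apply: (@le_trans _ _ (e / (1 + M) * M)).
  by rewrite ler_wpM2r // ge_min lexx orbT.
by rewrite mulrAC ler_pdivrMr // ler_wpM2l ?(ltW e0) // lerDr.
Qed.

Lemma uni_limit A : is_lin A ->
  (forall e : R, 0 < e -> exists2 B, uni B & forall u, nrm (B u - A u) <= e * nrm u) -> uni A.
Proof.
move=> lA hA; split=> //.
  move=> u v; apply/eqP; rewrite -subr_eq0; apply/eqP.
  apply: (@le_eps_eq0 _ (3 * (nrm u * nrm v))) => e e0 e1.
  have [B uB hB] := hA e e0.
  rewrite (_ : _ - _ = dot (A u - B u) (A v) + dot (B u) (A v - B v)); last first.
    by rewrite !dot_simp (uni_dot u v uB); ring.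
  apply: le_trans (ler_normD _ _) _.
  have Av : nrm (A v) <= 2 * nrm v.
    rewrite -[A v](subrK (B v)); apply: le_trans (nrmD _ _) _.
    have := hB v; rewrite (uni_nrm v uB) nrmB; have := ler_wpM2r (nrm_ge0 v) e1; lra.
  have hu := hB u; have hv := hB v; rewrite nrmB in hu; rewrite nrmB in hv.
  have h1 := le_trans (dot_le_nrm (A u - B u) (A v)) (ler_pM (nrm_ge0 _) (nrm_ge0 _) hu Av).
  have h2 := le_trans (dot_le_nrm (B u) (A v - B v)) (ler_wpM2l (nrm_ge0 _) hv).
  rewrite (uni_nrm u uB) in h2; have := lerD h1 h2; lra.
have [//|nJ] := pselect (forall u, A (mul_i u) = mul_i (A u)); first by left.
right=> u2; apply/eqP; rewrite -subr_eq0 opprK -nrm_eq0; apply/eqP.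
move/existsNP: nJ => [u1 hu1].
have X1 : 0 < nrm (A (mul_i u1) - mul_i (A u1)) by rewrite nrm_gt0 subr_eq0; apply/eqP.
apply: (@le_eps_eq0 _ (2 * nrm u2)) => e e0 _; rewrite ger0_norm ?nrm_ge0 //.
have n1 : 0 < 1 + 2 * nrm u1 by rewrite ltr_pwDl // mulr_ge0 // nrm_ge0.
set X := nrm _ in X1.
(* With a complex linear [B] this close to [A], the defect [X] of [A] at [u1] would be smaller than
   itself; hence all such approximations are antiunitary. *)
pose e' := Num.min e (X / (1 + 2 * nrm u1)).
have e'0 : 0 < e' by rewrite lt_min e0 divr_gt0.
have [B [_ _ hJ] hB] := hA e' e'0.
have dB u : nrm (mul_i (B u - A u)) <= e' * nrm u by rewrite nrm_mul_i.
have dJ u : nrm (A (mul_i u) - B (mul_i u)) <= e' * nrm u.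
  by rewrite nrmB -(nrm_mul_i u).
case: hJ => hJ.
  have := le_trans (nrmD _ _) (lerD (dB u1) (dJ u1)).
  suff : e' * nrm u1 + e' * nrm u1 < X.
    move=> h1 h2; have := le_lt_trans h2 h1.
    by rewrite mul_iB hJ addrC addrA subrK ltxx.
  have : e' * (1 + 2 * nrm u1) <= X.
    by rewrite -ler_pdivlMr // ge_min lexx orbT.
  lra.
have := nrmD (mul_i (A u2 - B u2)) (A (mul_i u2) - B (mul_i u2)).
rewrite mul_iB hJ opprK (_ : _ - _ + _ = A (mul_i u2) + mul_i (A u2)); last first.
  by rewrite addrC -addrA [_ + (_ - _)]addrC subrK.
move=> h; apply: le_trans h _.
have h1 := dB u2; rewrite mul_iB nrmB in h1.
have h2 := dJ u2; rewrite hJ opprK in h2.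
have : e' * nrm u2 <= e * nrm u2 by rewrite ler_wpM2r ?nrm_ge0 // ge_min lexx.
lra.
Qed.
End UniLimit.

Section UniCompact.
Variable R : realType.
Local Notation V := 'rV[R]_(2 + 2).
Implicit Types (u v w x z eta : V) (A B : V -> V).

Lemma uni_cluster (A : nat -> V -> V) : (forall n, uni (A n)) ->
  exists2 B, uni B & forall e : R, 0 < e -> forall N, exists2 n, (N <= n)%N &
    forall u, nrm (A n u - B u) <= e * nrm u.
Proof.
move=> uA.
(* A linear map is stored as the row of its values on the standard basis, all in the unit ball of
   the sup norm; a product of compact sets then gives the cluster point. *)
pose a n : 'rV[V]_(2 + 2) := \row_i A n (delta_mx 0 i).
pose K : set V := [set u | `|u| <= 1].
have cK : compact K.
  apply: bounded_closed_compact.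
    by exists 1; split=> [|M M1 u Ku]; [exact: num_real | exact: le_trans (ltW M1)].
  apply: (@closed_comp _ _ (fun u : V => `|u|) [set x : R | x <= 1]) => [u _|].
    exact: norm_continuous.
  exact: closed_le.
have cKK : compact [set v : 'rV[V]_(2 + 2) | forall i, K (v ord0 i)].
  exact: (@rV_compact V _ (fun=> K)).
have de i : dot (delta_mx 0 i) (delta_mx 0 i) = 1 :> R.
  rewrite /dot (bigD1 i) //= big1 ?addr0 => [|j ji]; rewrite !mxE eqxx /=.
    by rewrite eqxx mul1r.
  by rewrite (negbTE ji) mul0r.
have [|v [Kv cv]] := cKK (a @ \oo) _.
  exists 0%N => // n _ i; rewrite /K /= /a mxE.
  apply: le_trans (norm_le_nrm _) _; rewrite (uni_nrm _ (uA n)).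
  by rewrite /nrm de sqrtr1.
pose B u : V := \sum_i u 0 i *: v 0 i.
have lB : is_lin B.
  split=> [u w|c u]; rewrite /B.
    by rewrite -big_split; apply: eq_bigr => i _; rewrite mxE scalerDl.
  by rewrite scaler_sumr; apply: eq_bigr => i _; rewrite mxE scalerA.
have AE n u : A n u = \sum_i u 0 i *: A n (delta_mx 0 i).
  rewrite {1}(row_sum_delta u) (big_morph (A n) (fun x y => uniD x y (uA n)) (uni0 (uA n))).
  by apply: eq_bigr => i _; rewrite uniZ.
have near_n (e : R) : 0 < e -> forall N, exists2 n, (N <= n)%N &
    forall u, nrm (A n u - B u) <= e * nrm u.
  move=> e0 N; have e4 : 0 < e / 4 by rewrite divr_gt0.
  have [|| _ [[n Nn <-] hn]] := cv [set a n | n in [set n | (N <= n)%N]]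
      [set w | forall i, nrm (w 0 i - v 0 i) < e / 4].
  - by exists N => // n /= Nn; exists n.
  - exists (fun i j => [set w | nrm (w - v i j) < e / 4]) => [i j|w hw i]; last exact: hw.
    apply/nbhs_ballP; exists (e / 4 / 2); first by rewrite /= divr_gt0.
    move=> w; rewrite -ball_normE /= distrC => hw.
    by apply: le_lt_trans (nrm_le_norm _) _; rewrite mulrC -ltr_pdivlMr.
  exists n => // u; rewrite AE /B -sumrB.
  apply: (@le_trans _ _ (\sum_(i < 2 + 2) (e / 4 * nrm u))).
    elim/big_ind2: _ => [|x1 x2 y1 y2 h1 h2|i _]; first by rewrite nrm0.
      exact: le_trans (nrmD _ _) (lerD h1 h2).
    rewrite -scalerBr nrmZ mulrC; apply: ler_pM; rewrite ?nrm_ge0 ?coord_le_nrm //.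
    by have := hn i; rewrite mxE => /ltW.
  by rewrite sumr_const card_ord [leLHS](_ : _ = e * nrm u) //; rewrite -[LHS]mulr_natl; field.
exists B => //; apply: uni_limit => // e e0.
by have [n _ hn] := near_n e e0 0%N; exists (A n).
Unshelve. all: by end_near. Qed.

End UniCompact.

(** The difference is a vector of length at most 3 |y| divided by a number of modulus at least 1/2,
    whence the bound 6 |y|, uniform over the ball. *)
Lemma moeb_near_id (R : realType) (e : R) : 0 < e -> exists2 d, 0 < d &
  forall y, nrm y < d -> CH2 R y /\ forall z, CH2 R z -> nrm (moeb (- y) z - z) <= e.
Proof.
move=> e0; exists (Num.min (1 / 2) (e / 6)); first by rewrite lt_min !divr_gt0.
move=> y; rewrite lt_min => /andP[y1 y2].
have hy : CH2 R y by rewrite /CH2 /= -sqr_nrm expr_lt1 ?nrm_ge0 //; lra.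
split=> // z hz; have z1 := nrm_lt1 hz; have n0 := nrm_ge0 y.
have d0 : 1 - herm z (- y) != 0 by apply: den_neq0 => //; exact: ballN.
have -> : moeb (- y) z - z =
    cscale (1 - herm z (- y))^-1 (Lm y z - z + y - cscale (herm z y) z).
  rewrite moebE Lm_opp opprK LmD (Lm_p hy); apply: herm_inj => w.
  rewrite !herm_simp; field; move: d0; rewrite hermNr opprK //.
have zy : cn (herm z y) <= nrm y.
  by apply: le_trans (cn_herm _ _) _; rewrite ler_piMl // ltW.
have s0 := ms_gt0 hy; have sS := ms_sqr hy; rewrite -sqr_nrm in sS.
have s1 : ms y <= 1 by rewrite -(ler_sqr (ltW s0)) ?nnegrE // sS expr1n lerBlDr lerDl sqr_ge0.
have Lz : nrm (Lm y z - z) <= nrm y.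
  have -> : Lm y z - z = (ms y - 1) *: z + cscale (((1 + ms y)^-1)%:C * herm z y) y.
    by rewrite LmE scalerBl scale1r addrAC.
  apply: le_trans (nrmD _ _) _; rewrite nrmZ nrm_cscale cnM cnR.
  have a1 : `|ms y - 1| * nrm z <= nrm y ^+ 2.
    apply: (@le_trans _ _ `|ms y - 1|); first by rewrite ler_piMr // ltW.
    by rewrite distrC ger0_norm ?subr_ge0 //; nra.
  have a2 : `|(1 + ms y)^-1| * cn (herm z y) * nrm y <= nrm y ^+ 2.
    rewrite expr2 ler_wpM2r // (le_trans _ zy) // ler_piMl ?cn_ge0 //.
    by rewrite ger0_norm ?invr_ge0 ?invf_le1 //; lra.
  by have := lerD a1 a2; nra.
rewrite nrm_cscale cnV.
have D2 : 1 / 2 <= cn (1 - herm z (- y)).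
  apply: le_trans (cn_lb _ _); rewrite nrmN.
  have : nrm z * nrm y <= nrm y by rewrite ler_piMl // ltW.
  lra.
have num : nrm (Lm y z - z + y - cscale (herm z y) z) <= 3 * nrm y.
  have zz : nrm (cscale (herm z y) z) <= nrm y.
    rewrite nrm_cscale (le_trans _ zy) // ler_piMr ?cn_ge0 // ltW //.
  have b1 := nrmD (Lm y z - z + y) (- cscale (herm z y) z).
  have b2 := nrmD (Lm y z - z) y; rewrite nrmN in b1; lra.
have D0 : 0 < cn (1 - herm z (- y)) by lra.
rewrite ler_pdivrMl //; apply: le_trans num _.
by apply: (@le_trans _ _ (1 / 2 * e)); [lra | rewrite ler_wpM2r // ltW].
Qed.

(** * Rotating one normal direction into another *)

Section Rotation.
Variables (R : realType) (G : groupType)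
  (alpha : isometric_action (CH2 R) (bergman R) G) (p : 'rV[R]_(2 + 2)).
Hypothesis hp : CH2 R p.
Hypothesis dim1 : covering_dim_le (orbit_space alpha) 1.
Local Notation V := 'rV[R]_(2 + 2).
Implicit Types (u v w x z eta : V) (s t : G) (A B : V -> V).
Local Notation h := (hmap alpha p).

Let ballE z : CH2 R z = (dot z z < 1). Proof. by []. Qed.

(* The closure of the isotropy group at the origin; the group elements used for the
   approximation need not fix the origin. *)
Definition limit_isom A := uni A /\ forall e : R, 0 < e -> exists s,
  forall z, CH2 R z -> nrm (h s z - A z) <= e.

Variables (xi xi' : V) (r0 : R).
Hypotheses (n1 : dot xi xi = 1) (n2 : dot xi' xi' = 1) (n12 : dot xi xi' = 0).
Hypotheses (r00 : 0 < r0) (r01 : r0 < 1).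

Let eta (b : R) : V := cos b *: xi + sin b *: xi'.

(** Geometrically, the orbit of the origin avoids the open Euclidean ball of radius 2 r0 centred at
    2 r0 [eta b], which touches the origin. For a normal circle this holds with small r0 by
    [star_radius]. *)
Hypothesis star : forall s b, r0 * dot (eta b) (h s 0) <= dot (h s 0) (h s 0) / 4.

Let eta1 b : dot (eta b) (eta b) = 1.
Proof.
have e : dot (eta b) (eta b) = cos b ^+ 2 * dot xi xi + 2 * (cos b * sin b) * dot xi xi'
    + sin b ^+ 2 * dot xi' xi'.
  by rewrite /eta !dot_simp (dotC xi' xi); ring.
by rewrite e n1 n12 n2 !mulr1 mulr0 addr0 cos2Dsin2.
Qed.

Let neta b r : dot (r *: eta b) (r *: eta b) = r ^+ 2.
Proof. by rewrite dotZl dotZr eta1; ring. Qed.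

Let beta b r : 0 <= r -> r <= r0 -> CH2 R (r *: eta b).
Proof.
move=> r_ge0 rr; rewrite ballE neta expr_lt1 //; exact: le_lt_trans rr r01.
Qed.

Let slice b r s : 0 <= r -> r <= r0 ->
  1 + dot (h s 0) (h s 0) / 2 <= Bq (r *: eta b) (h s 0) * (1 - r ^+ 2).
Proof.
move=> r_ge0 rr; rewrite -(neta b); apply: Bq_slice; first exact: beta.
  by apply: hmap_ball => //; exact: ball0.
rewrite dotZl; have w0 := dot_ge0 (h s 0); have := star s b.
move: (dot (eta b) _) (dot (h s 0) _) w0 => x y y0 hxy.
have [x0|x0] := leP x 0.
  by apply: (@le_trans _ _ 0); [rewrite mulr_ge0_le0 | rewrite divr_ge0].
by apply: le_trans hxy; rewrite ler_pM2r.
Qed.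

Let rm := r0 / 2.
Let rm0 : 0 < rm. Proof. by rewrite divr_gt0. Qed.
Let rmr : rm <= r0. Proof. by rewrite /rm ler_pdivrMr //; have := r00; lra. Qed.
Let q := rm *: xi.
Let hq : CH2 R q.
Proof. by have := beta 0 (ltW rm0) rmr; rewrite /eta cos0 sin0 scale1r scale0r addr0. Qed.

(* The radius is clamped to [[r1, r2]] so that [S] is defined on the whole plane. *)
Let S (r1 r2 th : R) (x : R * R) : V :=
  (r1 + (r2 - r1) * ((1 + `|x.1| - `|1 - x.1|) / 2)) *: eta (th * x.2).

Let S_cont r1 r2 th : continuous (S r1 r2 th).
Proof.
move=> x; apply: cvgZ.
  apply: cvgD; first exact: cvg_cst.
  apply: cvgM; first exact: cvg_cst.
  apply: cvgM; last exact: cvg_cst.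
  apply: cvgB.
    apply: cvgD; first exact: cvg_cst.
    by apply: cvg_norm; exact: cvg_fst.
  apply: cvg_norm; apply: cvgB; [exact: cvg_cst | exact: cvg_fst].
have c2 : th * y.2 @[y --> x] --> th * x.2.
  by apply: cvgM; [exact: cvg_cst | exact: cvg_snd].
apply: cvgD; apply: cvgZ; (try exact: cvg_cst).
  by apply: cvg_comp c2 _; exact: continuous_cos.
by apply: cvg_comp c2 _; exact: continuous_sin.
Qed.

(* Otherwise the distances to the orbits of the origin and of [q] separate opposite sides of [S]. *)
Let rotB th c : 1 < c -> exists s, Bq (rm *: eta th) (h s q) < c.
Proof.
move=> c1; apply: contrapT => hno.
have hs s : c <= Bq (rm *: eta th) (h s q).
  by rewrite leNgt; apply/negP => hlt; apply: hno; exists s.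
set x := rm *: eta th in hs.
have hx : CH2 R x by apply: beta => //; exact: ltW.
pose ca := (2 + c) / 3; pose cb := (1 + 2 * c) / 3.
have Bqq : Bq q q = 1.
  rewrite /Bq hermuu -(rmorph1 (real_complex R)) -rmorphB cnR gtr0_norm ?subr_gt0 -?ballE //.
  by rewrite -expr2 divff // expf_neq0 // subr_eq0 gt_eqF // -ballE.
have ea : 0 < (ca - 1) / 2 by rewrite /ca; lra.
have eb : 0 < 1 - cb / c.
  by rewrite subr_gt0 ltr_pdivrMr ?mul1r /cb; lra.
have [da da0 hda] := Bq_cont hq ea.
have [db db0 hdb] := Bq_cont hx eb.
(* Half the range of radii: small enough to keep [r2] below [r0] and to keep both angular edges on
   their sides of [ca] and [cb]. *)
pose k := Num.min (rm / 2) (Num.min (da / 2) (db / 2)).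
have k0 : 0 < k by rewrite !lt_min !divr_gt0.
have [krm kda kdb] : [/\ k <= rm / 2, k < da & k < db].
  have a2 : k <= da / 2 by rewrite /k !ge_min lexx orbT.
  have b2 : k <= db / 2 by rewrite /k !ge_min lexx !orbT.
  split; [by rewrite /k ge_min lexx | lra | lra].
pose r1 := rm - k; pose r2 := rm + k.
have r2r : r2 <= r0 by rewrite /r2; move: krm; rewrite /rm; have := r00; lra.
have r1p : 0 < r1 by rewrite /r1; have := rm0; lra.
have r12 : r1 < r2 by rewrite /r1 /r2; lra.
pose f (a : R) : R := r1 + (r2 - r1) * ((1 + `|a| - `|1 - a|) / 2).
have fb a : r1 <= f a <= r2.
  have h1 : `|a| - `|1 - a| <= 1.
    by have := ler_normD (1 - a) 1 ; have := ler_normB 1 (1 - a); rewrite subKr normr1; lra.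
  have h2 : `|1 - a| - `|a| <= 1 by have := ler_normB 1 a; rewrite normr1; lra.
  rewrite /f; apply/andP; split; first by rewrite lerDl mulr_ge0 //; lra.
  rewrite -lerBrDl -[leRHS]mulr1 ler_wpM2l //; lra.
have f0 : f 0 = r1 by rewrite /f normr0 subr0 normr1; ring.
have f1 : f 1 = r2 by rewrite /f subrr normr0 normr1; field.
have SE a b : S r1 r2 th (a, b) = f a *: eta (th * b) by [].
have r2_1 : r2 < 1 by exact: le_lt_trans r2r r01.
have dd (r : R) : 0 < r -> r < 1 -> 0 < 1 - r ^+ 2.
  by move=> ra rb; rewrite subr_gt0 expr_lt1 // ltW.
have c0 : 0 < c by lra.
have p2 : 0 < 1 - r2 ^+ 2 by apply: dd => //; exact: lt_trans r12.
have p1 : 0 < 1 - r1 ^+ 2 by apply: dd => //; exact: lt_trans r2_1.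
have fk a : nrm (f a *: xi - q) <= k /\ nrm (f a *: eta th - x) <= k.
  rewrite /q /x -!scalerBl !nrmZ /nrm n1 eta1 sqrtr1 mulr1.
  have /andP[] := fb a; rewrite /r1 /r2 => g1 g2.
  by rewrite ler_norml; have g3 : - k <= f a - rm <= k; [apply/andP; split; lra | split].
(* (1 - r^2)^-1 is the value of [Bq] between a vector of length r and the origin. By [slice] it is
   the minimum over the orbit of the origin, so the first pair of sets separates the radii [r1] and
   [r2]. *)
have := @centred_square _ _ alpha p hp (S r1 r2 th) (Low alpha p 0 (1 - r2 ^+ 2)^-1)
  (High alpha p 0 (1 - r1 ^+ 2)^-1) (Low alpha p q cb) (High alpha p q ca) dim1
  (@S_cont _ _ _).
apply.
- move=> [a b]; rewrite SE; have /andP[g1 g2] := fb a; apply: beta.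
    by apply: le_trans g1; exact: ltW.
  exact: le_trans r2r.
- by apply: inv_open_Low => //; exact: ball0.
- apply: inv_open_High => //; first exact: ball0.
  by rewrite invr_gt0.
- exact: inv_open_Low.
- by apply: inv_open_High => //; rewrite /ca; lra.
- move=> z hz; have [hl|hl] := pselect (exists s, Bq z (h s 0) < (1 - r2 ^+ 2)^-1).
    by left.
  right; exists (1 - r2 ^+ 2)^-1.
    rewrite ltf_pV2 ?posrE //.
    by rewrite ltrD2l ltrN2 ltr_sqr ?nnegrE // ltW // (lt_trans r1p).
  by move=> s; rewrite leNgt; apply/negP => hlt; apply: hl; exists s.
- move=> z hz; have [hl|hl] := pselect (exists s, Bq z (h s q) < cb); first by left.
  right; exists cb; first by rewrite /ca /cb; lra.
  by move=> s; rewrite leNgt; apply/negP => hlt; apply: hl; exists s.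
- move=> b [c' + /(_ 1%g)]; rewrite SE f0 (hmap1 alpha hp (ball0 R)) Bq0 neta => h1 h2.
  by have := lt_le_trans h1 h2; rewrite ltxx.
- move=> b [s]; rewrite SE f1 ltNge => /negP; apply.
  rewrite -[leLHS]mul1r ler_pdivrMr //.
  apply: le_trans (slice _ _ _ r2r); last by rewrite ltW // (lt_trans r1p).
  by rewrite lerDl divr_ge0 // dot_ge0.
- move=> a [c' h1 /(_ 1%g)]; rewrite SE mulr0 (hmap1 alpha hp hq) /eta cos0 sin0 scale1r scale0r addr0.
  have [g1 _] := fk a; have [_ /(_ q hq)] := hda _ (le_lt_trans g1 kda).
  by rewrite Bqq ler_norml => /andP[_ g2] g3; move: g2 h1 g3; rewrite /ca; lra.
- move=> a [s]; rewrite SE mulr1 ltNge => /negP; apply.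
  have [_ g1] := fk a; have hsq := hmap_ball alpha hp s hq.
  have [_ /(_ _ hsq)] := hdb _ (le_lt_trans g1 kdb).
  rewrite ler_norml => /andP[+ _]; rewrite lerBrDr; apply: le_trans.
  rewrite [leRHS](_ : _ = cb / c * Bq x (h s q)); last by ring.
  rewrite mulrAC ler_pdivlMr // ler_wpM2l // /cb; lra.
Qed.

(** An element carrying [q] close to [x] almost fixes the origin: the image w of the origin is
    nearly as close to [x] as the origin is to [q], whereas [slice] makes the [Bq] value between [x]
    and w exceed this by a positive multiple of |w|^2. *)
Let approx th (e : R) : 0 < e -> exists s,
  nrm (h s 0) <= e /\ nrm (h s q - rm *: eta th) <= e.
Proof.
move=> e0; set x := rm *: eta th.
have hx : CH2 R x by apply: beta => //; exact: ltW.
(* The final bound is |h s 0|^2 <= 2 d / (1 - d) <= 4 d <= e^2. *)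
pose d := Num.min (1 / 2) (e ^+ 2 / 4).
have d0 : 0 < d by rewrite lt_min !divr_gt0 // exprn_gt0.
have d12 : d <= 1 / 2 by rewrite ge_min lexx.
have de : d <= e ^+ 2 / 4 by rewrite ge_min lexx orbT.
have [c c0 hc] := Bq_cont hx d0.
pose k := Num.min (e ^+ 2) (c ^+ 2 / 2).
have k0 : 0 < k by rewrite lt_min !(divr_gt0, exprn_gt0).
have [s hs] := @rotB th (1 + k) (ltac:(by rewrite ltrDl)).
have hsq := hmap_ball alpha hp s hq; have hs0 := hmap_ball alpha hp s (ball0 R).
have := le_lt_trans (Bq_ge hx hsq) hs; rewrite ltrD2l -sqr_nrm nrmB => xk.
have xe : nrm (h s q - x) <= e.
  rewrite -ler_sqr ?nnegrE ?nrm_ge0 ?(ltW e0) //; apply: le_trans (ltW xk) _.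
  by rewrite ge_min lexx.
have xc : nrm (h s q - x) < c.
  rewrite -ltr_sqr ?nnegrE ?nrm_ge0 ?(ltW c0) //; apply: lt_le_trans xk _.
  rewrite ge_min; apply/orP; right; have := sqr_ge0 c; lra.
exists s; split=> //.
have [_ /(_ _ hs0)] := hc _ xc.
rewrite Bq_hmap //; last exact: ball0.
have n0 : nrm (h s 0) ^+ 2 <= 2 * (d / (1 - d)) -> nrm (h s 0) <= e.
  move=> h1; rewrite -ler_sqr ?nnegrE ?nrm_ge0 ?(ltW e0) //; apply: le_trans h1 _.
  rewrite mulrA ler_pdivrMr; last lra.
  have := sqr_ge0 e; nra.
move=> hB; apply: n0; rewrite sqr_nrm.
have rm1 : 0 < 1 - rm ^+ 2.
  rewrite subr_gt0 expr_lt1 ?(ltW rm0) //; exact: le_lt_trans rmr r01.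
have hsl := slice th s (ltW rm0) rmr.
have Bqx : Bq q 0 = (1 - rm ^+ 2)^-1.
  by rewrite Bq0 /q dotZl dotZr n1 mulr1.
move: hB; rewrite Bqx -/x ler_norml => /andP[hB _].
set b := Bq x _ in hB hsl; set w := dot _ _ in hsl *.
have B1 : (1 - d) * b * (1 - rm ^+ 2) <= 1.
  rewrite -ler_pdivlMr // mul1r; move: hB; lra.
rewrite mulrCA mulrA ler_pdivlMr; last lra.
have := ler_wpM2l (ltac:(lra) : 0 <= 1 - d) hsl; rewrite mulrA => h1.
have := le_trans h1 B1; lra.
Qed.

(** The elements from [approx] factor as a linear isometry followed by a ball automorphism tending
    to the identity, so a cluster point of the linear parts is the required limit. *)
Lemma rotation th : exists2 A, limit_isom A & A xi = eta th.
Proof.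
have /choice[sg hsg] : forall n : nat, exists s,
    nrm (h s 0) <= n.+1%:R^-1 /\ nrm (h s q - rm *: eta th) <= n.+1%:R^-1.
  by move=> n; apply: approx; rewrite invr_gt0 ltr0n.
have /choice[A hA] : forall n : nat, exists A, uni A /\
    forall z, CH2 R z -> h (sg n) z = moeb (- h (sg n) 0) (A z).
  by move=> n; have [A uA eA] := hmap_form alpha hp (sg n); exists A.
have [B uB hB] := uni_cluster (fun n => (hA n).1).
have key (e : R) : 0 < e -> exists s, nrm (h s q - rm *: eta th) <= e /\
    forall z, CH2 R z -> nrm (h s z - B z) <= e.
  move=> e0; have e2 : 0 < e / 2 by rewrite divr_gt0.
  have [d d0 hd] := moeb_near_id e2.
  pose m := Num.min e (d / 2); have m0 : 0 < m by rewrite lt_min e0 divr_gt0.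
  pose N := Num.truncn m^-1.
  have [n Nn hn] := hB _ e2 N.
  have nm : n.+1%:R^-1 < m.
    rewrite invf_plt ?posrE ?ltr0n //.
    by apply: lt_le_trans (truncnS_gt _) _; rewrite ler_nat ltnS.
  have [g1 g2] := hsg n; exists (sg n); split.
    by apply: le_trans g2 _; apply: le_trans (ltW nm) _; rewrite ge_min lexx.
  move=> z hz; have [uA eA] := hA n; rewrite eA //.
  have yd : nrm (h (sg n) 0) < d.
    apply: le_lt_trans g1 _; apply: lt_le_trans nm _; rewrite ge_min; apply/orP; right; lra.
  have [_ /(_ (A n z) (uni_ball uA hz)) h1] := hd _ yd.
  have h2 := hn z; have z1 := nrm_lt1 hz.
  apply: le_trans (nrm_triangle (A n z) _ _) _.
  rewrite [e]splitr; apply: lerD => //; apply: le_trans h2 _.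
  by rewrite ler_piMr // ltW.
exists B; first by split=> // e e0; have [s [_ hs]] := key e e0; exists s.
have Bq : B q = rm *: eta th.
  apply/eqP; rewrite -subr_eq0 -nrm_eq0; apply/eqP.
  apply: (@le_eps_eq0 _ _ 2) => e e0 _; rewrite ger0_norm ?nrm_ge0 //.
  have [s [h1 h2]] := key e e0.
  apply: le_trans (nrm_triangle (h s q) _ _) _.
  have := h2 q hq; rewrite nrmB => h3; have := lerD h3 h1; lra.
have rn : rm != 0 by rewrite gt_eqF.
by apply: (scalerI rn); rewrite -Bq /q uniZ.
Qed.
End Rotation.

(** * Second order Taylor expansions *)

Section SecondOrder.
Variables (R : realType) (W : normedModType R).
Local Notation V := 'rV[R]_(2 + 2).
Implicit Types (a b h x : W) (eta : V) (F : W -> V).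

Lemma is_derive_line F x h (t : R) eta : differentiable F (x + t *: h) ->
  is_derive t 1 (fun s : R => dot eta (F (x + s *: h))) (dot eta ('D_h F (x + t *: h))).
Proof.
move=> df; rewrite deriveE //; apply: is_derive_eps => e e0.
have n1 : 0 < 1 + nrm eta by rewrite ltr_pwDl ?nrm_ge0.
have n2 : 0 < 1 + `|h| by rewrite ltr_pwDl.
pose e' := e / (2 * (1 + nrm eta) * (1 + `|h|)).
have e'0 : 0 < e' by rewrite divr_gt0 // !mulr_gt0.
have [d d0 hd] := differentiable_eps df e'0.
exists (d / (1 + `|h|)); first by rewrite divr_gt0.
move=> k; rewrite ltr_pdivlMr // => hk.
have kh : `|k *: h| <= `|k| * (1 + `|h|) by rewrite normrZ ler_wpM2l // lerDr.
have := hd (k *: h) (le_lt_trans kh hk).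
rewrite -[x + t *: h + k *: h]addrA -scalerDl linearZ /= => h1.
rewrite [_ * k]mulrC -dotZr -!dotBr.
apply: le_trans (dot_le_nrm _ _) _.
apply: le_trans (ler_wpM2l (nrm_ge0 _) (nrm_le_norm _)) _.
have h2 : `|F (x + (t + k) *: h) - F (x + t *: h) - k *: 'd F (x + t *: h) h|
    <= e' * (`|k| * (1 + `|h|)).
  by apply: le_trans h1 _; rewrite ler_wpM2l // ltW.
apply: (@le_trans _ _ ((1 + nrm eta) * (2 * (e' * (`|k| * (1 + `|h|)))))).
  by apply: ler_pM; rewrite ?nrm_ge0 ?mulr_ge0 ?lerDr ?ler_wpM2l.
by rewrite /e' le_eqVlt; apply/orP; left; apply/eqP; field; rewrite !gt_eqF.
Qed.

Lemma derive_first_order F x a (e : R) : differentiable ('D_a F) x -> 0 < e ->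
  exists2 d : R, 0 < d & forall h, `|h| < d ->
    nrm ('D_a F (x + h) - 'D_a F x - 'D_h ('D_a F) x) <= e * `|h|.
Proof.
move=> df e0; have e2 : 0 < e / 2 by rewrite divr_gt0.
have [d d0 hd] := differentiable_eps df e2; exists d => // h hh.
apply: le_trans (nrm_le_norm _) _; rewrite (deriveE h df).
by have := hd h hh; lra.
Qed.

Variables (U : set W) (F : W -> V) (x0 : W).
Hypotheses (oU : open U) (Ux : U x0) (F1 : forall x, U x -> differentiable F x)
  (F2 : forall a, differentiable ('D_a F) x0).

Lemma open_ball_norm : exists2 d : R, 0 < d & forall h, `|h| < d -> U (x0 + h).
Proof.
have /nbhs_ballP[d /= d0 hd] : nbhs x0 U by apply: open_nbhs_nbhs.
exists d => // h hh; apply: hd.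
by rewrite -ball_normE /= opprD addNKr normrN.
Qed.

Let Q h a := 'D_h ('D_a F) x0.

Lemma deriveD_dir x a b : U x -> 'D_(a + b) F x = 'D_a F x + 'D_b F x.
Proof. by move=> hx; rewrite !deriveE ?linearD //; exact: F1. Qed.

Lemma deriveZ_dir x (c : R) a : U x -> 'D_(c *: a) F x = c *: 'D_a F x.
Proof. by move=> hx; rewrite !deriveE ?linearZ //; exact: F1. Qed.

Let QDl h k a : Q (h + k) a = Q h a + Q k a.
Proof. by rewrite /Q !deriveE // linearD. Qed.

Let QZl (c : R) h a : Q (c *: h) a = c *: Q h a.
Proof. by rewrite /Q !deriveE // linearZ. Qed.

(** Tested against [eta], the mixed second difference is the increment of one real function. The
    mean value theorem turns it into a difference of values of ['D_a F], which differentiability at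
    [x0] evaluates. Being symmetric in [a] and [b], it yields the symmetry of second derivatives. *)
Let increment a b (e : R) : 0 < e -> exists2 d : R, 0 < d &
  forall t : R, 0 < t -> t < d -> forall eta,
  `|dot eta (F (x0 + t *: a + t *: b) - F (x0 + t *: a) - F (x0 + t *: b) + F x0
      - t ^+ 2 *: Q b a)| <= nrm eta * (e * t ^+ 2 * (2 * `|a| + `|b|)).
Proof.
move=> e0; have [d1 d10 hU] := open_ball_norm.
have [d2 d20 hd] := derive_first_order (F2 a) e0.
have n1 : 0 < 1 + `|a| + `|b| by rewrite -addrA ltr_pwDl // addr_ge0.
exists (Num.min d1 d2 / (1 + `|a| + `|b|)); first by rewrite divr_gt0 // lt_min d10.
move=> t t0; rewrite ltr_pdivlMr // => td eta.
have small (c : R) (y : bool) : 0 <= c <= 1 ->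
    `|(c * t) *: a + (y%:R * t) *: b| <= t * (`|a| + y%:R * `|b|).
  move=> /andP[c0 c1]; apply: le_trans (ler_normD _ _) _; rewrite !normrZ mulrDr.
  rewrite ?normrM (ger0_norm c0) (gtr0_norm t0) (ger0_norm (ler0n R y)).
  apply: lerD; last by rewrite mulrCA mulrA mulrC mulrA.
  by rewrite ler_wpM2r // ler_piMl // ltW.
have small2 (c : R) (y : bool) : 0 <= c <= 1 ->
    `|(c * t) *: a + (y%:R * t) *: b| < Num.min d1 d2.
  move=> hc; apply: le_lt_trans (small c y hc) _; apply: le_lt_trans td.
  rewrite ler_wpM2l ?(ltW t0) //; case: y; rewrite ?mul1r ?mul0r; have := normr_ge0 b; lra.
pose Y (y : bool) := x0 + (y%:R * t) *: b.
have YE y (c : R) : Y y + c *: (t *: a) = x0 + ((c * t) *: a + (y%:R * t) *: b).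
  by rewrite /Y scalerA -addrA [_ *: b + _]addrC.
have dif y (c : R) : 0 <= c <= 1 -> differentiable F (Y y + c *: (t *: a)).
  move=> hc; apply: F1; rewrite YE; apply: hU.
  by have := small2 c y hc; rewrite lt_min => /andP[].
pose g (y : bool) (c : R) := dot eta (F (Y y + c *: (t *: a))).
have dg y (c : R) : 0 <= c <= 1 -> is_derive c 1 (g y) (dot eta ('D_(t *: a) F (Y y + c *: (t *: a)))).
  by move=> hc; exact: is_derive_line (dif y c hc).
have dG (c : R) : 0 <= c <= 1 -> is_derive c 1 (fun s => g true s - g false s) _ :=
  fun hc => is_derive_sub (dg true c hc) (dg false c hc).
have [c /andP[c0 c1]] := MVT_cc ltr01 dG.
have hc : 0 <= c <= 1 by rewrite !ltW.
rewrite subr0 mulr1 /g !scale1r !scale0r !addr0 /Y !mul0r !mul1r !scale0r !addr0 => hM.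
have -> : dot eta (F (x0 + t *: a + t *: b) - F (x0 + t *: a) - F (x0 + t *: b) + F x0
      - t ^+ 2 *: Q b a) =
    t * dot eta ('D_a F (Y true + c *: (t *: a)) - 'D_a F (Y false + c *: (t *: a)) - t *: Q b a).
  have := hM; rewrite [x0 + t *: b + t *: a]addrAC.
  have dz y : 'D_(t *: a) F (Y y + c *: (t *: a)) = t *: 'D_a F (Y y + c *: (t *: a)).
    by have df := dif y c hc; rewrite (deriveE _ df) (deriveE a df) linearZ.
  have := dz true; have := dz false; rewrite /Y !mul0r !mul1r !scale0r !addr0 => -> ->.
  move: (F (x0 + t *: a + t *: b)) (F (x0 + t *: a)) (F (x0 + t *: b)) (F x0) => v1 v2 v3 v4.
  move: ('D_a F _) ('D_a F _) (Q b a) => v5 v6 v7.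
  rewrite !dot_simp => e1; rewrite [LHS](_ : _ =
    dot eta v1 - dot eta v2 - (dot eta v3 - dot eta v4) - t ^+ 2 * dot eta v7); last by ring.
  by rewrite e1; ring.
rewrite !YE normrM gtr0_norm //.
set k1 := _ + (true%:R * t) *: b; set k0 := _ + (false%:R * t) *: b.
have [s1 s0] := (small2 c true hc, small2 c false hc).
rewrite lt_min in s1; rewrite lt_min in s0.
have /andP[_ s12] := s1; have /andP[_ s02] := s0.
have := hd _ s12; have := hd _ s02; rewrite -/k0 -/k1 -!/(Q _ a) => h0 h1.
have Qk : Q k1 a - Q k0 a = t *: Q b a.
  by rewrite /k1 /k0 !QDl !QZl mul0r mul1r scale0r addr0 addrC addKr.
have -> : 'D_a F (x0 + k1) - 'D_a F (x0 + k0) - t *: Q b a =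
   ('D_a F (x0 + k1) - 'D_a F x0 - Q k1 a) - ('D_a F (x0 + k0) - 'D_a F x0 - Q k0 a).
  rewrite -Qk; move: ('D_a F _) ('D_a F _) ('D_a F _) (Q k1 a) (Q k0 a) => u1 u2 u3 u4 u5.
  apply: dot_inj => w; rewrite !dot_simp; ring.
have k1n := small c true hc; have k0n := small c false hc.
rewrite -/k1 mul1r in k1n; rewrite -/k0 mul0r addr0 in k0n.
apply: (@le_trans _ _ (t * (nrm eta * (e * `|k1| + e * `|k0|)))).
  rewrite ler_wpM2l ?(ltW t0) //; apply: le_trans (dot_le_nrm _ _) _.
  rewrite ler_wpM2l ?nrm_ge0 //; apply: le_trans (nrmD _ _) _; rewrite nrmN.
  exact: lerD.
rewrite mulrCA ler_wpM2l ?nrm_ge0 // -mulrDr mulrCA -mulrA ler_wpM2l ?(ltW e0) //.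
rewrite expr2 -mulrA ler_wpM2l ?(ltW t0) //; apply: le_trans (lerD k1n k0n) _.
by rewrite -mulrDr ler_wpM2l ?(ltW t0) // mulr_natl mulr2n addrAC.
Qed.

Lemma second_derive_sym a b : Q a b = Q b a.
Proof.
apply: dot_inj => eta; apply/eqP; rewrite -subr_eq0 -dotBr; apply/eqP.
apply: (@le_eps_eq0 _ _ (nrm eta * (3 * (`|a| + `|b|)))) => e e0 _.
have [d1 d10 h1] := increment a b e0; have [d2 d20 h2] := increment b a e0.
pose t := Num.min d1 d2 / 2.
have t0 : 0 < t by rewrite divr_gt0 // lt_min d10.
have tm : t < Num.min d1 d2 by rewrite /t ltr_pdivrMr // mulr_natr mulr2n ltrDl lt_min d10.
move: tm; rewrite lt_min => /andP[t1 t2].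
have := h1 t t0 t1 eta; have := h2 t t0 t2 eta.
rewrite [x0 + t *: b + t *: a]addrAC.
set X := F (x0 + t *: a + t *: b); set Y := F (x0 + t *: a); set Z := F (x0 + t *: b).
move=> g2 g1; have t2p : 0 < t ^+ 2 by rewrite exprn_gt0.
rewrite -(ler_pM2l t2p) -{1}(gtr0_norm t2p) -normrM -dotZr scalerBr.
have -> : dot eta (t ^+ 2 *: Q a b - t ^+ 2 *: Q b a) =
   dot eta (X - Y - Z + F x0 - t ^+ 2 *: Q b a) - dot eta (X - Z - Y + F x0 - t ^+ 2 *: Q a b).
  clear g1 g2; move: (Q a b) (Q b a) (F x0) X Y Z => q1 q2 p X Y Z.
  by rewrite !dot_simp; ring.
apply: le_trans (ler_normB _ _) _.
apply: le_trans (lerD g1 g2) _; clear; rewrite le_eqVlt; apply/orP; left; apply/eqP; ring.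
Qed.
End SecondOrder.

Section Taylor.
Variables (R : realType) (k : nat).
Local Notation V := 'rV[R]_(2 + 2).
Local Notation W := 'rV[R]_k.
Variables (U : set W) (F : W -> V) (x0 : W).
Hypotheses (oU : open U) (Ux : U x0) (F1 : forall x, U x -> differentiable F x)
  (F2 : forall a, differentiable ('D_a F) x0).

Let Q h a := 'D_h ('D_a F) x0.

Lemma Q_sym a b : Q a b = Q b a. Proof. exact: (second_derive_sym oU Ux F1 F2). Qed.

Lemma QDl h h' a : Q (h + h') a = Q h a + Q h' a.
Proof. by rewrite /Q !deriveE // linearD. Qed.

Lemma QZl (c : R) h a : Q (c *: h) a = c *: Q h a.
Proof. by rewrite /Q !deriveE // linearZ. Qed.

Lemma QDr h a b : Q h (a + b) = Q h a + Q h b.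
Proof. by rewrite !(Q_sym h) QDl. Qed.

Lemma QZr (c : R) h a : Q h (c *: a) = c *: Q h a.
Proof. by rewrite !(Q_sym h) QZl. Qed.

Lemma row_coord_le (h : W) i : `|h 0 i| <= `|h|.
Proof.
by rewrite [leRHS]mx_normrE; exact: (le_bigmax _ (fun ij : 'I_1 * 'I_k => `|h ij.1 ij.2|) (0, i)).
Qed.

Lemma derive_coord h x : U x -> 'D_h F x = \sum_i h 0 i *: 'D_(delta_mx 0 i) F x.
Proof.
move=> hx; rewrite {1}[h]row_sum_delta.
elim/big_ind2: _ => [|a v b w <- <-|i _].
- by rewrite deriveE ?linear0 //; exact: F1.
- by rewrite (deriveD_dir F1).
- by rewrite (deriveZ_dir F1).
Qed.

Lemma Q_coord g h : Q g h = \sum_i h 0 i *: Q g (delta_mx 0 i).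
Proof.
rewrite {1}[h]row_sum_delta; elim/big_ind2: _ => [|a v b w <- <-|i _].
- by rewrite -(scale0r 0) QZr scale0r.
- by rewrite QDr.
- by rewrite QZr.
Qed.

Lemma nrm_sum (I : finType) (f : I -> V) : nrm (\sum_i f i) <= \sum_i nrm (f i).
Proof.
elim/big_ind2: _ => [|x1 x2 y1 y2 h1 h2|//]; first by rewrite nrm0.
by apply: le_trans (nrmD _ _) _; exact: lerD.
Qed.

(** Uniformity in the direction [g] reduces to the finitely many basis directions. *)
Lemma derive_dir_first_order (e : R) : 0 < e -> exists2 d : R, 0 < d & forall h g, `|h| < d ->
  nrm ('D_g F (x0 + h) - 'D_g F x0 - Q h g) <= e * `|h| * `|g|.
Proof.
move=> e0; have k1 : 0 < 1 + k%:R :> R by rewrite ltr_pwDl.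
have ek : 0 < e / (1 + k%:R) by rewrite divr_gt0.
have [d1 d10 hU] := open_ball_norm oU Ux.
have : \forall h \near (0 : W), forall i : 'I_k,
    nrm ('D_(delta_mx 0 i) F (x0 + h) - 'D_(delta_mx 0 i) F x0 - Q h (delta_mx 0 i))
     <= e / (1 + k%:R) * `|h|.
  apply: (@filter_forall _ _ _ (nbhs (0 : W)) _) => i.
  have [d d0 hd] := derive_first_order (F2 (delta_mx 0 i)) ek.
  apply/nbhs_ballP; exists d => //= h; rewrite -ball_normE /= sub0r normrN => hh.
  exact: hd.
move=> /nbhs_ballP[d2 /= d20 hd].
exists (Num.min d1 d2); first by rewrite lt_min d10.
move=> h g; rewrite lt_min => /andP[h1 h2].
have hd' : forall i, _ := hd h _; rewrite -ball_normE /= sub0r normrN in hd'.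
rewrite Q_coord (derive_coord g (hU h h1)) (derive_coord g Ux) -!sumrB.
apply: le_trans (nrm_sum _) _.
apply: (@le_trans _ _ (\sum_(i < k) `|g| * (e / (1 + k%:R) * `|h|))).
  apply: ler_sum => i _; rewrite -!scalerBr nrmZ.
  by apply: ler_pM; rewrite ?nrm_ge0 ?row_coord_le // hd'.
rewrite sumr_const card_ord -[_ *+ k]mulr_natl.
rewrite [leLHS](_ : _ = (k%:R / (1 + k%:R)) * (e * `|h| * `|g|)); last by ring.
rewrite ler_piMl //; first by rewrite -mulrA; apply: mulr_ge0; [exact: ltW|exact: mulr_ge0].
by rewrite ler_pdivrMr // mul1r lerDr.
Qed.

Lemma taylor2 (e : R) : 0 < e -> exists2 d : R, 0 < d & forall h, `|h| < d ->
  nrm (F (x0 + h) - F x0 - 'D_h F x0 - 2^-1 *: Q h h) <= e * `|h| ^+ 2.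
Proof.
move=> e0; have [d1 d10 hU] := open_ball_norm oU Ux.
have [d2 d20 hd] := derive_dir_first_order e0.
exists (Num.min d1 d2); first by rewrite lt_min d10.
move=> h; rewrite lt_min => /andP[h1 h2].
set E := F (x0 + h) - _ - _ - _.
have sm (c : R) : 0 <= c <= 1 -> `|c *: h| <= `|h|.
  by move=> /andP[c0 c1]; rewrite normrZ ger0_norm // ler_piMl.
have UU (c : R) : 0 <= c <= 1 -> U (x0 + c *: h).
  by move=> hc; apply: hU; exact: le_lt_trans (sm c hc) h1.
(* The remainder [E] is tested against itself: the mean value theorem bounds |E|^2 by |E| times a
   first order remainder of ['D_h F]. *)
have dg (c : R) : 0 <= c <= 1 -> is_derive c 1
   (fun t : R => dot E (F (x0 + t *: h)) - (t * dot E ('D_h F x0) - t * (t * - (2^-1 * dot E (Q h h)))))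
   (dot E ('D_h F (x0 + c *: h)) - (dot E ('D_h F x0) - (1 * (c * - (2^-1 * dot E (Q h h))) + c * - (2^-1 * dot E (Q h h))))).
  move=> hc; apply: is_derive_sub.
    by apply: is_derive_line; apply: F1; exact: UU.
  apply: is_derive_sub; first exact: is_derive_scl.
  exact: (is_derive_mul (is_derive_id c (1 : R)) (is_derive_scl c _)).
have [c /andP[c0 c1]] := MVT_cc ltr01 dg.
have hc : 0 <= c <= 1 by rewrite !ltW.
rewrite subr0 mulr1 scale1r scale0r addr0 !mul0r !mul1r !subr0 => hM.
have : dot E E = dot E ('D_h F (x0 + c *: h) - 'D_h F x0 - Q (c *: h) h).
  rewrite QZl {2}/E; clear dg; move: hM; generalize E; move=> {}E; move: (F _) (F _) ('D_h F _) ('D_h F _) (Q h h).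
  move=> v1 v2 v3 v4 v5 hM; rewrite !dot_simp; lra.
have cd2 : `|c *: h| < d2 by exact: le_lt_trans (sm c hc) h2.
have hd' := hd (c *: h) h cd2.
have [->|E0] := eqVneq E 0; first by rewrite nrm0 mulr_ge0 ?sqr_ge0 // ltW.
rewrite -nrm_gt0 in E0.
move=> hE; rewrite -(ler_pM2l E0) -expr2 sqr_nrm hE.
apply: le_trans (le_trans (ler_norm _) (dot_le_nrm _ _)) _; rewrite ler_wpM2l ?nrm_ge0 //.
apply: le_trans hd' _; rewrite expr2 mulrA ler_wpM2r // ler_wpM2l ?(ltW e0) //.
exact: sm.
Qed.
End Taylor.

Section LinearBounds.
Variables (R : realType) (k : nat).
Local Notation V := 'rV[R]_(2 + 2).
Local Notation W := 'rV[R]_k.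

Lemma linear_bound (Y : normedModType R) (f : {linear W -> Y}) :
  exists2 C : R, 0 < C & forall h, `|f h| <= C * `|h|.
Proof.
exists (1 + \sum_i `|f (delta_mx 0 i)|); first by rewrite ltr_pwDl // sumr_ge0.
move=> h; rewrite {1}[h]row_sum_delta linear_sum /=.
apply: le_trans (ler_norm_sum _ _ _) _.
rewrite mulrDl mul1r mulr_suml; apply: ler_wpDl => //; apply: ler_sum => i _.
by rewrite linearZ normrZ mulrC ler_wpM2l // row_coord_le.
Qed.

End LinearBounds.

Section InjectiveBound.
Variables (R : realType) (k : nat).
Local Notation V := 'rV[R]_(2 + 2).
Local Notation W := 'rV[R]_k.

Definition wlin (f : W -> V) :=
  (forall u v, f (u + v) = f u + f v) /\ (forall (c : R) u, f (c *: u) = c *: f u).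

Lemma wlin_sum f h : wlin f -> f h = \sum_i h 0 i *: f (delta_mx 0 i).
Proof.
move=> [fD fZ]; rewrite {1}[h]row_sum_delta.
elim/big_ind2: _ => [|a v b w <- <-|i _]; last by rewrite fZ.
  by rewrite -(scale0r 0) fZ scale0r.
by rewrite fD.
Qed.

Lemma wlin_bound f : wlin f -> exists2 C : R, 0 < C & forall h, nrm (f h) <= C * `|h|.
Proof.
move=> fl; exists (1 + \sum_i nrm (f (delta_mx 0 i))).
  by rewrite ltr_pwDl // sumr_ge0 // => i _; exact: nrm_ge0.
move=> h; rewrite (wlin_sum h fl).
apply: le_trans (nrm_sum _) _.
rewrite mulrDl mul1r mulr_suml; apply: ler_wpDl => //; apply: ler_sum => i _.
by rewrite nrmZ mulrC ler_wpM2l ?nrm_ge0 // row_coord_le.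
Qed.

Lemma bilin_bound (f : W -> W -> V) : (forall a, wlin (f^~ a)) -> (forall h, wlin (f h)) ->
  exists2 C : R, 0 < C & forall h a, nrm (f h a) <= C * `|h| * `|a|.
Proof.
move=> fl fr.
exists (1 + \sum_i \sum_j nrm (f (delta_mx 0 i) (delta_mx 0 j))).
  by rewrite ltr_pwDl // sumr_ge0 // => i _; rewrite sumr_ge0 // => j _; exact: nrm_ge0.
move=> h a; rewrite (wlin_sum h (fl a)).
apply: le_trans (nrm_sum _) _.
rewrite !mulrDl !mul1r !mulr_suml; apply: ler_wpDl; first exact: mulr_ge0.
apply: ler_sum => i _; rewrite nrmZ (wlin_sum a (fr _)).
rewrite [_ * `|h|]mulrC -mulrA; apply: ler_pM; rewrite ?nrm_ge0 ?row_coord_le //.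
rewrite mulr_suml; apply: le_trans (nrm_sum _) _; apply: ler_sum => j _.
by rewrite nrmZ mulrC ler_wpM2l ?nrm_ge0 // row_coord_le.
Qed.

(** The pseudo-inverse of the matrix of [f] is a bounded left inverse. *)
Lemma injective_bound (f : W -> V) : wlin f -> (forall h, f h = 0 -> h = 0) ->
  exists2 C : R, 0 < C & forall h, `|h| <= C * nrm (f h).
Proof.
move=> fl inj; pose A : 'M[R]_(k, 2 + 2) := \matrix_i f (delta_mx 0 i).
have fA h : h *m A = f h.
  by rewrite mulmx_sum_row (wlin_sum h fl); apply: eq_bigr => i _; rewrite rowK.
have rf : row_free A.
  apply/row_freeP; exists (pinvmx A).
  apply/row_matrixP => i; rewrite !rowE mulmxA; apply/eqP; rewrite -subr_eq0; apply/eqP.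
  by apply: inj; rewrite -fA mulmxBl mulmx1 mulmxKpV ?subrr // submxMl.
have [C C0 hC] := @linear_bound R (2 + 2) W (mulmxr (pinvmx A)).
exists C => // h.
have e : h = mulmxr (pinvmx A) (f h) by rewrite /= -fA -mulmxA mulmxVp // mulmx1.
by rewrite {1}e; apply: le_trans (hC _) _; rewrite ler_wpM2l ?(ltW C0) // norm_le_nrm.
Qed.
End InjectiveBound.

(** * The 2-jet of a parametrization in recentred coordinates *)

Section Chart.
Variables (R : realType) (k : nat).
Local Notation V := 'rV[R]_(2 + 2).
Local Notation W := 'rV[R]_k.
Variables (p : V) (F d1 : W -> V) (d2 : W -> W -> V).
Hypotheses (hp : CH2 R p) (d1l : wlin d1) (d1inj : forall a, d1 a = 0 -> a = 0)
  (d2C : forall a b, d2 a b = d2 b a) (d2l : forall a, wlin (d2^~ a))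
  (Ftaylor : forall e : R, 0 < e -> exists2 d : R, 0 < d & forall h, `|h| < d ->
    nrm (F h - p - d1 h - 2^-1 *: d2 h h) <= e * `|h| ^+ 2).

Let di : R[i] := (1 - dot p p)%:C^-1.
Let q u v := cscale (di * herm u p) v.

Definition chart h : V := moeb p (F h).
Definition chart1 a : V := dmoeb p p (d1 a).
(* The terms added to [d2] come from the second derivative of [moeb p] at [p]. *)
Definition chart2 h a : V := dmoeb p p (d2 h a + q (d1 a) (d1 h) + q (d1 h) (d1 a)).

Lemma dmoeb_pp u : dmoeb p p u = cscale di (Lm p u).
Proof. by rewrite dmoebE moeb_pp // cscale0r addr0 hermuu /di rmorphB. Qed.

Let qDl u v w : q (u + v) w = q u w + q v w.
Proof. by rewrite /q hermDl mulrDr cscaleDl. Qed.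
Let qDr u v w : q u (v + w) = q u v + q u w.
Proof. by rewrite /q cscaleDr. Qed.
Let qZl (c : R) u v : q (c *: u) v = c *: q u v.
Proof. by apply: herm_inj => z; rewrite /q !herm_simp; ring. Qed.
Let qZr (c : R) u v : q u (c *: v) = c *: q u v.
Proof. by apply: herm_inj => z; rewrite /q !herm_simp; ring. Qed.

Lemma chart1_lin : wlin chart1.
Proof.
have [hD hZ] := is_lin_dmoeb p p; have [d1D d1Z] := d1l.
by split=> [a b|c a]; rewrite /chart1 ?d1D ?d1Z ?hD ?hZ.
Qed.

Let di0 : di != 0. Proof. by rewrite invr_eq0 mdel_neq0. Qed.

Lemma chart1_inj a : chart1 a = 0 -> a = 0.
Proof.
rewrite /chart1 dmoeb_pp => h; apply: d1inj; apply: (Lm_inj hp).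
by rewrite -[LHS]cscale1 -(mulVf di0) -cscaleA h cscale0r.
Qed.

Lemma chart2C a b : chart2 a b = chart2 b a.
Proof. by rewrite /chart2 d2C addrAC. Qed.

Lemma chart2_lin a : wlin (chart2^~ a).
Proof.
have [hD hZ] := is_lin_dmoeb p p; have [d1D d1Z] := d1l; have [d2D d2Z] := d2l a.
split=> [g h|c h]; rewrite /chart2 ?d1D ?d1Z ?d2D ?d2Z -?hD -?hZ; congr (dmoeb p p).
  rewrite qDl qDr; move: (d2 g a) (d2 h a) (q _ _) (q _ _) (q _ _) (q _ _) => x y u v w z.
  by apply: dot_inj => t; rewrite !dot_simp; ring.
by rewrite qZl qZr -!scalerDr.
Qed.

Let dr : R := 1 - dot p p.
Let dr0 : 0 < dr. Proof. by rewrite subr_gt0. Qed.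
Let cdi : cn di = dr^-1.
Proof. by rewrite /di cnV cnR gtr0_norm. Qed.
Let p1 : nrm p <= 1. Proof. by rewrite ltW // nrm_lt1. Qed.

(** With s = <u, p> and dr = 1 - |p|^2 the map is [Lm p u] / (dr - s). Cutting the geometric series
    of 1 / (dr - s) after two terms leaves exactly s^2 / (dr (dr - s)) times the linear term. *)
Lemma moeb_second_order : exists2 C : R, 0 < C & exists2 d : R, 0 < d & forall u, nrm u < d ->
  nrm (moeb p (p + u) - dmoeb p p (u + q u u)) <= C * nrm u ^+ 3.
Proof.
have [CM CM0 hM] := is_lin_bounded (is_lin_dmoeb p p).
exists (2 * dr^-1 ^+ 2 * CM); first by rewrite !mulr_gt0 ?invr_gt0.
exists (dr / 2); first by rewrite divr_gt0.
move=> u hu; set s := herm u p.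
have cs : cn s <= nrm u.
  by apply: le_trans (cn_herm _ _) _; rewrite ler_piMr ?nrm_ge0.
have den : dr / 2 <= cn (dr%:C - s).
  have := cnD (dr%:C - s) s; rewrite subrK cnR gtr0_norm //; lra.
have dn0 : dr%:C - s != 0 by rewrite -cn_gt0 (lt_le_trans _ den) // divr_gt0.
have drC : dr%:C != 0 :> R[i] by rewrite mdel_neq0.
have e1 : moeb p (p + u) - dmoeb p p (u + q u u) =
    cscale (s ^+ 2 / (dr%:C * (dr%:C - s))) (dmoeb p p u).
  rewrite moebE [p + u - p]addrC addKr hermDl hermuu !dmoeb_pp LmD LmC -/s /di -/dr.
  rewrite (_ : 1 - ((dot p p)%:C + s) = dr%:C - s); last by rewrite /dr rmorphB /= rmorph1; ring.
  move: (Lm p u) => v; apply: herm_inj => w; rewrite !herm_simp; field.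
  by rewrite drC dn0.
rewrite e1 nrm_cscale cnM cnV expr2 !cnM cnR gtr0_norm //.
have h2 : cn s * cn s / (dr * cn (dr%:C - s)) <= nrm u ^+ 2 * (2 * dr^-1 ^+ 2).
  rewrite -[2 * _](_ : (dr * (dr / 2))^-1 = _); last by field; rewrite gt_eqF.
  rewrite expr2; apply: ler_pM; rewrite ?cn_ge0 ?mulr_ge0 ?invr_ge0 ?mulr_ge0 ?cn_ge0 ?(ltW dr0) //.
    by apply: ler_pM; rewrite ?cn_ge0.
  rewrite lef_pV2 ?posrE ?mulr_gt0 ?divr_gt0 ?(lt_le_trans _ den) ?divr_gt0 //.
  by rewrite ler_pM2l.
apply: le_trans (ler_pM _ (nrm_ge0 _) h2 (hM u)) _.
  by rewrite mulr_ge0 ?mulr_ge0 ?cn_ge0 // invr_ge0 mulr_ge0 ?cn_ge0 // ltW.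
by rewrite le_eqVlt; apply/orP; left; apply/eqP; ring.
Qed.

Lemma q_le u v : nrm (q u v) <= dr^-1 * nrm u * nrm v.
Proof.
rewrite nrm_cscale cnM cdi ler_wpM2r ?nrm_ge0 // ler_wpM2l ?invr_ge0 ?(ltW dr0) //.
by apply: le_trans (cn_herm _ _) _; rewrite ler_piMr ?nrm_ge0.
Qed.

Lemma chart_taylor (e : R) : 0 < e -> exists2 d : R, 0 < d & forall h, `|h| < d ->
  nrm (chart h - chart1 h - 2^-1 *: chart2 h h) <= e * `|h| ^+ 2.
Proof.
move=> e0; have [CM CM0 hM] := is_lin_bounded (is_lin_dmoeb p p).
have [C C0 [d' d'0 hC]] := moeb_second_order.
have [b b0 hb] := wlin_bound d1l.
have d2r h : wlin (d2 h).
  by have [d2D d2Z] := d2l h; split=> *; rewrite !(d2C h) ?d2D ?d2Z.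
have [c c0 hc] := bilin_bound d2l d2r.
(* For small [h] the increment [u] of [F] satisfies |u| <= m |h|; [K] then collects the constants of
   the cubic errors. *)
pose m := b + (1 + c).
have m0 : 0 < m by rewrite !addr_gt0.
pose K := C * m ^+ 3 + CM * (dr^-1 * (1 + c) * (m + b)).
have K0 : 0 < K.
  by rewrite addr_gt0 ?mulr_gt0 ?exprn_gt0 ?invr_gt0 // addr_gt0.
have ee : 0 < Num.min 1 (e / (2 * CM)) by rewrite lt_min ltr01 divr_gt0 // mulr_gt0.
have [d d0 hd] := Ftaylor ee.
exists (Num.min d (Num.min 1 (Num.min (d' / m) (e / (2 * K))))).
  by rewrite !lt_min d0 ltr01 !divr_gt0 // mulr_gt0.
move=> h; rewrite !lt_min => /and4P[h1 h2 h3 h4].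
have hn := normr_ge0 h; set n := `|h| in h1 h2 h3 h4 hn *.
have hE := hd h h1; set u := F h - p; set E := F h - p - _ - _ in hE.
have uE : u - d1 h = E + 2^-1 *: d2 h h by rewrite /E subrK.
have hE1 : nrm E <= n ^+ 2.
  apply: le_trans hE _; rewrite -[leRHS]mul1r ler_wpM2r ?sqr_ge0 //.
  by rewrite ge_min lexx.
have hE2 : CM * nrm E <= e / 2 * n ^+ 2.
  rewrite -(@ler_pM2l _ CM) // in hE; apply: le_trans hE _; rewrite mulrA ler_wpM2r ?sqr_ge0 //.
  apply: (@le_trans _ _ (CM * (e / (2 * CM)))); first by rewrite ler_wpM2l ?(ltW CM0) // ge_min lexx orbT.
  by rewrite le_eqVlt; apply/orP; left; apply/eqP; field; rewrite gt_eqF.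
have hr : nrm (u - d1 h) <= (1 + c) * n ^+ 2.
  rewrite uE; apply: le_trans (nrmD _ _) _; rewrite mulrDl mul1r; apply: lerD => //.
  rewrite nrmZ gtr0_norm ?invr_gt0 //; apply: (@le_trans _ _ (1 * nrm (d2 h h))).
    by rewrite ler_wpM2r ?nrm_ge0 // invf_le1 // ler1n.
  by rewrite mul1r expr2 mulrA; exact: hc.
have hu : nrm u <= m * n.
  rewrite -(subrK (d1 h) u) addrC /m [leRHS]mulrDl.
  apply: le_trans (nrmD _ _) _; apply: lerD; first exact: hb.
  apply: le_trans hr _; rewrite ler_wpM2l ?addr_ge0 ?(ltW c0) //.
  by rewrite expr2 ler_piMl // ltW.
have ud : nrm u < d'.
  by apply: le_lt_trans hu _; rewrite mulrC -ltr_pdivlMr.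
have hC' := hC u ud.
have FE : F h = p + u by rewrite /u addrC subrK.
have [hD hZ] := is_lin_dmoeb p p.
(* The error has three sources: the expansion of [moeb p], the expansion of [F], and the replacement
   of [u] by [d1 h] in the quadratic term [q u u]. *)
have key : chart h - chart1 h - 2^-1 *: chart2 h h =
   (moeb p (p + u) - dmoeb p p (u + q u u)) + dmoeb p p E
     + dmoeb p p (q (u - d1 h) u + q (d1 h) (u - d1 h)).
  rewrite /chart /chart1 /chart2 FE -hZ.
  have cE : u + q u u = d1 h + 2^-1 *: (d2 h h + q (d1 h) (d1 h) + q (d1 h) (d1 h)) + E +
      (q (u - d1 h) u + q (d1 h) (u - d1 h)).
    have -> : q (u - d1 h) u = q u u - q (d1 h) u.
      by rewrite qDl -scaleN1r qZl scaleN1r.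
    have -> : q (d1 h) (u - d1 h) = q (d1 h) u - q (d1 h) (d1 h).
      by rewrite qDr -scaleN1r qZr scaleN1r.
    have -> : E = u - d1 h - 2^-1 *: d2 h h by [].
    move: (q u u) (q (d1 h) u) (q (d1 h) (d1 h)) (d1 h) (d2 h h) (u) => x y z v w t.
    by apply: dot_inj => r; rewrite !dot_simp; field.
  rewrite cE !hD; move: (moeb _ _) (dmoeb p p _) (dmoeb p p _) (dmoeb p p _) (dmoeb p p _) (dmoeb p p _).
  by move=> x y z v w t; apply: dot_inj => r; rewrite !dot_simp; ring.
rewrite key; apply: le_trans (nrmD _ _) _; apply: (@le_trans _ _ (K * n * n ^+ 2 + e / 2 * n ^+ 2)).
  apply: le_trans (lerD (nrmD _ _) (lexx _)) _.
  have t1 : nrm (dmoeb p p E) <= e / 2 * n ^+ 2 by exact: le_trans (hM E) hE2.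
  have t2 : nrm (moeb p (p + u) - dmoeb p p (u + q u u)) <= C * m ^+ 3 * n * n ^+ 2.
    apply: le_trans hC' _.
    rewrite [leRHS](_ : _ = C * (m * n) ^+ 3); last by ring.
    by rewrite ler_wpM2l ?(ltW C0) // lerXn2r ?nnegrE ?nrm_ge0 // (le_trans (nrm_ge0 u)).
  have t3 : nrm (dmoeb p p (q (u - d1 h) u + q (d1 h) (u - d1 h))) <=
      CM * (dr^-1 * (1 + c) * (m + b)) * n * n ^+ 2.
    apply: le_trans (hM _) _; rewrite -!mulrA ler_wpM2l ?(ltW CM0) //.
    apply: le_trans (nrmD _ _) _; apply: le_trans (lerD (q_le _ _) (q_le _ _)) _.
    have t4 : nrm (u - d1 h) * nrm u <= (1 + c) * n ^+ 2 * (m * n).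
      by apply: ler_pM; rewrite ?nrm_ge0.
    have t5 : nrm (d1 h) * nrm (u - d1 h) <= b * n * ((1 + c) * n ^+ 2).
      by apply: ler_pM; rewrite ?nrm_ge0 // hb.
    rewrite -!mulrA -mulrDr ler_wpM2l ?invr_ge0 ?(ltW dr0) //.
    apply: le_trans (lerD t4 t5) _; rewrite le_eqVlt; apply/orP; left; apply/eqP; ring.
  apply: le_trans (lerD (lerD t2 t1) t3) _.
  rewrite /K le_eqVlt; apply/orP; left; apply/eqP; ring.
rewrite -mulrDl ler_wpM2r ?sqr_ge0 //.
suff : K * n <= e / 2 by lra.
rewrite mulrC -ler_pdivlMr // (le_trans (ltW h4)) // le_eqVlt; apply/orP; left; apply/eqP; field.
by rewrite gt_eqF.
Qed.
End Chart.

Lemma eps_le (R : realType) (x y M : R) :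
  (forall e : R, 0 < e -> e <= 1 -> x <= y + e * M) -> x <= y.
Proof.
move=> h; rewrite leNgt; apply/negP => yx.
pose e := Num.min 1 ((x - y) / (2 * (1 + `|M|))).
have M0 : 0 < 1 + `|M| by rewrite ltr_pwDl.
have e0 : 0 < e by rewrite lt_min ltr01 divr_gt0 ?subr_gt0 ?mulr_gt0.
have e1 : e <= 1 by rewrite ge_min lexx.
have := h e e0 e1.
have : e * M <= (x - y) / 2.
  apply: (@le_trans _ _ (e * (1 + `|M|))).
    by rewrite ler_wpM2l ?(ltW e0) // (le_trans (ler_norm M)) // lerDr.
  apply: (@le_trans _ _ ((x - y) / (2 * (1 + `|M|)) * (1 + `|M|))).
    by rewrite ler_wpM2r ?(ltW M0) // ge_min lexx orbT.
  by rewrite le_eqVlt; apply/orP; left; apply/eqP; field; rewrite gt_eqF.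
by move: yx; lra.
Qed.

(** * The second order germ of an orbit *)

Section UniGroup.
Variable R : realType.
Local Notation V := 'rV[R]_(2 + 2).
Implicit Types (u v : V) (A B : V -> V).

Lemma uni_comp A B : uni A -> uni B -> uni (A \o B).
Proof.
move=> uA uB; split.
- by split=> [u v|a u] /=; rewrite ?(uniD _ _ uB) ?(uniD _ _ uA) ?(uniZ _ _ uB) ?(uniZ _ _ uA).
- by move=> u v /=; rewrite !uni_dot.
case: uA (uA) => _ _ [cA|cA] uA; case: uB => _ _ [cB|cB].
- by left=> u /=; rewrite cB cA.
- by right=> u /=; rewrite cB (uniN _ uA) cA.
- by right=> u /=; rewrite cB cA.
- by left=> u /=; rewrite cB (uniN _ uA) cA opprK.
Qed.

Lemma uni_inv A : uni A -> exists2 B, uni B & (forall u, B (A u) = u) /\ (forall u, A (B u) = u).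
Proof.
move=> uA; have Al : wlin A by case: uA.
pose M : 'M[R]_(2 + 2) := \matrix_i A (delta_mx 0 i).
have MA u : u *m M = A u.
  by rewrite mulmx_sum_row (wlin_sum u Al); apply: eq_bigr => i _; rewrite rowK.
have Ainj u : A u = 0 -> u = 0.
  by move=> h; apply/eqP; rewrite -nrm_eq0 -(uni_nrm _ uA) h nrm0.
have uM : M \in unitmx.
  rewrite -row_free_unit -kermx_eq0; apply/eqP/row_matrixP => i; rewrite row0.
  by apply: Ainj; rewrite -MA; apply/eqP; rewrite -sub_kermx row_sub.
pose B u := u *m invmx M.
have BA u : B (A u) = u by rewrite /B -MA mulmxK.
have AB u : A (B u) = u by rewrite /B -MA mulmxKV.
exists B => //; split.
- by split=> [u v|a u]; rewrite /B ?mulmxDl ?scalemxAl.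
- by move=> u v; rewrite -(uni_dot _ _ uA) !AB.
case: (uA) => _ _ [cA|cA]; [left|right] => u.
  by rewrite -{1}(AB u) -cA BA.
by rewrite -{1}(AB u) -[mul_i _]opprK -cA -(uniN _ uA) BA.
Qed.
End UniGroup.

Section Germ.
Variables (R : realType) (G : groupType) (alpha : isometric_action (CH2 R) (bergman R) G).
Variables (p : 'rV[R]_(2 + 2)) (hp : CH2 R p).
Local Notation V := 'rV[R]_(2 + 2).
Implicit Types (u v w z eta : V) (A B : V -> V).

(* The closure in the ball of the recentred orbit. *)
Definition inP z := CH2 R z /\ forall e : R, 0 < e -> exists s, nrm (hmap alpha p s 0 - z) <= e.

Lemma inP_orbit s : inP (hmap alpha p s 0).
Proof.
split; first by apply: hmap_ball hp _ _ (ball0 R).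
by move=> e e0; exists s; rewrite subrr nrm0 ltW.
Qed.

Lemma inP_limit A z : limit_isom alpha p A -> inP z -> inP (A z).
Proof.
move=> [uA hA] [hz hP]; split; first exact: uni_ball.
move=> e e0; have e2 : 0 < e / 2 by rewrite divr_gt0.
have [s hs] := hA _ e2; have [t ht] := hP _ e2.
exists (s * t)%g; rewrite (hmapM _ hp _ _ (ball0 R)).
have hb : CH2 R (hmap alpha p t 0) by apply: hmap_ball hp _ _ (ball0 R).
rewrite -(subrK (A (hmap alpha p t 0)) (hmap alpha p s _)) -addrA.
apply: le_trans (nrmD _ _) _; rewrite -(uniB _ _ uA) (uni_nrm _ uA).
by have := hs _ hb; lra.
Qed.

Lemma inP_hmap s z : inP z -> inP (hmap alpha p s z).
Proof.
move=> [hz hP]; split; first exact: hmap_ball.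
move=> e e0.
have [A uA hA] := hmap_form alpha hp s.
have hy : CH2 R (- hmap alpha p s 0) by apply: ballN; apply: hmap_ball hp _ _ (ball0 R).
have [d d0 hd] := hasd_cont (hasd_moeb hy (uni_ball uA hz)) e0.
have d2 : 0 < d / 2 by rewrite divr_gt0.
have [t ht] := hP _ d2.
have hb : CH2 R (hmap alpha p t 0) by apply: hmap_ball hp _ _ (ball0 R).
exists (s * t)%g; rewrite (hmapM _ hp _ _ (ball0 R)) (hA _ hb) (hA _ hz).
have := hd (A (hmap alpha p t 0 - z)).
rewrite (uniB _ _ uA) [A z + _]addrC subrK => h; apply: ltW; apply: h.
rewrite -(uniB _ _ uA) (uni_nrm _ uA); lra.
Qed.

Lemma limit_isom_comp A B : limit_isom alpha p A -> limit_isom alpha p B ->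
  limit_isom alpha p (A \o B).
Proof.
move=> [uA hA] [uB hB]; split; first exact: uni_comp.
move=> e e0; have e2 : 0 < e / 2 by rewrite divr_gt0.
have [s hs] := hA _ e2; have [t ht] := hB _ e2.
exists (s * t)%g => z hz; rewrite hmapM //=.
have hb : CH2 R (hmap alpha p t z) by apply: hmap_ball.
rewrite -(subrK (A (hmap alpha p t z)) (hmap alpha p s _)) -addrA.
apply: le_trans (nrmD _ _) _; rewrite -(uniB _ _ uA) (uni_nrm _ uA).
by have := hs _ hb; have := ht _ hz; lra.
Qed.

Lemma limit_isom_inv A : limit_isom alpha p A -> exists2 B, limit_isom alpha p B &
  (forall u, B (A u) = u) /\ (forall u, A (B u) = u).
Proof.
move=> [uA hA]; have [B uB [BA AB]] := uni_inv uA; exists B => //; split=> // e e0.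
have [s hs] := hA _ e0; exists (s^-1)%g => z hz.
have hb : CH2 R (hmap alpha p s^-1%g z) by apply: hmap_ball.
rewrite -(uni_nrm _ uA) (uniB _ _ uA) AB -nrmN opprB.
by have := hs _ hb; rewrite hmapKV.
Qed.
End Germ.

(** * Tangent space and second fundamental form under limit isometries *)

Section Star.
(* [Phi] parametrizes the recentred orbit near the origin, with 2-jet [B h + Q h h / 2]. *)
Variables (R : realType) (G : groupType) (alpha : isometric_action (CH2 R) (bergman R) G).
Variables (p : 'rV[R]_(2 + 2)) (hp : CH2 R p).
Local Notation V := 'rV[R]_(2 + 2).
Variable k : nat.
Local Notation W := 'rV[R]_k.
Variables (Phi B : W -> V) (Q : W -> W -> V).
Hypotheses (Bl : wlin B) (Binj : forall a, B a = 0 -> a = 0)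
  (QC : forall a b, Q a b = Q b a) (Ql : forall a, wlin (Q^~ a))
  (C1 : exists2 d : R, 0 < d & forall h, `|h| < d -> exists s, Phi h = hmap alpha p s 0)
  (C2 : forall e : R, 0 < e -> exists2 d : R, 0 < d & forall h, `|h| < d ->
     nrm (Phi h - B h - 2^-1 *: Q h h) <= e * `|h| ^+ 2)
  (C3 : forall d : R, 0 < d -> exists2 r : R, 0 < r & forall s, nrm (hmap alpha p s 0) < r ->
     exists2 h, `|h| < d & hmap alpha p s 0 = Phi h).

Let Qr h : wlin (Q h).
Proof. by have [D Z] := Ql h; split=> *; rewrite !(QC h) ?D ?Z. Qed.

Let QBl x y z : Q (x - y) z = Q x z - Q y z.
Proof. by rewrite (Ql z).1 -scaleN1r (Ql z).2 scaleN1r. Qed.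

Let nrm_leB u v : nrm (u - v : V) <= nrm u + nrm v.
Proof. by apply: le_trans (nrmD _ _) _; rewrite nrmN. Qed.

Lemma Q_bound : exists2 C : R, 0 < C & forall h a, nrm (Q h a) <= C * `|h| * `|a|.
Proof. exact: bilin_bound. Qed.

Lemma chart_lower : exists2 c : R, 0 < c & exists2 d : R, 0 < d &
  forall h, `|h| < d -> `|h| <= c * nrm (Phi h).
Proof.
have [c c0 hc] := injective_bound Bl Binj; have [q q0 hq] := Q_bound.
have [d d0 hd] := C2 ltr01.
have q1 : 0 < 2 * c * (1 + q) by rewrite !mulr_gt0 // addr_gt0.
exists (2 * c); first by rewrite mulr_gt0.
exists (Num.min d (2 * c * (1 + q))^-1); first by rewrite lt_min d0 invr_gt0.
move=> h; rewrite lt_min => /andP[h1 h2].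
have := hd h h1; have := hc h; have := hq h h.
move: (Phi h) (B h) (Q h h) => x y z hz hy hx.
have hB : nrm y <= nrm x + (1 + q) * `|h| ^+ 2.
  have e : y = x - (x - y - 2^-1 *: z) - 2^-1 *: z.
    by apply: dot_inj => t; rewrite !dot_simp; ring.
  rewrite {1}e; apply: le_trans (nrm_leB _ _) _; apply: le_trans (lerD (nrm_leB _ _) (lexx _)) _.
  rewrite -addrA lerD2l mulrDl; apply: lerD => //.
  rewrite nrmZ gtr0_norm ?invr_gt0 // expr2 mulrA.
  by move: hz (nrm_ge0 z); lra.
have h3 : c * ((1 + q) * `|h| ^+ 2) <= `|h| / 2.
  rewrite expr2 [leLHS](_ : _ = (`|h| * (2 * c * (1 + q))) * (`|h| / 2)); last by field.
  rewrite ler_piMl ?divr_ge0 //; rewrite -ler_pdivlMr // div1r; exact: ltW.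
have : `|h| <= c * nrm x + c * ((1 + q) * `|h| ^+ 2).
  by apply: le_trans hy _; rewrite -mulrDr ler_wpM2l // ltW.
lra.
Qed.

(** Near the origin the linear part of the 2-jet has no normal component and the rest is quadratic;
    at distance at least r from it the bound is Cauchy-Schwarz, paid for by the summand r^-1 of the
    constant. *)
Lemma star_quad : exists2 K : R, 0 < K & forall s eta, (forall a, dot eta (B a) = 0) ->
  `|dot eta (hmap alpha p s 0)| <= K * nrm eta * nrm (hmap alpha p s 0) ^+ 2.
Proof.
have [c c0 [d d0 hd]] := chart_lower; have [q q0 hq] := Q_bound.
have [d' d'0 hd'] := C2 ltr01.
have dd : 0 < Num.min d d' by rewrite lt_min d0.
have [r r0 hr] := C3 dd.
have K0 : 0 < (1 + q) * c ^+ 2 by rewrite mulr_gt0 ?addr_gt0 // mulr_gt0.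
exists ((1 + q) * c ^+ 2 + r^-1); first by rewrite addr_gt0 // invr_gt0.
move=> s eta heta; have [wr|wr] := ltP (nrm (hmap alpha p s 0)) r.
  have [h hh ->] := hr s wr; move: hh; rewrite lt_min => /andP[h1 h2].
  have := hd' h h2; have := heta h; have := hd h h1; have := hq h h.
  move: (Phi h) (B h) (Q h h) => x y z hz hx hy hx2.
  have e : dot eta x = dot eta (x - y - 2^-1 *: z + 2^-1 *: z).
    by rewrite !dot_simp hy; ring.
  rewrite e; apply: le_trans (dot_le_nrm _ _) _.
  rewrite [_ * nrm eta]mulrC -mulrA ler_wpM2l ?nrm_ge0 //.
  apply: le_trans (nrmD _ _) _.
  have h3 : `|h| ^+ 2 <= c ^+ 2 * nrm x ^+ 2.
    by rewrite -exprMn lerXn2r ?nnegrE // mulr_ge0 ?nrm_ge0 // ltW.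
  have h4 : nrm (2^-1 *: z) <= q * `|h| ^+ 2.
    by rewrite nrmZ gtr0_norm ?invr_gt0 // expr2 mulrA; move: hz (nrm_ge0 z); lra.
  apply: le_trans (lerD hx2 h4) _.
  rewrite -mulrDl [leRHS]mulrDl -mulrA; apply: ler_wpDr.
    by rewrite mulr_ge0 ?invr_ge0 ?sqr_ge0 // ltW.
  by rewrite ler_wpM2l // addr_ge0 // ltW.
apply: le_trans (dot_le_nrm _ _) _.
rewrite [_ * nrm eta]mulrC -mulrA ler_wpM2l ?nrm_ge0 // mulrDl; apply: ler_wpDl.
  by rewrite mulr_ge0 ?sqr_ge0 // ltW.
by rewrite expr2 mulrA ler_peMl ?nrm_ge0 // mulrC ler_pdivlMr // mul1r.
Qed.

Lemma star_closure : exists2 K : R, 0 < K & forall z eta, inP alpha p z ->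
  (forall a, dot eta (B a) = 0) -> `|dot eta z| <= K * nrm eta * nrm z ^+ 2.
Proof.
have [K K0 hK] := star_quad; exists K => // z eta [hz hP] he.
apply: (@eps_le _ _ _ (nrm eta + K * nrm eta * (2 * nrm z + 1))) => e e0 e1.
have [s hs] := hP e e0; have := hK s eta he; move: (hmap alpha p s 0) hs => w hs hw.
have wz : nrm w <= nrm z + e.
  by rewrite -(subrK z w) addrC; apply: le_trans (nrmD _ _) _; rewrite lerD2l.
have h1 : nrm w ^+ 2 <= nrm z ^+ 2 + e * (2 * nrm z + 1).
  apply: (@le_trans _ _ ((nrm z + e) ^+ 2)); first by rewrite lerXn2r ?nnegrE ?nrm_ge0 // addr_ge0 ?nrm_ge0 // ltW.
  rewrite sqrrD -addrA lerD2l mulrDr mulr1; apply: lerD; last by rewrite expr2 ler_piMl // ltW.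
  by rewrite le_eqVlt; apply/orP; left; apply/eqP; ring.
have -> : dot eta z = dot eta w - dot eta (w - z) by rewrite !dot_simp; ring.
apply: le_trans (ler_normB _ _) _.
have h2 := dot_le_nrm eta (w - z).
have h3 : nrm eta * nrm (w - z) <= nrm eta * e by rewrite ler_wpM2l ?nrm_ge0.
have h4 : K * nrm eta * nrm w ^+ 2 <= K * nrm eta * (nrm z ^+ 2 + e * (2 * nrm z + 1)).
  by rewrite ler_wpM2l // mulr_ge0 ?nrm_ge0 // ltW.
have h5 := le_trans hw h4; have h6 := le_trans h2 h3.
apply: le_trans (lerD h5 h6) _; rewrite le_eqVlt; apply/orP; left; apply/eqP; ring.
Qed.

Lemma star_radius : exists2 r0 : R, 0 < r0 < 1 & forall s eta, dot eta eta = 1 ->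
  (forall a, dot eta (B a) = 0) ->
  r0 * dot eta (hmap alpha p s 0) <= dot (hmap alpha p s 0) (hmap alpha p s 0) / 4.
Proof.
have [K K0 hK] := star_quad.
have d0 : 0 < 4 * K + 2 by rewrite addr_gt0 // mulr_gt0.
(* This makes K r0 <= 1/4, as required, and the summand 2 keeps r0 below 1. *)
exists (4 * K + 2)^-1.
  by rewrite invr_gt0 d0 invf_lt1 // ltr_wpDl ?mulr_ge0 ?ltr1n // ltW.
move=> s eta e1 he; have := hK s eta he.
rewrite {1}/nrm e1 sqrtr1 mulr1 sqr_nrm; move: (dot eta _) (dot_ge0 (hmap alpha p s 0)).
move: (dot (hmap _ _ _ _) _) => y x y0 hx.
rewrite mulrC ler_pdivrMr // (le_trans (le_trans (ler_norm _) hx)) //.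
have : 0 <= K * y by rewrite mulr_ge0 // ltW.
lra.
Qed.

Lemma chart_upper a : exists2 b : R, 0 < b & exists2 d : R, 0 < d & forall t : R,
  0 < t -> t < d -> nrm (Phi (t *: a)) <= b * t.
Proof.
have [d d0 hd] := C2 ltr01.
have a1 : 0 < 1 + `|a| by rewrite ltr_pwDl.
exists (1 + nrm (B a) + nrm (Q a a) + `|a| ^+ 2).
  by rewrite -!addrA ltr_pwDl // !addr_ge0 ?nrm_ge0 ?sqr_ge0.
exists (Num.min 1 (d / (1 + `|a|))); first by rewrite lt_min ltr01 divr_gt0.
move=> t t0; rewrite lt_min => /andP[t1]; rewrite ltr_pdivlMr // => td.
have hh : `|t *: a| < d.
  by apply: le_lt_trans td; rewrite normrZ gtr0_norm // ler_pM2l // lerDr.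
have := hd _ hh; rewrite (Ql (t *: a)).2 (Qr a).2 Bl.2 normrZ gtr0_norm //.
move: (Phi _) (B a) (Q a a) => x y z hx.
have e : x = (x - t *: y - 2^-1 *: (t *: (t *: z))) + t *: y + 2^-1 *: (t *: (t *: z)).
  by apply: dot_inj => w; rewrite !dot_simp; ring.
rewrite {1}e; apply: le_trans (nrmD _ _) _; apply: le_trans (lerD (nrmD _ _) (lexx _)) _.
rewrite !nrmZ gtr0_norm // gtr0_norm ?invr_gt0 //.
have tt : t * t <= t by rewrite ler_piMl // ltW.
have h1 : 2^-1 * (t * (t * nrm z)) <= t * nrm z.
  have : t * (t * nrm z) <= t * nrm z by rewrite mulrA ler_wpM2r ?nrm_ge0.
  have : 0 <= t * (t * nrm z) by rewrite !mulr_ge0 ?nrm_ge0 // ltW.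
  lra.
have h2 : 1 * (t * `|a|) ^+ 2 <= t * `|a| ^+ 2.
  by rewrite mul1r exprMn ler_wpM2r ?sqr_ge0 // expr2.
have h3 := le_trans hx h2.
have h4 : t * nrm y <= t * nrm y by [].
apply: le_trans (lerD (lerD h3 h4) h1) _.
by rewrite [leRHS](_ : _ = t * `|a| ^+ 2 + t * nrm y + t * nrm z + t) ?lerDl ?ltW //; ring.
Qed.

(** The point A (Phi (t a)) lies in the closure of the orbit, so its normal component is O(t^2),
    while its linear part is t A (B a); divide by t. *)
Lemma limit_isom_normal A a eta : limit_isom alpha p A -> (forall c, dot eta (B c) = 0) ->
  dot eta (A (B a)) = 0.
Proof.
move=> hA he; have uA := hA.1; have [K K0 hK] := star_closure.
have [b b0 [d d0 hb]] := chart_upper a; have [d1 d10 h1] := C1.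
have [d2 d20 h2] := C2 ltr01.
have a1 : 0 < 1 + `|a| by rewrite ltr_pwDl.
apply: (@le_eps_eq0 _ _ (K * nrm eta * b ^+ 2 + nrm eta * (`|a| ^+ 2 + nrm (Q a a)))) => e e0 e1.
pose t := Num.min e (Num.min (d / 2) (Num.min (d1 / (1 + `|a|)) (d2 / (1 + `|a|)) / 2)).
have m0 : 0 < Num.min (d1 / (1 + `|a|)) (d2 / (1 + `|a|)) by rewrite lt_min !divr_gt0.
have t0 : 0 < t by rewrite !lt_min e0 !divr_gt0 // m0.
have te : t <= e by rewrite ge_min lexx.
have td : t < d.
  apply: (@le_lt_trans _ _ (d / 2)); first by rewrite !ge_min lexx orbT.
  by rewrite ltr_pdivrMr // mulr_natr mulr2n ltrDl.
have tm : t < Num.min (d1 / (1 + `|a|)) (d2 / (1 + `|a|)).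
  apply: (@le_lt_trans _ _ (Num.min (d1 / (1 + `|a|)) (d2 / (1 + `|a|)) / 2)).
    by rewrite !ge_min lexx !orbT.
  by rewrite ltr_pdivrMr // mulr_natr mulr2n ltrDl.
have hn : `|t *: a| <= t * (1 + `|a|) by rewrite normrZ gtr0_norm // ler_pM2l // lerDr.
move: tm; rewrite lt_min !ltr_pdivlMr // => /andP[t1 t2].
have [s hs] := h1 _ (le_lt_trans hn t1).
have hx := h2 _ (le_lt_trans hn t2).
have hy := hb t t0 td.
have hP : inP alpha p (A (Phi (t *: a))) by rewrite hs; apply: inP_limit => //; exact: inP_orbit.
have hs' := hK _ eta hP he; rewrite (uni_nrm _ uA) in hs'.
move: hx; rewrite (Ql (t *: a)).2 (Qr a).2 Bl.2 normrZ gtr0_norm //.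
move: (Phi _) hs' hy (B a) (Q a a) => x hx hy y z hxy.
rewrite -(ler_pM2l t0) -{1}(gtr0_norm t0) -normrM -dotZr -(uniZ _ _ uA).
have e2 : t *: y = x - ((x - t *: y - 2^-1 *: (t *: (t *: z))) + 2^-1 *: (t *: (t *: z))).
  by apply: dot_inj => w; rewrite !dot_simp; ring.
rewrite {1}e2 (uniB _ _ uA) dotBr; apply: le_trans (ler_normB _ _) _.
have h3 : `|dot eta (A x)| <= K * nrm eta * (b ^+ 2 * t ^+ 2).
  apply: le_trans hx _; rewrite -exprMn ler_wpM2l ?mulr_ge0 ?nrm_ge0 ?(ltW K0) //.
  by rewrite lerXn2r ?nnegrE ?nrm_ge0 // mulr_ge0 // ltW.
have h4 : nrm (x - t *: y - 2^-1 *: (t *: (t *: z)) + 2^-1 *: (t *: (t *: z))) <=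
    t ^+ 2 * (`|a| ^+ 2 + nrm z).
  apply: le_trans (nrmD _ _) _; rewrite [leRHS]mulrDr.
  apply: lerD; first by rewrite -exprMn -[leRHS]mul1r.
  rewrite !nrmZ gtr0_norm ?invr_gt0 // gtr0_norm // [t * (t * _)]mulrA -expr2.
  have : 0 <= t ^+ 2 * nrm z by rewrite mulr_ge0 ?sqr_ge0 ?nrm_ge0.
  lra.
have h5 : `|dot eta (A (x - t *: y - 2^-1 *: (t *: (t *: z)) + 2^-1 *: (t *: (t *: z))))| <=
    nrm eta * (t ^+ 2 * (`|a| ^+ 2 + nrm z)).
  by apply: le_trans (dot_le_nrm _ _) _; rewrite (uni_nrm _ uA) ler_wpM2l ?nrm_ge0.
apply: le_trans (lerD h3 h5) _.
rewrite (_ : _ + _ = t * (t * (K * nrm eta * b ^+ 2 + nrm eta * (`|a| ^+ 2 + nrm z)))); last by ring.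
rewrite ler_pM2l // ler_wpM2r // addr_ge0 //.
  by rewrite mulr_ge0 ?sqr_ge0 // mulr_ge0 ?nrm_ge0 // ltW.
by rewrite mulr_ge0 ?addr_ge0 ?sqr_ge0 ?nrm_ge0.
Qed.

(** Equivariance of the second fundamental form under limit isometries. An orbit point Phi h is
    compared with A (Phi (t a)) up to o(t^2): this forces h = t b + O(t^2), and since [eta]
    annihilates the unknown first order part B (h - t b), only the quadratic terms remain. *)
Lemma limit_isom_second A a b eta : limit_isom alpha p A -> A (B a) = B b ->
  (forall c, dot eta (B c) = 0) -> dot eta (A (Q a a)) = dot eta (Q b b).
Proof.
move=> hA hab he; have uA := hA.1.
have [u u0 [du du0 hu]] := chart_upper a; have [d1 d10 h1] := C1.
have [l l0 [dl dl0 hl]] := chart_lower.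
have [c c0 hc] := injective_bound Bl Binj; have [q q0 hq] := Q_bound.
have a1 : 0 < 1 + `|a| by rewrite ltr_pwDl.
pose g := l * (u + 1).
(* The constants serve, in turn, |h| <= g t, |X| <= e m t^2 for the discrepancy [X] of the 2-jets,
   and |h - t b| <= c sg t^2. *)
have g0 : 0 < g by rewrite mulr_gt0 // addr_gt0.
pose m := g ^+ 2 + 1 + `|a| ^+ 2.
have m0 : 0 <= m by rewrite !addr_ge0 ?sqr_ge0.
pose sg := m + q * g ^+ 2 + q * `|a| ^+ 2.
have sg0 : 0 <= sg.
  by rewrite !addr_ge0 // mulr_ge0 ?sqr_ge0 // ltW.
apply/eqP; rewrite eq_sym -subr_eq0; apply/eqP.
apply: (@le_eps_eq0 _ _ (nrm eta * (2 * m + q * (c * sg) * (g + `|b|)))) => e e0 e1.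
have [d2 d20 h2] := C2 e0.
have dd : 0 < Num.min dl d2 by rewrite lt_min dl0.
have [r r0 hr] := C3 dd.
have [t t0 [te td ta tr]] : exists2 t : R, 0 < t &
    [/\ t <= e, t < du, t * (1 + `|a|) < Num.min d1 d2 & t * (u + 1) < r].
  have u1 : 0 < u + 1 by rewrite addr_gt0.
  have md : 0 < Num.min d1 d2 by rewrite lt_min d10.
  pose m' := Num.min du (Num.min (Num.min d1 d2 / (1 + `|a|)) (r / (u + 1))).
  have m'0 : 0 < m' by rewrite !lt_min du0 !divr_gt0.
  have m'2 : m' / 2 < m' by rewrite ltr_pdivrMr // mulr_natr mulr2n ltrDl.
  pose t := Num.min e (m' / 2).
  have t0 : 0 < t by rewrite lt_min e0 divr_gt0.
  have te : t <= e by rewrite ge_min lexx.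
  have : t < m' by rewrite gt_min m'2 orbT.
  move: t t0 te => t t0 te; rewrite /m' lt_min => /andP[k1].
  rewrite lt_min => /andP[k2 k3]; exists t => //.
  by split=> //; rewrite -ltr_pdivlMr.
have hn : `|t *: a| <= t * (1 + `|a|) by rewrite normrZ gtr0_norm // ler_pM2l // lerDr.
have := le_lt_trans hn ta; rewrite lt_min => /andP[ta1 ta2].
have [s1 hs1] := h1 _ ta1; have hx := h2 _ ta2; have hw1 := hu t t0 td.
have t1 : t <= 1 by exact: le_trans te e1.
(* The group element must approximate [A] to an accuracy that is negligible against the second order
   terms. *)
have et : 0 < e * t ^+ 2 by rewrite mulr_gt0 // exprn_gt0.
have [s2 hs2] := hA.2 _ et.
have hb1 : CH2 R (Phi (t *: a)) by rewrite hs1; apply: hmap_ball hp _ _ (ball0 R).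
have hw2 := hs2 _ hb1; rewrite {1}hs1 -(hmapM _ hp _ _ (ball0 R)) in hw2.
have hw2n : nrm (hmap alpha p (s2 * s1)%g 0) <= t * (u + 1).
  rewrite -(subrK (A (Phi (t *: a))) (hmap _ _ _ _)).
  apply: le_trans (nrmD _ _) _; rewrite (uni_nrm _ uA) addrC mulrDr mulr1 [t * u]mulrC.
  apply: lerD => //; apply: le_trans hw2 _.
  by rewrite expr2 mulrA ler_piMl ?(ltW t0) // mulr_ile1 // ltW.
have [h hh hE] := hr _ (le_lt_trans hw2n tr).
move: hh; rewrite lt_min => /andP[hh1 hh2].
have hx2 := h2 _ hh2; have hlh := hl _ hh1.
rewrite -hE in hx2 hlh.
have hg : `|h| <= g * t.
  by apply: le_trans hlh _; rewrite /g -mulrA ler_pM2l // mulrC.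
move: hx; rewrite (Ql (t *: a)).2 (Qr a).2 Bl.2 normrZ gtr0_norm // => hx.
move: (hmap alpha p (s2 * s1)%g 0) (Phi (t *: a)) hw2 hx hx2 {hE hw1 hw2n hs1 hb1 hlh} => w2 w1 hw2 hx hx2.
(* The difference between the 2-jets of Phi h and of A (Phi (t a)). *)
pose X := B (h - t *: b) + 2^-1 *: Q h h - 2^-1 *: (t ^+ 2 *: A (Q a a)).
have BE : B (h - t *: b) = B h - t *: A (B a).
  by rewrite Bl.1 -scaleN1r !Bl.2 scaleN1r hab.
have hX : nrm X <= e * m * t ^+ 2.
  have -> : X = (w2 - A w1) - (w2 - B h - 2^-1 *: Q h h) +
      A (w1 - t *: B a - 2^-1 *: (t *: (t *: Q a a))).
    rewrite /X BE !(uniB _ _ uA) !(uniZ _ _ uA).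
    move: (A w1) (B h) (Q h h) (A (B a)) (A (Q a a)) => v1 v2 v3 v4 v5.
    by apply: dot_inj => w; rewrite !dot_simp; ring.
  apply: le_trans (nrmD _ _) _; rewrite (uni_nrm _ uA).
  apply: le_trans (lerD (nrm_leB _ _) hx) _.
  apply: le_trans (lerD (lerD hw2 hx2) (lexx _)) _.
  have : e * `|h| ^+ 2 <= e * (g * t) ^+ 2.
    by rewrite ler_pM2l // lerXn2r ?nnegrE // mulr_ge0 // ltW.
  rewrite /m; lra.
have hQh : nrm (Q h h) <= q * g ^+ 2 * t ^+ 2.
  apply: le_trans (hq h h) _; rewrite -mulrA -[leRHS]mulrA -exprMn ler_pM2l // -expr2.
  by rewrite lerXn2r ?nnegrE // mulr_ge0 // ltW.
have hD : `|h - t *: b| <= c * sg * t ^+ 2.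
  apply: le_trans (hc _) _; rewrite -mulrA ler_pM2l //.
  have -> : B (h - t *: b) = X - (2^-1 *: Q h h - 2^-1 *: (t ^+ 2 *: A (Q a a))).
    rewrite /X; move: (B _) (Q h h) (A _) => v1 v2 v3.
    by apply: dot_inj => w; rewrite !dot_simp; ring.
  apply: le_trans (nrm_leB _ _) _; apply: le_trans (lerD hX (nrm_leB _ _)) _.
  rewrite !nrmZ (uni_nrm _ uA) gtr0_norm ?invr_gt0 // gtr0_norm ?exprn_gt0 //.
  have h3 := hq a a; have h4 : t ^+ 2 * nrm (Q a a) <= t ^+ 2 * (q * `|a| * `|a|).
    by rewrite ler_pM2l // exprn_gt0.
  have h5 : e * m * t ^+ 2 <= m * t ^+ 2.
    by rewrite -[leRHS]mul1r -!mulrA ler_wpM2r // mulr_ge0 ?sqr_ge0.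
  have := nrm_ge0 (Q h h); have : 0 <= t ^+ 2 * nrm (Q a a) by rewrite mulr_ge0 ?sqr_ge0 ?nrm_ge0.
  rewrite /sg; move: h4 h5 hQh; move: (t ^+ 2 * nrm _) (nrm (Q h h)) (e * m * _) => y1 y2 y3; lra.
have hQ : nrm (Q h h - t ^+ 2 *: Q b b) <= q * (c * sg) * (g + `|b|) * (t * t ^+ 2).
  have -> : Q h h - t ^+ 2 *: Q b b = Q (h - t *: b) h + Q (t *: b) (h - t *: b).
    rewrite QBl (QC (t *: b) (h - t *: b)) QBl (QC h (t *: b)) (Ql h).2 (Ql (t *: b)).2 (Qr b).2.
    move: (Q h h) (Q b h) (Q b b) => v1 v2 v3; by apply: dot_inj => w; rewrite !dot_simp; ring.
  apply: le_trans (nrmD _ _) _; apply: le_trans (lerD (hq _ _) (hq _ _)) _.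
  rewrite normrZ gtr0_norm //.
  have k1 : `|h - t *: b| * `|h| <= c * sg * t ^+ 2 * (g * t) by apply: ler_pM.
  have k2 : t * `|b| * `|h - t *: b| <= t * `|b| * (c * sg * t ^+ 2).
    by rewrite ler_wpM2l // mulr_ge0 // ltW.
  have k3 : q * (`|h - t *: b| * `|h| + t * `|b| * `|h - t *: b|) <=
     q * (c * sg * t ^+ 2 * (g * t) + t * `|b| * (c * sg * t ^+ 2)).
    by rewrite ler_pM2l // lerD.
  apply: (@le_trans _ _ (q * (`|h - t *: b| * `|h| + t * `|b| * `|h - t *: b|))).
    by rewrite le_eqVlt; apply/orP; left; apply/eqP; ring.
  apply: le_trans k3 _; rewrite le_eqVlt; apply/orP; left; apply/eqP; ring.
have t20 : 0 < t ^+ 2 by rewrite exprn_gt0.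
rewrite -(ler_pM2l t20) -{1}(gtr0_norm t20) -normrM -dotBr -dotZr.
have -> : dot eta (t ^+ 2 *: (Q b b - A (Q a a))) = dot eta (2 *: X - (Q h h - t ^+ 2 *: Q b b)).
  rewrite /X; have := he (h - t *: b); move: (B _) (Q h h) (Q b b) (A _) => v1 v2 v3 v4 h3.
  by rewrite !dot_simp h3; field.
apply: le_trans (dot_le_nrm _ _) _.
rewrite [leRHS](_ : _ = nrm eta * (2 * (e * m * t ^+ 2) + q * (c * sg) * (g + `|b|) * (e * t ^+ 2)));
  last by ring.
rewrite ler_wpM2l ?nrm_ge0 //; apply: le_trans (nrm_leB _ _) _.
rewrite nrmZ gtr0_norm //; apply: lerD; first by rewrite ler_pM2l.
apply: le_trans hQ _; rewrite ler_wpM2l //; last by rewrite ler_pM2r.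
by rewrite !mulr_ge0 ?(ltW q0) ?(ltW c0) // addr_ge0 // ltW.
Qed.
End Star.

(** * Normal spaces that are not complex *)

Section Orthogonal.
Variable R : realType.
Local Notation V := 'rV[R]_(2 + 2).
Implicit Types (u v w xi eta : V).

Lemma ortho_exists m (f : 'I_m -> V) : (m < 4)%N ->
  exists2 xi, dot xi xi = 1 & forall i, dot xi (f i) = 0.
Proof.
move=> m4; pose M : 'M[R]_(2 + 2, m) := \matrix_(j, i) f i 0 j.
have dM (x : V) i : dot x (f i) = (x *m M) 0 i.
  by rewrite mxE /dot; apply: eq_bigr => j _; rewrite mxE.
have /rowV0Pn[x hx x0] : kermx M != 0.
  rewrite -mxrank_eq0 mxrank_ker subn_eq0 -ltnNge.
  exact: leq_ltn_trans (rank_leq_col M) m4.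
rewrite -nrm_gt0 in x0; exists ((nrm x)^-1 *: x).
  rewrite dotZl dotZr -sqr_nrm; field; by rewrite gt_eqF.
move=> i; rewrite dotZl dM (_ : x *m M = 0) ?mxE ?mulr0 //.
exact/sub_kermxP.
Qed.

Lemma plane_decomp (B : 'rV[R]_2 -> V) xi xi' u : wlin B -> (forall a, B a = 0 -> a = 0) ->
  (forall a, dot xi (B a) = 0) -> (forall a, dot xi' (B a) = 0) ->
  dot xi xi = 1 -> dot xi' xi' = 1 -> dot xi xi' = 0 ->
  exists a, exists c d : R, u = B a + c *: xi + d *: xi'.
Proof.
move=> Bl Binj h1 h2 n1 n2 n12.
pose M : 'M[R]_(2 + (1 + 1), 2 + 2) := col_mx (\matrix_i B (delta_mx 0 i)) (col_mx xi xi').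
have ME (x : 'rV[R]_(2 + (1 + 1))) : x *m M =
   B (lsubmx x) + lsubmx (rsubmx x) 0 0 *: xi + rsubmx (rsubmx x) 0 0 *: xi'.
  rewrite -{1}[x]hsubmxK mul_row_col -{1}[rsubmx x]hsubmxK mul_row_col addrA.
  congr (_ + _ + _); rewrite mulmx_sum_row.
  - by rewrite (wlin_sum _ Bl); apply: eq_bigr => i _; rewrite rowK.
  - by rewrite big_ord1 row_id.
  - by rewrite big_ord1 row_id.
have inj (x : 'rV[R]_(2 + (1 + 1))) : x *m M = 0 -> x = 0.
  rewrite ME; set c := _ 0 0; set d := _ 0 0 => e.
  have c0 : c = 0.
    have : dot xi (B (lsubmx x) + c *: xi + d *: xi') = 0 by rewrite e dotC dot0l.
    by rewrite !dot_simp h1 n1 n12 => <-; ring.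
  have d0 : d = 0.
    have : dot xi' (B (lsubmx x) + c *: xi + d *: xi') = 0 by rewrite e dotC dot0l.
    by rewrite !dot_simp h2 n2 [dot xi' xi]dotC n12 => <-; ring.
  move: e; rewrite c0 d0 !scale0r !addr0 => /Binj b0.
  rewrite -[x]hsubmxK b0 -[rsubmx x]hsubmxK.
  rewrite [lsubmx (rsubmx x)]mx11_scalar [rsubmx (rsubmx x)]mx11_scalar -/c -/d c0 d0.
  by rewrite !raddf0 !row_mx0.
have uM : M \in unitmx.
  rewrite -row_free_unit -kermx_eq0; apply/eqP/row_matrixP => i; rewrite row0.
  by apply: inj; apply/eqP; rewrite -sub_kermx row_sub.
exists (lsubmx (u *m invmx M)), (lsubmx (rsubmx (u *m invmx M)) 0 0).
exists (rsubmx (rsubmx (u *m invmx M)) 0 0).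
by rewrite -ME mulmxKV.
Qed.

Lemma ortho5 e1 e2 e3 e4 u : dot e1 e1 = 1 -> dot e2 e2 = 1 -> dot e3 e3 = 1 -> dot e4 e4 = 1 ->
  dot e1 e2 = 0 -> dot e1 e3 = 0 -> dot e1 e4 = 0 -> dot e2 e3 = 0 -> dot e2 e4 = 0 ->
  dot e3 e4 = 0 ->
  dot u e1 = 0 -> dot u e2 = 0 -> dot u e3 = 0 -> dot u e4 = 0 -> u = 0.
Proof.
move=> n1 n2 n3 n4 n12 n13 n14 n23 n24 n34 u1 u2 u3 u4.
pose B (a : 'rV[R]_2) := a 0 0 *: e1 + a 0 1 *: e2.
have Bl : wlin B.
  by split=> [a b|c a]; rewrite /B !mxE ?scalerDl ?scalerDr ?scalerA // addrACA.
have B3 a : dot e3 (B a) = 0 by rewrite /B !dot_simp [dot e3 _]dotC n13 [dot e3 _]dotC n23; ring.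
have B4 a : dot e4 (B a) = 0 by rewrite /B !dot_simp [dot e4 _]dotC n14 [dot e4 _]dotC n24; ring.
have Bi a : B a = 0 -> a = 0.
  move=> h; have h1 : dot e1 (B a) = 0 by rewrite h dotC dot0l.
  have h2 : dot e2 (B a) = 0 by rewrite h dotC dot0l.
  move: h1 h2; rewrite /B !dot_simp n1 n2 [dot e2 e1]dotC n12 !mulr1 !mulr0 addr0 add0r => a0 a1.
  apply/rowP => i; rewrite mxE; case: i => [[|[|//]] hi].
    by rewrite -[RHS]a0; congr (a _ _); exact: val_inj.
  by rewrite -[RHS]a1; congr (a _ _); exact: val_inj.
have [a [c [d e]]] := plane_decomp u Bl Bi B3 B4 n3 n4 n34.
apply/eqP; rewrite -dot_eq0; apply/eqP; rewrite {2}e /B !dot_simp u1 u2 u3 u4; ring.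
Qed.
End Orthogonal.

Section Totally.
Variables (R : realType) (G : groupType) (alpha : isometric_action (CH2 R) (bergman R) G).
Variables (p : 'rV[R]_(2 + 2)) (hp : CH2 R p) (dim1 : covering_dim_le (orbit_space alpha) 1).
Local Notation V := 'rV[R]_(2 + 2).
Variable k : nat.
Local Notation W := 'rV[R]_k.
Variables (Phi B : W -> V) (Q : W -> W -> V).
Hypotheses (Bl : wlin B) (Binj : forall a, B a = 0 -> a = 0)
  (QC : forall a b, Q a b = Q b a) (Ql : forall a, wlin (Q^~ a))
  (C1 : exists2 d : R, 0 < d & forall h, `|h| < d -> exists s, Phi h = hmap alpha p s 0)
  (C2 : forall e : R, 0 < e -> exists2 d : R, 0 < d & forall h, `|h| < d ->
     nrm (Phi h - B h - 2^-1 *: Q h h) <= e * `|h| ^+ 2)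
  (C3 : forall d : R, 0 < d -> exists2 r : R, 0 < r & forall s, nrm (hmap alpha p s 0) < r ->
     exists2 h, `|h| < d & hmap alpha p s 0 = Phi h).
Implicit Types (u v w xi eta : V) (A : V -> V).

Definition normal eta := forall a, dot eta (B a) = 0.

Let limit_normal A a eta : limit_isom alpha p A -> normal eta -> dot eta (A (B a)) = 0.
Proof. exact: (limit_isom_normal hp Bl Binj QC Ql C1 C2 C3). Qed.

Lemma normal_limit A eta : limit_isom alpha p A -> normal eta -> normal (A eta).
Proof.
move=> hA he a; have [A' hA' [AK KA]] := limit_isom_inv hp hA.
by rewrite -(KA (B a)) (uni_dot _ _ hA.1); exact: limit_normal.
Qed.

Lemma normal_rotation xi xi' th : normal xi -> normal xi' -> dot xi xi = 1 -> dot xi' xi' = 1 ->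
  dot xi xi' = 0 -> exists2 A, limit_isom alpha p A & A xi = cos th *: xi + sin th *: xi'.
Proof.
move=> h1 h2 n1 n2 n12.
have [r0 /andP[r00 r01] hr] := star_radius Bl Binj QC Ql C2 C3.
apply: (rotation hp dim1 n1 n2 n12 r00 r01) => s b; apply: hr.
  rewrite !dot_simp n1 n2 [dot xi' xi]dotC n12 -[RHS](cos2Dsin2 b); ring.
by move=> a; rewrite !dot_simp h1 h2; ring.
Qed.

Lemma no_line v : v != 0 -> (exists a, v = B a) -> (forall a, exists c : R, B a = c *: v) -> False.
Proof.
move=> v0 [a0 va] hB; rewrite -nrm_gt0 in v0.
pose xi := (nrm v)^-1 *: mul_i v.
have nv : dot v v = nrm v ^+ 2 by rewrite sqr_nrm.
have n0 : nrm v != 0 by rewrite gt_eqF.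
have vJ : dot v (mul_i v) = 0 by exact: dotJJ.
have n1 : dot xi xi = 1 by rewrite /xi !dot_simp dot_mul_i nv; field.
have [xi' n2 hx] := @ortho_exists R 2 (fun i => if i == 0 then v else xi) isT.
have o1 := hx 0; have o2 := hx 1; rewrite /= in o1 o2.
have h1 : normal xi by move=> a; have [c ->] := hB a; rewrite /xi !dot_simp [dot _ v]dotC vJ; ring.
have h2 : normal xi' by move=> a; have [c ->] := hB a; rewrite !dot_simp o1; ring.
have n12 : dot xi xi' = 0 by rewrite dotC.
have [A hA] := normal_rotation (pi / 2) h1 h2 n1 n2 n12.
rewrite cos_pihalf sin_pihalf scale0r add0r scale1r => Ax.
have uA := hA.1.
pose c := dot v (A v) / nrm v ^+ 2.
have Av : A v = c *: v.
  apply/eqP; rewrite -subr_eq0 -dot_eq0; apply/eqP; set w := A v - _.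
  have wv : dot w v = 0 by rewrite /w !dot_simp [dot (A v) v]dotC nv /c; field.
  have wn : normal w by move=> a; have [d ->] := hB a; rewrite dotZr wv mulr0.
  have := limit_normal a0 hA wn; rewrite -va => wA.
  by rewrite {2}/w dotBr dotZr wA wv; ring.
have : dot xi' (A (mul_i v)) = 0.
  case: uA => _ _ [->|->]; rewrite Av mul_iZ ?dotNr dotZr.
    by move: o2; rewrite /xi dotZr => /eqP; rewrite mulf_eq0 invr_eq0 (negbTE n0) => /eqP ->; rewrite mulr0.
  by move: o2; rewrite /xi dotZr => /eqP; rewrite mulf_eq0 invr_eq0 (negbTE n0) => /eqP ->; rewrite mulr0 oppr0.
have -> : mul_i v = nrm v *: xi by rewrite /xi scalerA divff // scale1r.
by rewrite (uniZ _ _ uA) Ax dotZr n2 mulr1; exact/eqP.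
Qed.

Variables (xi xi' : V).
Hypotheses (h1 : normal xi) (h2 : normal xi') (n1 : dot xi xi = 1) (n2 : dot xi' xi' = 1)
  (n12 : dot xi xi' = 0)
  (decomp : forall u, exists a, exists c d : R, u = B a + c *: xi + d *: xi').

Lemma normal_span eta : normal eta -> eta = dot eta xi *: xi + dot eta xi' *: xi'.
Proof.
move=> he; have [a [c [d e]]] := decomp eta.
have b0 : dot (B a) (B a) = 0.
  have := he a; rewrite {1}e !dot_simp h1 h2; lra.
have {}b0 : B a = 0 by apply/eqP; rewrite -dot_eq0 b0.
rewrite b0 add0r in e; rewrite {2 3}e {1}e !dot_simp n1 n2 [dot xi' xi]dotC n12.
by rewrite !mulr1 !mulr0 addr0 add0r.
Qed.

(** [normal_rotation] prescribes only the image of [xi], so it may yield reflections. If the element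
    taking [xi] to [xi'] is a quarter turn, its square is -1. Otherwise it is a reflection, and the
    element taking [xi] to [- xi] is either -1 or a second reflection whose product with the first
    is a quarter turn. *)
Lemma minus_one_on_normal : exists2 A, limit_isom alpha p A & A xi = - xi /\ A xi' = - xi'.
Proof.
have img A : limit_isom alpha p A ->
    [/\ dot (A xi') (A xi) = 0, dot (A xi') xi ^+ 2 + dot (A xi') xi' ^+ 2 = 1 &
       A xi' = dot (A xi') xi *: xi + dot (A xi') xi' *: xi'].
  move=> hA; have e := normal_span (normal_limit hA h2); split=> //.
    by rewrite (uni_dot _ _ hA.1) dotC.
  have : dot (A xi') (A xi') = 1 by rewrite (uni_dot _ _ hA.1).
  by rewrite {1}e !dot_simp ![dot _ (A xi')]dotC !expr2.
have [A1 hA1] := normal_rotation (pi / 2) h1 h2 n1 n2 n12.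
rewrite cos_pihalf sin_pihalf scale0r add0r scale1r => A1x.
have [] := img A1 hA1; rewrite A1x => k1 k2 k3.
rewrite k1 expr0n addr0 in k2; rewrite k1 scale0r addr0 in k3.
have u1 := hA1.1.
have /orP[/eqP a1|/eqP a1] : (dot (A1 xi') xi == 1) || (dot (A1 xi') xi == -1).
  by rewrite -sqrf_eq1; apply/eqP.
  rewrite a1 scale1r in k3.
  have [A2 hA2] := normal_rotation pi h1 h2 n1 n2 n12.
  rewrite cospi sinpi scale0r addr0 scaleN1r => A2x.
  have [] := img A2 hA2; rewrite A2x dotNr => l1 l2 l3.
  have l1' : dot (A2 xi') xi = 0 by lra.
  rewrite l1' expr0n add0r in l2; rewrite l1' scale0r add0r in l3.
  have u2 := hA2.1.
  have /orP[/eqP b1|/eqP b1] : (dot (A2 xi') xi' == 1) || (dot (A2 xi') xi' == -1).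
    by rewrite -sqrf_eq1; apply/eqP.
    rewrite b1 scale1r in l3.
    have hC := limit_isom_comp hp hA1 hA2.
    exists ((A1 \o A2) \o (A1 \o A2)); first exact: limit_isom_comp.
    by split; rewrite /= ?A2x ?l3 ?(uniN _ u1) ?A1x ?k3 ?(uniN _ u2) ?(uniN _ u1) ?l3 ?A2x
      ?(uniN _ u1) ?A1x ?k3.
  by exists A2 => //; split=> //; rewrite l3 b1 scaleN1r.
rewrite a1 scaleN1r in k3; exists (A1 \o A1); first exact: limit_isom_comp.
by split; rewrite /= ?A1x ?k3 ?(uniN _ u1) ?A1x.
Qed.

(* An isotropy element equal to -1 on the normal plane is 1 or -1 on its image under [mul_i],
   which together with it spans everything. *)
Lemma second_vanish_real : dot (mul_i xi) xi' ^+ 2 != 1 ->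
  forall eta a, normal eta -> dot eta (Q a a) = 0.
Proof.
move=> kap eta a he; have [A hA [Ax Ax']] := minus_one_on_normal; have uA := hA.1.
have Aeta : A eta = - eta.
  rewrite (normal_span he) (uniD _ _ uA) !(uniZ _ _ uA) Ax Ax'.
  by rewrite !scalerN opprD.
have [eps [eps1 AJ]] : exists eps : R, eps * eps = 1 /\ forall u, A (mul_i u) = eps *: mul_i (A u).
  case: uA => _ _ [hJ|hJ]; [exists 1|exists (-1)]; split; rewrite ?mulr1 ?mulrNN ?mulr1 // => u.
    by rewrite scale1r.
  by rewrite scaleN1r.
have AB : A (B a) = B (- eps *: a).
  rewrite Bl.2; apply/eqP; rewrite -subr_eq0; apply/eqP; set w := A (B a) - _.
  have wJ z : A z = - z -> normal z -> dot w z = 0 /\ dot w (mul_i z) = 0.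
    move=> Az hz; have h3 := limit_normal a hA hz.
    have h4 := hz a; split; first by rewrite /w !dot_simp dotC h3 dotC h4; ring.
    have h5 : mul_i z = - eps *: A (mul_i z).
      by rewrite AJ Az mul_iN !scalerN !scaleNr opprK scalerA eps1 scale1r.
    have h6 : dot (A (B a)) (mul_i z) = - eps * dot (B a) (mul_i z).
      by rewrite {1}h5 dotZr (uni_dot _ _ uA).
    by rewrite /w !dot_simp h6; ring.
  have [w1 w2] := wJ xi Ax h1; have [w3 w4] := wJ xi' Ax' h2.
  apply/eqP; apply/negPn/negP => w0; rewrite -nrm_gt0 in w0.
  clear wJ; clearbody w; move/eqP: kap; apply.
  pose m := nrm w; have m0 : m != 0 by rewrite gt_eqF.
  have ww : dot w w = m ^+ 2 by rewrite sqr_nrm.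
  have wJw : dot w (mul_i w) = 0 by exact: dotJJ.
  have wx : dot (mul_i w) xi = 0 by rewrite dotJl w2 oppr0.
  have wx' : dot (mul_i w) xi' = 0 by rewrite dotJl w4 oppr0.
  (* If [w] were nonzero, [xi], [xi'] and the normalized [w] and [mul_i w] would form an orthonormal
     basis; [mul_i xi], orthogonal to all of them but [xi'], would then be [xi'] up to sign. *)
  have e := @ortho5 _ xi xi' (m^-1 *: w) (m^-1 *: mul_i w) (mul_i xi - dot (mul_i xi) xi' *: xi').
  have e0 : mul_i xi - dot (mul_i xi) xi' *: xi' = 0.
    have xx : dot (mul_i xi) xi = 0 by rewrite dotC dotJJ.
    apply: e => //; rewrite !dot_simp ?dot_mul_i ?ww ?wJw ?n2 ?[dot xi' xi]dotC ?n12 ?xx.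
    + by field.
    + by field.
    + by rewrite dotC w1 mulr0.
    + by rewrite dotC wx mulr0.
    + by rewrite dotC w3 mulr0.
    + by rewrite dotC wx' mulr0.
    + by rewrite !mulr0.
    + ring.
    + ring.
    + by rewrite [dot _ w]dotC w2 [dot _ w]dotC w3; ring.
    + by rewrite [dot xi' _]dotC wx' [dot xi w]dotC w1; ring.
  have : dot (mul_i xi) (mul_i xi) = 1 by rewrite dot_mul_i.
  move/eqP: e0; rewrite subr_eq0 => /eqP e0.
  by rewrite {1 2}e0 !dot_simp n2 mulr1 expr2.
have := limit_isom_second hp Bl Binj QC Ql C1 C2 C3 hA AB he.
have -> : Q (- eps *: a) (- eps *: a) = Q a a.
  by rewrite (Ql _).2 QC (Ql _).2 scalerA mulrNN eps1 scale1r.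
have -> : dot eta (A (Q a a)) = - dot eta (Q a a).
  by rewrite -[in LHS](opprK eta) -Aeta dotNl (uni_dot _ _ uA).
lra.
Qed.
End Totally.

(** * Complex normal spaces *)

Section Semilinear.
Variable R : realType.
Local Notation V := 'rV[R]_(2 + 2).
Implicit Types (u v w z xi : V) (c d : R[i]) (M N : V -> V).

(** The flag records a conjugation, so that unitary and antiunitary maps are handled together. *)
Definition cj (b : bool) c := if b then conjc c else c.

Lemma cn_cj b c : cn (cj b c) = cn c.
Proof. by case: b; rewrite /= ?cnJ. Qed.

Lemma cjK b c : cj b (cj b c) = c.
Proof. by case: b => //=; rewrite conjcK. Qed.

Lemma cj_neq0 b c : (cj b c != 0) = (c != 0).
Proof. by rewrite -!cn_gt0 cn_cj. Qed.

Definition semilin M := is_lin M /\ exists b, forall c u, M (cscale c u) = cscale (cj b c) (M u).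

Lemma semilin_comp M N : semilin M -> semilin N -> semilin (M \o N).
Proof.
move=> [[MD MZ] [b hM]] [[ND NZ] [b' hN]]; split.
  by split=> *; rewrite /= ?ND ?MD ?NZ ?MZ.
exists (b (+) b') => c u /=; rewrite hN hM.
by case: (b) (b') => -[] //=; rewrite conjcK.
Qed.

Lemma semilin_uni M : uni M -> semilin M.
Proof.
move=> uM; split; first by case: uM.
case: (uM) => _ _ [hJ|hJ]; [exists false|exists true] => -[x y] u;
  by rewrite cscale.unlock /= (uniD _ _ uM) !(uniZ _ _ uM) hJ // ?scalerN ?scaleNr.
Qed.

Lemma dmoebC p z c u : dmoeb p z (cscale c u) = cscale c (dmoeb p z u).
Proof. by apply: herm_inj => w; rewrite !dmoebE LmC !herm_simp; ring. Qed.

Lemma semilin_dmoeb p z : semilin (dmoeb p z).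
Proof. by split; [exact: is_lin_dmoeb | exists false => c u; exact: dmoebC]. Qed.

Definition cdep u w := exists c d, (c != 0) || (d != 0) /\ cscale c u + cscale d w = 0.

Lemma cdep_det u w v xi : cdep u w -> herm u v * herm w xi = herm u xi * herm w v.
Proof.
move=> [c [d [cd e]]].
have h t : c * herm u t + d * herm w t = 0.
  by rewrite -!hermCl -hermDl e herm0l.
have hv := h v; have hx := h xi.
have [c0|c0] := eqVneq c 0.
  rewrite c0 !mul0r !add0r in hv hx cd; rewrite eqxx /= in cd.
  move/eqP: hv; rewrite mulf_eq0 (negbTE cd) => /eqP ->.
  by move/eqP: hx; rewrite mulf_eq0 (negbTE cd) => /eqP ->; rewrite !mulr0.
apply: (mulfI c0); apply/eqP; rewrite -subr_eq0; apply/eqP.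
have -> : c * (herm u v * herm w xi) - c * (herm u xi * herm w v) =
  (c * herm u v + d * herm w v) * herm w xi - (c * herm u xi + d * herm w xi) * herm w v by ring.
by rewrite hv hx !mul0r subrr.
Qed.

Lemma cdep_push M u w : semilin M -> cdep u w -> cdep (M u) (M w).
Proof.
move=> [[MD MZ] [b hM]] [c [d [cd e]]]; exists (cj b c), (cj b d).
rewrite !cj_neq0; split=> //; rewrite -!hM -MD e.
by rewrite -(scale0r (0 : V)) MZ !scale0r.
Qed.

Lemma cdep_pull M u w : semilin M -> (forall x, M x = 0 -> x = 0) -> cdep (M u) (M w) -> cdep u w.
Proof.
move=> [[MD MZ] [b hM]] inj [c [d [cd e]]]; exists (cj b c), (cj b d).
by rewrite !cj_neq0; split=> //; apply: inj; rewrite MD !hM !cjK.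
Qed.

Lemma herm_basis v xi u : herm v v = 1 -> herm xi xi = 1 -> herm v xi = 0 ->
  u = cscale (herm u v) v + cscale (herm u xi) xi.
Proof.
move=> nv nx vx; apply/eqP; rewrite -subr_eq0; apply/eqP; set w := u - _.
have wv : herm w v = 0.
  by rewrite /w !herm_simp nv [herm xi v]hermC vx (_ : conjc 0 = 0) ?rmorph0 //; ring.
have wx : herm w xi = 0 by rewrite /w !herm_simp nx vx; ring.
have re (x y : V) : dot x y = complex.Re (herm x y) by [].
have im (x y : V) : dot x (mul_i y) = complex.Im (herm x y) by [].
apply: (@ortho5 R v (mul_i v) xi (mul_i xi)).
- by rewrite re nv.
- by rewrite dot_mul_i re nv.
- by rewrite re nx.
- by rewrite dot_mul_i re nx.
- exact: dotJJ.
- by rewrite re vx.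
- by rewrite im vx.
- by rewrite dotJl im vx oppr0.
- by rewrite dot_mul_i re vx.
- exact: dotJJ.
- by rewrite re wv.
- by rewrite im wv.
- by rewrite re wx.
- by rewrite im wx.
Qed.

Lemma cdep_perp v xi u w : herm v v = 1 -> herm xi xi = 1 -> herm v xi = 0 ->
  herm u xi = 0 -> herm w xi = 0 -> cdep u w.
Proof.
move=> nv nx vx ux wx; rewrite (herm_basis u nv nx vx) (herm_basis w nv nx vx) ux wx.
rewrite !cscale0l !addr0.
have [u0|u0] := eqVneq (herm u v) 0.
  exists 1, 0; rewrite oner_eq0; split=> //.
  by rewrite u0 !cscale0l cscale0r addr0.
exists (herm w v), (- herm u v); rewrite oppr_eq0 u0 orbT; split=> //.
by rewrite !cscaleA -cscaleDl mulrC mulNr subrr cscale0l.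
Qed.
End Semilinear.

(** * Complex tangent directions *)

Section TangentCone.
Variable R : realType.
Local Notation V := 'rV[R]_(2 + 2).
Implicit Types (u v w z xi : V) (S : V -> Prop) (M : V -> V).

(* The complex tangent directions of [S] at [z]: secants may be rescaled by complex numbers. *)
Definition TanC S z w := forall e : R, 0 < e -> exists z' (lam : R[i]),
  [/\ S z', 0 < cn lam, cn lam < e & nrm (z' - z - cscale lam w) <= e * cn lam].

Lemma TanC_secant z z' w (lam : R[i]) (e : R) : nrm (z' - z - cscale lam w) <= e * cn lam ->
  nrm (z' - z) <= (nrm w + e) * cn lam.
Proof.
move=> h; rewrite -(subrK (cscale lam w) (z' - z)) addrC.
apply: le_trans (nrmD _ _) _; rewrite nrm_cscale mulrDl [_ * nrm w]mulrC; exact: lerD.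
Qed.

(** The chain rule for secants; an antilinear derivative conjugates the scale and so keeps its
    modulus. *)
Lemma TanC_push S S' f z M w : (forall z', S z' -> S' (f z')) -> hasd f z M -> semilin M ->
  TanC S z w -> TanC S' (f z) (M w).
Proof.
move=> hS hf [lM [b hM]] hw e e0.
have [C C0 hC] := is_lin_bounded lM.
have w1 : 0 < nrm w + 1 by rewrite ltr_wpDl ?nrm_ge0.
have ew : 0 < e / (2 * (nrm w + 1)) by rewrite divr_gt0 // mulr_gt0.
have [d d0 hd] := hf.2 _ ew.
pose e1 := Num.min 1 (Num.min e (Num.min (d / (nrm w + 1)) (e / (2 * C)))).
have e10 : 0 < e1 by rewrite !lt_min ltr01 e0 !divr_gt0 // mulr_gt0.
have [z' [lam [Sz lam0 lame hz]]] := hw e1 e10.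
have e1le : [/\ e1 <= 1, e1 <= e, e1 <= d / (nrm w + 1) & e1 <= e / (2 * C)].
  by rewrite /e1 !ge_min !lexx /= !orbT.
have [i1 i2 i3 i4] := e1le.
exists (f z'), (cj b lam); rewrite cn_cj; split=> //.
- exact: hS.
- exact: lt_le_trans lame i2.
have hu := TanC_secant hz.
have hu1 : nrm (z' - z) <= (nrm w + 1) * cn lam.
  by apply: le_trans hu _; rewrite ler_wpM2r ?cn_ge0 // lerD2l.
have ud : nrm (z' - z) < d.
  apply: le_lt_trans hu1 _; rewrite mulrC -ltr_pdivlMr //; exact: lt_le_trans lame i3.
have hF := hd _ ud; rewrite [z + _]addrC subrK in hF.
have hB x y : M (x - y) = M x - M y.
  by rewrite lM.1 -scaleN1r lM.2 scaleN1r.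
have -> : f z' - f z - cscale (cj b lam) (M w) =
    (f z' - f z - M (z' - z)) + M (z' - z - cscale lam w).
  rewrite (hB (z' - z)) hM; move: (f z' - f z) (M (z' - z)) (cscale _ _) => x y t.
  by rewrite addrA subrK.
apply: le_trans (nrmD _ _) _; apply: le_trans (lerD hF (hC _)) _.
have k1 : e / (2 * (nrm w + 1)) * nrm (z' - z) <= e / 2 * cn lam.
  rewrite [leRHS](_ : _ = e / (2 * (nrm w + 1)) * ((nrm w + 1) * cn lam)).
    by rewrite ler_pM2l.
  by field; rewrite gt_eqF.
have k2 : C * nrm (z' - z - cscale lam w) <= e / 2 * cn lam.
  rewrite [leRHS](_ : _ = C * (e / (2 * C) * cn lam)); last by field; rewrite gt_eqF.
  by rewrite ler_pM2l // (le_trans hz) // ler_pM2r.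
apply: le_trans (lerD k1 k2) _; rewrite -mulrDl ler_pM2r //.
by rewrite -mulrDr -mulr2n -[_ *+ 2]mulr_natl; rewrite le_eqVlt; apply/orP; left; apply/eqP; field.
Qed.

(** The component of a point along the complex line of [xi] is quadratic in its distance to 0, hence
    negligible against the scale of the secant. *)
Lemma TanC_sub (P : V -> Prop) xi K w : (forall z, P z -> `|dot xi z| <= K * nrm z ^+ 2) ->
  (forall z, P z -> `|dot (mul_i xi) z| <= K * nrm z ^+ 2) -> TanC P 0 w -> herm w xi = 0.
Proof.
move=> h1 h2 hw; apply/eqP; rewrite -cn_eq0 eq_le cn_ge0 andbT.
have w1 : 0 < nrm w + 1 by rewrite ltr_wpDl ?nrm_ge0.
apply: (@eps_le _ _ _ (nrm xi + 2 * `|K| * (nrm w + 1) ^+ 2)) => e e0 e1.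
have [z [lam [Pz lam0 lame hz]]] := hw e e0.
have hu : nrm z <= (nrm w + 1) * cn lam.
  have := TanC_secant hz; rewrite subr0 => h; apply: le_trans h _.
  by rewrite ler_wpM2r ?cn_ge0 // lerD2l.
rewrite subr0 in hz.
have e2 : lam * herm w xi = herm z xi - herm (z - cscale lam w) xi.
  by rewrite !herm_simp; ring.
have hzx : cn (herm z xi) <= 2 * `|K| * nrm z ^+ 2.
  have -> : herm z xi = (dot xi z)%:C + 'i * (dot (mul_i xi) z)%:C.
    apply/eqP; rewrite eq_complex /= [dot xi z]dotC [dot (mul_i xi) z]dotC.
    by apply/andP; split; apply/eqP; ring.
  apply: le_trans (cnD _ _) _; rewrite cnM !cnR.
  have -> : cn 'i = 1 :> R by rewrite /cn /= expr0n add0r expr1n sqrtr1.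
  have k0 : K * nrm z ^+ 2 <= `|K| * nrm z ^+ 2 by rewrite ler_wpM2r ?sqr_ge0 // ler_norm.
  have := le_trans (h1 z Pz) k0; have := le_trans (h2 z Pz) k0; rewrite mul1r; lra.
rewrite add0r -(ler_pM2l lam0) -cnM e2.
apply: le_trans (le_trans (cnD _ _) (lerD hzx (lexx _))) _; rewrite cnN.
have k1 : cn (herm (z - cscale lam w) xi) <= e * cn lam * nrm xi.
  by apply: le_trans (cn_herm _ _) _; rewrite ler_wpM2r ?nrm_ge0.
have k2 : 2 * `|K| * nrm z ^+ 2 <= 2 * `|K| * ((nrm w + 1) ^+ 2 * (e * cn lam)).
  rewrite ler_wpM2l ?mulr_ge0 //; apply: (@le_trans _ _ (((nrm w + 1) * cn lam) ^+ 2)).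
    by rewrite lerXn2r ?nnegrE ?nrm_ge0 // mulr_ge0 // ltW.
  by rewrite exprMn ler_wpM2l ?sqr_ge0 // expr2 ler_wpM2r ?cn_ge0 // ltW.
apply: le_trans (lerD k2 k1) _; rewrite le_eqVlt; apply/orP; left; apply/eqP; ring.
Qed.
End TangentCone.

Section ActionDerivative.
Variables (R : realType) (G : groupType) (alpha : isometric_action (CH2 R) (bergman R) G).
Variables (p : 'rV[R]_(2 + 2)) (hp : CH2 R p).
Local Notation V := 'rV[R]_(2 + 2).
Implicit Types (u v w z xi : V) (A M : V -> V).

Lemma hasd_hmap s A z : uni A ->
  (forall z', CH2 R z' -> hmap alpha p s z' = moeb (- hmap alpha p s 0) (A z')) ->
  CH2 R z -> hasd (hmap alpha p s) z (dmoeb (- hmap alpha p s 0) (A z) \o A).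
Proof.
move=> uA hA hz.
have hy : CH2 R (- hmap alpha p s 0) by apply: ballN; apply: hmap_ball hp _ _ (ball0 R).
have h := hasd_comp (hasd_lin z (uni_lin uA)) (hasd_moeb hy (uni_ball uA hz)).
split; first exact: h.1.
move=> e e0; have [d d0 hd] := h.2 _ e0; have [d' d'0 hd'] := CH2_open_nrm hz.
exists (Num.min d d'); first by rewrite lt_min d0.
move=> u; rewrite lt_min => /andP[u1 u2].
by rewrite (hA _ (hd' u u2)) (hA _ hz); exact: hd.
Qed.

Lemma dmoeb_inj q z u : CH2 R q -> CH2 R z -> dmoeb q z u = 0 -> u = 0.
Proof.
move=> hq hz h; have hq' := ballN hq; have hm := moeb_ball hq hz.
have c := hasd_comp (hasd_moeb hq hz) (hasd_moeb hq' hm).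
have i : hasd id z id by apply: hasd_lin.
have [d d0 hd] := CH2_open_nrm hz.
have := hasd_eq c i; move=> /(_ _ u) /= e; rewrite -[u]e ?h.
  have [_ hZ] := is_lin_dmoeb (- q) (moeb q z).
  by rewrite -(scale0r (0 : V)) hZ !scale0r.
by exists d => // v hv; rewrite /= moebK //; exact: hd.
Qed.
End ActionDerivative.

(** * Complex linearity of the second fundamental form of a complex curve *)

Section HolomorphicGerm.
Variables (R : realType) (k : nat).
Local Notation V := 'rV[R]_(2 + 2).
Local Notation W := 'rV[R]_k.
Variables (p : V) (d1 : W -> V) (d2 DF : W -> W -> V).
Hypotheses (hp : CH2 R p) (d2Z : forall (c : R) h a, d2 (c *: h) a = c *: d2 h a)
  (DFe : forall e : R, 0 < e -> exists2 d : R, 0 < d & forall h a, `|h| < d ->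
     nrm (DF h a - d1 a - d2 h a) <= e * `|h| * `|a|)
  (DFc : exists2 d : R, 0 < d & forall h a b, `|h| < d -> cdep (DF h a) (DF h b)).

(** Complex dependence of the derivatives in the directions [a] and [b] at all nearby points is the
    vanishing of a determinant in the coordinates [f] (tangent) and [g] (normal). At the base point
    [g] vanishes on the tangent line, so the first order term of this determinant is the claimed
    relation times a nonzero factor. The terms that [chart2] adds to [d2] satisfy the relation by
    themselves. *)
Lemma chart2_complex a b xi h : d1 a != 0 -> chart1 p d1 b = mul_i (chart1 p d1 a) ->
  herm (chart1 p d1 a) xi = 0 ->
  herm (chart2 p d1 d2 h b) xi = 'i * herm (chart2 p d1 d2 h a) xi.
Proof.
move=> a0 hab hxi; pose M := dmoeb p p.
have sM : semilin M := semilin_dmoeb p p; have [[MD MZ] _] := sM.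
have MB x y : M (x - y) = M x - M y by rewrite MD -scaleN1r MZ scaleN1r.
have MC c x : M (cscale c x) = cscale c (M x) := dmoebC p p c x.
have e1 : d1 b = mul_i (d1 a).
  apply/eqP; rewrite -subr_eq0; apply/eqP; apply: (dmoeb_inj hp hp).
  have hab' : M (d1 b) = mul_i (M (d1 a)) by exact: hab.
  by rewrite -/M MB mul_iE MC -mul_iE hab' subrr.
pose f x := herm (M x) (M (d1 a)); pose g x := herm (M x) xi.
have fD x y : f (x + y) = f x + f y by rewrite /f MD hermDl.
have gD x y : g (x + y) = g x + g y by rewrite /g MD hermDl.
have fZ (c : R) x : f (c *: x) = c%:C * f x by rewrite /f MZ hermZl.
have gZ (c : R) x : g (c *: x) = c%:C * g x by rewrite /g MZ hermZl.
have f0 : f (d1 a) != 0.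
  rewrite /f hermuu_eq0; apply: contraNneq a0 => h0.
  by apply/eqP; exact: dmoeb_inj hp hp h0.
have g0 : g (d1 a) = 0 by exact: hxi.
have fJ x : f (mul_i x) = 'i * f x by rewrite /f mul_iE MC hermCl.
have gJ x : g (mul_i x) = 'i * g x by rewrite /g mul_iE MC hermCl.
have gC c x : g (cscale c x) = c * g x by rewrite /g MC hermCl.
suff key : g (d2 h b) = 'i * g (d2 h a).
  rewrite /chart2 -/M -!/(g _) !gD !gC key e1 hermJl gJ; ring.
have [CM CM0 hM] := is_lin_bounded (conj MD MZ).
pose Kf := CM * nrm (M (d1 a)); pose Kg := CM * nrm xi.
have fb x : cn (f x) <= Kf * nrm x.
  apply: le_trans (cn_herm _ _) _; rewrite /Kf mulrAC ler_wpM2r ?nrm_ge0 //; exact: hM.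
have gb x : cn (g x) <= Kg * nrm x.
  apply: le_trans (cn_herm _ _) _; rewrite /Kg mulrAC ler_wpM2r ?nrm_ge0 //; exact: hM.
have Kf0 : 0 <= Kf by rewrite mulr_ge0 ?nrm_ge0 // ltW.
have Kg0 : 0 <= Kg by rewrite mulr_ge0 ?nrm_ge0 // ltW.
apply/eqP; rewrite -subr_eq0; apply/eqP; apply: (mulfI f0); rewrite mulr0.
apply/eqP; rewrite -cn_eq0; apply/eqP.
pose na := nrm (d1 a); pose m := nrm (d2 h a) + nrm (d2 h b) + `|h| * (`|a| + `|b|).
have m0 : 0 <= m by rewrite !addr_ge0 ?nrm_ge0 // mulr_ge0 // addr_ge0.
pose K := 2 * (Kf * na * Kg * m + Kf * m * Kg * m).
apply: (@le_eps_eq0 _ _ K) => e e0 ee1.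
have [d d0 hd] := DFe e0; have [d' d'0 hd'] := DFc.
have h10 : 0 < 1 + `|h| by rewrite ltr_pwDl.
pose t := Num.min e (Num.min d d' / 2 / (1 + `|h|)).
have dm : 0 < Num.min d d' by rewrite lt_min d0.
have t0 : 0 < t by rewrite lt_min e0 !divr_gt0.
have te : t <= e by rewrite ge_min lexx.
have th : `|t *: h| < Num.min d d'.
  rewrite normrZ gtr0_norm //; apply: (@le_lt_trans _ _ (t * (1 + `|h|))).
    by rewrite ler_pM2l // lerDr.
  rewrite -ltr_pdivlMr //; apply: (@le_lt_trans _ _ (Num.min d d' / 2 / (1 + `|h|))).
    by rewrite ge_min lexx orbT.
  by rewrite ltr_pM2r ?invr_gt0 // ltr_pdivrMr // mulr_natr mulr2n ltrDl.
move: th; rewrite lt_min => /andP[th1 th2].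
have hE x : exists2 E, DF (t *: h) x = d1 x + (t *: d2 h x + E) &
    nrm E <= e * (t * (`|h| * `|x|)).
  exists (DF (t *: h) x - d1 x - t *: d2 h x).
    by rewrite addrA -[DF (t *: h) x - _ - _]addrA -opprD [RHS]addrC subrK.
  have := hd (t *: h) x th1; rewrite d2Z normrZ gtr0_norm //.
  by rewrite -!mulrA.
have [Ea hEa nEa] := hE a; have [Eb hEb nEb] := hE b.
have det := cdep_det (M (d1 a)) xi (cdep_push sM (hd' (t *: h) a b th2)).
rewrite -!/(f _) -!/(g _) hEa hEb !fD !gD !fZ !gZ e1 fJ gJ g0 mulr0 in det.
have small (x : W) y : nrm y <= e * (t * (`|h| * `|x|)) -> nrm y <= t * (`|h| * `|x|).
  by move=> hy; apply: le_trans hy _; rewrite ler_piMl // mulr_ge0 ?mulr_ge0 // ltW.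
have sa := small _ _ nEa; have sb := small _ _ nEb.
(* The determinant relation solved for its first order part in [t]; each summand on the right is [t]
   times something small with [e]. *)
have t_id : t%:C * (f (d1 a) * (g (d2 h b) - 'i * g (d2 h a))) =
   'i * f (d1 a) * g Ea - f (d1 a) * g Eb
   + ((t%:C * f (d2 h b) + f Eb) * (t%:C * g (d2 h a) + g Ea)
   - (t%:C * f (d2 h a) + f Ea) * (t%:C * g (d2 h b) + g Eb)).
  apply/eqP; rewrite -subr_eq0; apply/eqP.
  move/eqP: det; rewrite -subr_eq0 => /eqP <-.
  move: (f (d1 a)) (f (d2 h a)) (f (d2 h b)) (g (d2 h a)) (g (d2 h b)) (f Ea) (f Eb) (g Ea) (g Eb).
  by move=> x1 x2 x3 x4 x5 x6 x7 x8 x9; ring.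
rewrite (ger0_norm (cn_ge0 _)) -(ler_pM2l t0) -{1}(gtr0_norm t0) -cnR -cnM t_id.
have haE : `|h| * `|a| <= m.
  by rewrite /m mulrDr addrA [leRHS]addrAC; apply: ler_wpDl => //; rewrite addr_ge0 ?addr_ge0 ?nrm_ge0 // mulr_ge0.
have hbE : `|h| * `|b| <= m.
  by rewrite /m mulrDr addrA; apply: ler_wpDl => //; rewrite addr_ge0 ?addr_ge0 ?nrm_ge0 // mulr_ge0.
have ca : cn (f (d1 a)) <= Kf * na by exact: fb.
have gE (x : W) E : nrm E <= e * (t * (`|h| * `|x|)) -> `|h| * `|x| <= m -> cn (g E) <= Kg * (e * (t * m)).
  move=> h1 h2; apply: le_trans (gb E) _; rewrite ler_wpM2l //; apply: le_trans h1 _.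
  by rewrite ler_pM2l // ler_pM2l.
have big (F : V -> R[i]) KF (x : W) E : 0 <= KF -> (forall y, cn (F y) <= KF * nrm y) ->
    nrm E <= t * (`|h| * `|x|) -> nrm (d2 h x) + `|h| * `|x| <= m ->
    cn (t%:C * F (d2 h x) + F E) <= t * (KF * m).
  move=> k0 hF h1 h2; apply: le_trans (cnD _ _) _; rewrite cnM cnR gtr0_norm //.
  apply: (@le_trans _ _ (t * (KF * nrm (d2 h x)) + KF * (t * (`|h| * `|x|)))).
    apply: lerD; first by rewrite ler_pM2l.
    by apply: le_trans (hF E) _; rewrite ler_wpM2l.
  rewrite (_ : _ + _ = t * (KF * (nrm (d2 h x) + `|h| * `|x|))); last by ring.
  by rewrite ler_pM2l // ler_wpM2l.
have ma : nrm (d2 h a) + `|h| * `|a| <= m.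
  have -> : m = nrm (d2 h a) + `|h| * `|a| + (nrm (d2 h b) + `|h| * `|b|) by rewrite /m; ring.
  by rewrite lerDl addr_ge0 ?nrm_ge0 // mulr_ge0.
have mb : nrm (d2 h b) + `|h| * `|b| <= m.
  have -> : m = nrm (d2 h b) + `|h| * `|b| + (nrm (d2 h a) + `|h| * `|a|) by rewrite /m; ring.
  by rewrite lerDl addr_ge0 ?nrm_ge0 // mulr_ge0.
have b1 := big f Kf _ _ Kf0 fb sb mb; have b2 := big g Kg _ _ Kg0 gb sa ma.
have b3 := big f Kf _ _ Kf0 fb sa ma; have b4 := big g Kg _ _ Kg0 gb sb mb.
have g1 := gE _ _ nEa haE; have g2 := gE _ _ nEb hbE.
have ci : cn 'i = 1 :> R by rewrite /cn /= expr0n add0r expr1n sqrtr1.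
apply: le_trans (cnD _ _) _.
have p1 : cn ('i * f (d1 a) * g Ea - f (d1 a) * g Eb) <= 2 * (Kf * na * (Kg * (e * (t * m)))).
  apply: le_trans (cnD _ _) _; rewrite cnN !cnM ci mul1r mulr_natl mulr2n.
  by apply: lerD; apply: ler_pM; rewrite ?cn_ge0.
have p2 : cn ((t%:C * f (d2 h b) + f Eb) * (t%:C * g (d2 h a) + g Ea)
   - (t%:C * f (d2 h a) + f Ea) * (t%:C * g (d2 h b) + g Eb)) <= 2 * (t * (Kf * m) * (t * (Kg * m))).
  apply: le_trans (cnD _ _) _; rewrite cnN !cnM mulr_natl mulr2n.
  by apply: lerD; apply: ler_pM; rewrite ?cn_ge0.
have p3 : 2 * (t * (Kf * m) * (t * (Kg * m))) <= 2 * (e * (Kf * m) * (t * (Kg * m))).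
  rewrite ler_pM2l //; apply: ler_wpM2r; first by apply: mulr_ge0; [exact: ltW|exact: mulr_ge0].
  by apply: ler_wpM2r => //; exact: mulr_ge0.
apply: le_trans (lerD p1 (le_trans p2 p3)) _.
by rewrite /K le_eqVlt; apply/orP; left; apply/eqP; ring.
Qed.
End HolomorphicGerm.

(* [X] and [Y] are the squared moduli of the two coordinates of [x] in [no_complex_germ]; the
   left-hand side is, up to nonzero factors, the determinant of the two directions at [z]. *)
Lemma rotation_determinant (R : realType) (c X Y : R[i]) :
  let D := 1 - c * X - c ^+ 2 * Y in let d := 1 - X - Y in
  let E := d * (X + 4 * Y) + (X + 2 * Y) ^+ 2 in
  let M := d * ((c - 1) * X + 2 * (c ^+ 2 - 1) * Y) + ((c - 1) * X + (c ^+ 2 - 1) * Y) * (X + 2 * Y) in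
  let N := c * X + 2 * c ^+ 2 * Y in
  (2 * (c - 1) * E - M) * (2 * c ^+ 2 * D + N * (c ^+ 2 - 1)) -
  (2 * (c ^+ 2 - 1) * E - 2 * M) * (c * D + N * (c - 1)) =
  (1 - c) ^+ 3 * c * (X ^+ 2 + 4 * Y) * (1 + c * Y).
Proof. move=> D d E M N; rewrite /N /M /E /d /D; ring. Qed.

Lemma dmoebK (R : realType) (q y w : 'rV[R]_(2 + 2)) : CH2 R q -> CH2 R y ->
  dmoeb (- q) (moeb q y) (dmoeb q y w) = w.
Proof.
move=> hq hy; have hq' := ballN hq; have hm := moeb_ball hq hy.
have c := hasd_comp (hasd_moeb hq hy) (hasd_moeb hq' hm).
have i : hasd id y id by apply: hasd_lin.
have [d d0 hd] := CH2_open_nrm hy.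
apply: (hasd_eq c i); exists d => // u hu; rewrite /= moebK //; exact: hd.
Qed.

Lemma uni_cj (R : realType) (A : 'rV[R]_(2 + 2) -> 'rV[R]_(2 + 2)) : uni A -> exists b,
  (forall c u, A (cscale c u) = cscale (cj b c) (A u)) /\
  (forall u w, herm (A u) (A w) = cj b (herm u w)).
Proof.
move=> uA; case: (uA) => _ hd [hJ|hJ]; [exists false|exists true]; split=> [[x y] u|u w].
- by rewrite cscale.unlock /= (uniD _ _ uA) !(uniZ _ _ uA) hJ.
- by rewrite /herm hd /= -hJ hd.
- by rewrite cscale.unlock /= (uniD _ _ uA) !(uniZ _ _ uA) hJ scalerN scaleNr.
- by rewrite /herm hd /= -[mul_i (A w)]opprK -hJ dotNr hd.
Qed.

(** * Excluding a nonzero complex second fundamental form *)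

Section ComplexPlane.
Variables (R : realType) (G : groupType) (alpha : isometric_action (CH2 R) (bergman R) G).
Variables (p : 'rV[R]_(2 + 2)) (hp : CH2 R p) (dim1 : covering_dim_le (orbit_space alpha) 1).
Local Notation V := 'rV[R]_(2 + 2).
Variable k : nat.
Local Notation W := 'rV[R]_k.
Variables (Phi B : W -> V) (Q : W -> W -> V).
Hypotheses (Bl : wlin B) (Binj : forall a, B a = 0 -> a = 0)
  (QC : forall a b, Q a b = Q b a) (Ql : forall a, wlin (Q^~ a))
  (C1 : exists2 d : R, 0 < d & forall h, `|h| < d -> exists s, Phi h = hmap alpha p s 0)
  (C2 : forall e : R, 0 < e -> exists2 d : R, 0 < d & forall h, `|h| < d ->
     nrm (Phi h - B h - 2^-1 *: Q h h) <= e * `|h| ^+ 2)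
  (C3 : forall d : R, 0 < d -> exists2 r : R, 0 < r & forall s, nrm (hmap alpha p s 0) < r ->
     exists2 h, `|h| < d & hmap alpha p s 0 = Phi h).
Variables (v xi : V).
Hypotheses (nv : herm v v = 1) (nx : herm xi xi = 1) (vx : herm v xi = 0)
  (hx : normal B xi) (hJx : normal B (mul_i xi)) (hT : forall c, exists a, B a = cscale c v)
  (hol : forall a b h, B b = mul_i (B a) -> herm (Q h b) xi = 'i * herm (Q h a) xi).
Implicit Types (u w z eta : V) (A : V -> V) (c d : R[i]).

Let xv : herm xi v = 0. Proof. by rewrite hermC vx rmorph0. Qed.
Let basis u : u = cscale (herm u v) v + cscale (herm u xi) xi.
Proof. exact: herm_basis. Qed.

(** By [hol] and symmetry the normal part of [Q] is complex bilinear on the tangent line. *)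
Lemma second_scaled a1 a c : B a1 = v -> B a = cscale c v ->
  herm (Q a a) xi = c ^+ 2 * herm (Q a1 a1) xi.
Proof.
move=> e1 ea; have [j [jE jE']] : exists j : R[i], j = 'i /\ j = 'i%C by exists 'i.
have [b eb] := hT j.
have eJ : B b = mul_i (B a1) by rewrite eb e1 mul_iE jE'.
pose x := complex.Re c; pose y := complex.Im c.
have ec : c = x%:C + j * y%:C.
  by rewrite jE; apply/eqP; rewrite eq_complex /=; apply/andP; split; apply/eqP; rewrite /x /y; ring.
have ae : a = x *: a1 + y *: b.
  apply/eqP; rewrite -subr_eq0; apply/eqP; apply: Binj.
  rewrite Bl.1 -scaleN1r Bl.2 scaleN1r Bl.1 !Bl.2 e1 eb ea.
  apply: herm_inj => w; rewrite herm0l !herm_simp {1}ec.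
  by move: (herm v w) x%:C y%:C => q s t; ring.
have Qr h : wlin (Q h) by have [D Z] := Ql h; split=> *; rewrite !(QC h) ?D ?Z.
rewrite ae (Ql _).1 !(Ql _).2 !(Qr _).1 !(Qr _).2 (QC b a1).
have hol' h : herm (Q h b) xi = j * herm (Q h a1) xi by rewrite (hol _ eJ) jE.
rewrite !(hermDl, hermZl) !hol' (QC b a1) hol' ec.
move: (herm _ _) => q; apply/eqP; rewrite -subr_eq0; apply/eqP.
by ring.
Qed.

Lemma herm_limit_normal A a : limit_isom alpha p A -> herm (A (B a)) xi = 0.
Proof.
move=> hA; have n := limit_isom_normal hp Bl Binj QC Ql C1 C2 C3 a hA.
apply/eqP; rewrite eq_complex /= (dotC _ xi) (dotC _ (mul_i xi)).
by rewrite (n xi hx) (n (mul_i xi) hJx) !eqxx.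
Qed.

(* The isotropy preserves a form [q] with [q (c v) = c ^ 2 q v], so if it multiplies [v] by [c]
   it multiplies [xi] by [c ^ 2]. *)
Definition rot c u := cscale (c * herm u v) v + cscale (c ^+ 2 * herm u xi) xi.

Hypothesis (a1 : W) (e1 : B a1 = v) (kap : herm (Q a1 a1) xi != 0).

(** [A] multiplies [v] by some [c], and equivariance of the nonzero form gives d = c^2. So [A \o A]
    multiplies [v] by [d] and [xi] by d^2. *)
Lemma rot_of_limit A d : limit_isom alpha p A -> (forall c u, A (cscale c u) = cscale c (A u)) ->
  A xi = cscale d xi -> exists2 A', limit_isom alpha p A' & forall u, A' u = rot d u.
Proof.
move=> hA AC Ax; have uA := hA.1.
have := herm_limit_normal a1 hA; rewrite e1 => Avx.
pose c := herm (A v) v.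
have Av : A v = cscale c v by rewrite {1}[A v]basis Avx cscale0l addr0.
have dc : d = c ^+ 2.
  have [b eb] := hT c; have AB : A (B a1) = B b by rewrite e1 Av eb.
  have e := limit_isom_second hp Bl Binj QC Ql C1 C2 C3 hA AB.
  have : herm (A (Q a1 a1)) xi = herm (Q b b) xi.
    apply/eqP; rewrite eq_complex /= ![dot _ xi]dotC ![dot _ (mul_i xi)]dotC.
    by rewrite (e xi hx) (e (mul_i xi) hJx) !eqxx.
  rewrite (second_scaled e1 eb) {1}[Q a1 a1]basis (uniD _ _ uA) !AC Ax Av.
  rewrite !herm_simp nx vx !mulr0 add0r mulr1 => h.
  by apply: (mulfI kap); rewrite h mulrC.
exists (A \o A); first exact: limit_isom_comp.
move=> u /=; rewrite {1}[u]basis (uniD _ _ uA) !AC Ax Av (uniD _ _ uA) !AC Ax Av /rot.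
by rewrite !cscaleA dc; congr (cscale _ v + cscale _ xi); ring.
Qed.

Definition cis (th : R) : R[i] := cos th +i* sin th.

(** The elements turning [xi] by [th] and by twice [th] may both be antilinear. Then their composite
    is complex linear and, the first angle being conjugated, turns [xi] by 2 th - th = th. *)
Lemma rot_angle th : exists2 c, c = cis th \/ c = cis (th + th) &
  exists2 A, limit_isom alpha p A & forall u, A u = rot c u.
Proof.
have n1 : dot xi xi = 1 by rewrite (_ : dot xi xi = complex.Re (herm xi xi)) // nx.
have n2 : dot (mul_i xi) (mul_i xi) = 1 by rewrite dot_mul_i.
have R1 b : exists2 A, limit_isom alpha p A & A xi = cscale (cis b) xi.
  have [A hA Ax] := normal_rotation hp dim1 Bl Binj QC Ql C2 C3 b hx hJx n1 n2 (dotJJ xi).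
  by exists A => //; rewrite Ax cscale.unlock.
have [A hA Ax] := R1 th; have [A' hA' Ax'] := R1 (th + th).
have [_ [b Ab]] := semilin_uni hA.1; have [_ [b' Ab']] := semilin_uni hA'.1.
case: b Ab => Ab; last by exists (cis th); [left | exact: rot_of_limit hA Ab Ax].
case: b' Ab' => Ab'; last by exists (cis (th + th)); [right | exact: rot_of_limit hA' Ab' Ax'].
exists (cis th); first by left.
apply: (rot_of_limit (limit_isom_comp hp hA' hA)) => [c u /=|/=].
  by rewrite Ab Ab' /= conjcK.
rewrite Ax Ab' Ax' cscaleA; congr (cscale _ xi).
have := cos2Dsin2 th; rewrite /cis cosD sinD; move: (cos th) (sin th) => x y xy.
apply/eqP; rewrite eq_complex /=; apply/andP; split; apply/eqP.
  by rewrite -[RHS]mulr1 -xy; ring.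
by rewrite -[RHS]mulr1 -xy; ring.
Qed.

Lemma cn_cis th : cn (cis th) = 1.
Proof. by rewrite /cn /= cos2Dsin2 sqrtr1. Qed.

Lemma cis_near1 (e : R) : 0 < e -> exists2 th, 0 < th & th + th < pi /\
  forall c, c = cis th \/ c = cis (th + th) -> cn (c - 1) < e.
Proof.
move=> e0.
have e2 : 0 < e ^+ 2 / 2 by rewrite divr_gt0 // exprn_gt0.
have : \forall t \near (0 : R), `|cos 0 - cos t| < e ^+ 2 / 2.
  by have /cvgrPdist_lt := @continuous_cos R 0; exact.
move=> /nbhs_ballP[d /= d0 hd].
pose th := Num.min (d / 4) (pi / 4).
have p0 := pi_gt0 R.
have th0 : 0 < th by rewrite lt_min !divr_gt0.
have thd : th <= d / 4 by rewrite ge_min lexx.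
have thp : th <= pi / 4 by rewrite ge_min lexx orbT.
exists th => //; split; first by lra.
have near t : 0 < t -> t < d -> cn (cis t - 1) < e.
  move=> t0 td; have := hd t; rewrite -ball_normE /= sub0r normrN gtr0_norm // => /(_ td).
  rewrite cos0 => h; rewrite -(@ltr_pXn2r _ 2) ?nnegrE ?cn_ge0 ?(ltW e0) //.
  rewrite /cn sqr_sqrtr ?addr_ge0 ?sqr_ge0 //=.
  have := cos2Dsin2 t; have := ler_norm (1 - cos t); move: (cos t) (sin t) h => x y h1 h2 h3; lra.
move=> c [->|->]; apply: near; lra.
Qed.

(** The substitute for an infinitesimal rotation; c is not 1 because both possible angles lie
    strictly between 0 and pi, where the sine is positive. *)
Lemma rot_near1 (e : R) : 0 < e -> exists2 c, [/\ c != 1, cn c = 1 & cn (c - 1) < e] &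
  exists2 A, limit_isom alpha p A & forall u, A u = rot c u.
Proof.
move=> e0; have [th th0 [thp hc]] := cis_near1 e0.
have [c cE hA] := rot_angle th; exists c => //; split.
- have s0 t : 0 < t -> t < pi -> cis t != 1.
    move=> t0 tp; rewrite eq_complex negb_and; apply/orP; right => /=.
    by rewrite gt_eqF // sin_gt0_pi // t0.
  case: cE => ->; apply: s0; lra.
- by case: cE => ->; exact: cn_cis.
- exact: hc.
Qed.

Lemma herm_expand u w : herm u w = herm u v * conjc (herm w v) + herm u xi * conjc (herm w xi).
Proof. by rewrite {1}[w]basis hermDr !hermCr; congr (_ + _); rewrite mulrC. Qed.

(* The generator of the one-parameter family [rot], up to a factor ['i]. *)
Definition gen u := cscale (herm u v) v + cscale (2 * herm u xi) xi.

Let nxi : nrm xi = 1.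
Proof.
have n1 : dot xi xi = 1 by rewrite (_ : dot xi xi = complex.Re (herm xi xi)) // nx.
by rewrite /nrm n1 sqrtr1.
Qed.

Let nvv : nrm v = 1.
Proof.
have n1 : dot v v = 1 by rewrite (_ : dot v v = complex.Re (herm v v)) // nv.
by rewrite /nrm n1 sqrtr1.
Qed.

Lemma gen_tangent z : inP alpha p z -> TanC (inP alpha p) z (gen z).
Proof.
move=> hz e e0; pose b := herm z xi.
have b1 : 0 < 1 + cn b by rewrite ltr_pwDl ?cn_ge0.
have ee : 0 < Num.min e (e / (1 + cn b)) by rewrite lt_min e0 divr_gt0.
have [c [c1 _ ce] [A hA Ac]] := rot_near1 ee.
move: ce; rewrite lt_min => /andP[ce1 ce2].
exists (A z), (c - 1); split=> //.
- exact: inP_limit.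
- by rewrite cn_gt0 subr_eq0.
(* The error is quadratic in c - 1, because c^2 - 1 - 2 (c - 1) = (c - 1)^2. *)
have -> : A z - z - cscale (c - 1) (gen z) = cscale ((c - 1) ^+ 2 * b) xi.
  apply: herm_inj => w.
  have e2 : herm z w = herm z v * herm v w + b * herm xi w.
    by rewrite {1}[z]basis hermDl !hermCl.
  by rewrite Ac /rot /gen -/b !herm_simp e2; ring.
rewrite nrm_cscale nxi mulr1 cnM expr2 cnM -mulrA mulrC -mulrA mulrC ler_wpM2r ?cn_ge0 //.
move: ce2; rewrite ltr_pdivlMr // => ce2.
by apply: le_trans (ltW ce2); rewrite mulrC ler_wpM2l ?cn_ge0 // lerDr.
Qed.

(** Along Phi (t a1) the coordinate on [v] is t to first order, and the coordinate on [xi] is t^2 /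
    2 times the nonzero number of [kap] to second order. *)
Lemma generic_point : exists s, herm (hmap alpha p s 0) v != 0 /\ herm (hmap alpha p s 0) xi != 0.
Proof.
pose q1 := cn (herm (Q a1 a1) v); pose kp := cn (herm (Q a1 a1) xi); pose n := `|a1| ^+ 2.
have kp0 : 0 < kp by rewrite cn_gt0.
have n1 : 0 < 1 + n by rewrite ltr_pwDl // sqr_ge0.
have a10 : 0 < 1 + `|a1| by rewrite ltr_pwDl.
(* The Taylor remainder is then at most t^2 kp / 4, half of the main term in the [xi] coordinate; t
   < 1 / (q1 + kp + 1) makes the linear term dominate in the [v] coordinate. *)
pose e := kp / (4 * (1 + n)).
have e0 : 0 < e by rewrite divr_gt0 // mulr_gt0.
have [d d0 hd] := C2 e0; have [d' d'0 hd'] := C1.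
have q0 : 0 < q1 + kp + 1 by rewrite ltr_wpDl // addr_ge0 ?cn_ge0.
pose t := Num.min (Num.min d d' / (1 + `|a1|)) (q1 + kp + 1)^-1 / 2.
have m0 : 0 < Num.min (Num.min d d' / (1 + `|a1|)) (q1 + kp + 1)^-1.
  by rewrite lt_min invr_gt0 q0 divr_gt0 // lt_min d0.
have t0 : 0 < t by rewrite divr_gt0.
have : t < Num.min (Num.min d d' / (1 + `|a1|)) (q1 + kp + 1)^-1.
  by rewrite /t ltr_pdivrMr // mulr_natr mulr2n ltrDl.
rewrite lt_min ltr_pdivlMr // => /andP[t1 t2].
have ta : `|t *: a1| <= t * (1 + `|a1|) by rewrite normrZ gtr0_norm // ler_pM2l // lerDr.
have := le_lt_trans ta t1; rewrite lt_min => /andP[td td'].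
have [s hs] := hd' _ td'; exists s; rewrite -hs.
have := hd _ td; rewrite normrZ gtr0_norm // exprMn -/n.
have Qr h : wlin (Q h) by have [D Z] := Ql h; split=> *; rewrite !(QC h) ?D ?Z.
rewrite (Ql _).2 (Qr _).2 Bl.2 e1 {hs}; move: (Phi _) => x; set r := x - _ - _ => hr.
have {}hr : nrm r <= t ^+ 2 * (kp / 4).
  apply: le_trans hr _; rewrite mulrCA ler_wpM2l ?sqr_ge0 //.
  rewrite /e mulrAC ler_pdivrMr ?mulr_gt0 //.
  rewrite [leRHS](_ : _ = kp * (1 + n)); last by field.
  by rewrite ler_pM2l // lerDr.
have t2' : t * (q1 + kp + 1) < 1 by rewrite -ltr_pdivlMr // div1r.
have xE : x = r + t *: v + 2^-1 *: (t *: (t *: Q a1 a1)).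
  by rewrite /r; move: (t *: v) (2^-1 *: _) => y1 y2; rewrite addrAC subrK subrK.
have rv : cn (herm r v) <= t ^+ 2 * (kp / 4).
  by apply: le_trans (cn_herm _ _) _; rewrite nvv mulr1.
have rx : cn (herm r xi) <= t ^+ 2 * (kp / 4).
  by apply: le_trans (cn_herm _ _) _; rewrite nxi mulr1.
clearbody r; have tt : 0 < t * t by rewrite mulr_gt0.
split; apply/eqP; rewrite xE !(hermDl, hermZl).
  rewrite nv mulr1 => h.
  have : t%:C = - (herm r v + 2^-1%:C * (t%:C * (t%:C * herm (Q a1 a1) v))).
    by apply/eqP; rewrite -subr_eq0 opprK -h; apply/eqP; ring.
  move/(congr1 (@cn R)); rewrite cnR gtr0_norm // cnN => h2.
  have := cnD (herm r v) (2^-1%:C * (t%:C * (t%:C * herm (Q a1 a1) v))).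
  rewrite -h2 !cnM !cnR !gtr0_norm ?invr_gt0 // -/q1 => h3.
  have h4 : t * (t * (q1 + kp + 1)) < t by rewrite gtr_pMr.
  have h5 : 0 <= t * (t * q1) by rewrite mulrA mulr_ge0 ?cn_ge0 // ltW.
  have h6 : 0 <= t * (t * kp) by rewrite mulrA mulr_ge0 ?cn_ge0 // ltW.
  move: rv; rewrite expr2; move: (cn (herm r v)) h3 => y h3 h7.
  have h8 : t * (t * (q1 + kp + 1)) = t * (t * q1) + t * (t * kp) + t * t by ring.
  move: h8 h3 h4 h5 h6 h7 tt; have -> : t * t * (kp / 4) = t * (t * kp) / 4 by ring.
  move: (t * (t * q1)) (t * (t * kp)) (t * (t * _)) (t * t) => g1 g2 g3 g4; lra.
rewrite vx mulr0 addr0 => h.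
have : herm r xi = - (2^-1%:C * (t%:C * (t%:C * herm (Q a1 a1) xi))).
  by apply/eqP; rewrite -subr_eq0 opprK h.
move/(congr1 (@cn R)); rewrite cnN !cnM !cnR !gtr0_norm ?invr_gt0 // -/kp => h2.
move: rx; rewrite h2 expr2 => h3.
have h6 : 0 < t * t * kp by rewrite mulr_gt0.
lra.
Qed.

(* At [z = rot c x], the generators of the rotations about the origin and about [x] are both
   tangent to the orbit, so they span at most a complex line. *)
Lemma no_complex_germ : False.
Proof.
have [s] := generic_point; set x := hmap alpha p s 0; set a := herm x v; set b := herm x xi.
move=> [a0 b0].
have hxb : CH2 R x by apply: hmap_ball hp _ _ (ball0 R).
have hNx := ballN hxb.
have Px : inP alpha p x by exact: inP_orbit.
have [K K0 hK] := star_closure Bl Binj QC Ql C2 C3.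
have T0 w : TanC (inP alpha p) 0 w -> herm w xi = 0.
  apply: (@TanC_sub _ _ _ K) => z Pz; first by have := hK z xi Pz hx; rewrite nxi mulr1.
  by have := hK z _ Pz hJx; rewrite nrm_mul_i nxi mulr1.
have [A uA hA] := hmap_form alpha hp s.
have [A2 uA2 hA2] := hmap_form alpha hp s^-1%g.
have y0 : hmap alpha p s^-1%g x = 0 by rewrite /x hmapVK //; exact: ball0.
have hy2 : CH2 R (- hmap alpha p s^-1%g 0) by apply: ballN; apply: hmap_ball hp _ _ (ball0 R).
pose M0 := dmoeb (- hmap alpha p s^-1%g 0) (A2 x) \o A2.
have hM0 : hasd (hmap alpha p s^-1%g) x M0 := hasd_hmap hp uA2 hA2 hxb.
have sM0 : semilin M0 := semilin_comp (semilin_dmoeb _ _) (semilin_uni uA2).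
have iM0 w : M0 w = 0 -> w = 0.
  move=> h; have h2 := dmoeb_inj hy2 (uni_ball uA2 hxb) h.
  by apply/eqP; rewrite -nrm_eq0 -(uni_nrm _ uA2) h2 nrm0.
(* Every tangent direction at [x] is carried by [hmap s^-1] to one at the origin, so all of them lie
   on one complex line. *)
have Tx w : TanC (inP alpha p) x w -> herm (M0 w) xi = 0.
  move=> hw; apply: T0; rewrite -y0; apply: TanC_push hM0 sM0 hw => z Pz; exact: inP_hmap.
have [c [c1 cn1 _] [A' hA' Ac]] := rot_near1 ltr01.
have [B' hB' [BA AB]] := limit_isom_inv hp hA'.
set z := A' x; have Pz : inP alpha p z by exact: inP_limit.
have hz : CH2 R z := Pz.1.
set u := hmap alpha p s^-1%g z; have Pu : inP alpha p u by exact: inP_hmap.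
have hu : CH2 R u := Pu.1.
have su : hmap alpha p s u = z by rewrite /u hmapKV.
have rc y : herm (rot c y) v = c * herm y v /\ herm (rot c y) xi = c ^+ 2 * herm y xi.
  by rewrite /rot !herm_simp nv nx vx xv; split; ring.
have zv : herm z v = c * a by rewrite /z Ac (rc x).1.
have zx : herm z xi = c ^+ 2 * b by rewrite /z Ac (rc x).2.
have gv y : herm (gen y) v = herm y v by rewrite /gen !herm_simp nv xv; ring.
have gx y : herm (gen y) xi = 2 * herm y xi by rewrite /gen !herm_simp nx vx; ring.
have Agen : A' (gen x) = gen z.
  by rewrite Ac /rot gv gx /gen zv zx -/a -/b; congr (_ + cscale _ _); ring.
(* Transported by [hmap s], [gen u] is the direction at [z] of the rotations about [x], and it is
   tangent there like [gen z]. The two are compared at [x], where the tangent directions are known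
   to be dependent, then taken back to [z] by [A'] and recentred by [moeb x]. *)
have dep : cdep (A (gen u)) (dmoeb x z (gen z)).
  have hs : hasd (hmap alpha p s) u (dmoeb (- x) (A u) \o A) := hasd_hmap hp uA hA hu.
  have ss : semilin (dmoeb (- x) (A u) \o A) := semilin_comp (semilin_dmoeb _ _) (semilin_uni uA).
  have t1 := gen_tangent Pu.
  have t2 := TanC_push (fun z' Pz' => inP_hmap hp s Pz') hs ss t1; rewrite su in t2.
  have t3 := TanC_push (fun z' Pz' => inP_limit hp hB' Pz') (hasd_lin z (uni_lin hB'.1))
    (semilin_uni hB'.1) t2.
  rewrite {1}/z BA in t3.
  have cd1 := cdep_perp nv nx vx (Tx _ t3) (Tx _ (gen_tangent Px)).
  have cd2 := cdep_push (semilin_uni hA'.1) (cdep_pull sM0 iM0 cd1).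
  rewrite AB Agen in cd2.
  have := cdep_push (semilin_dmoeb x z) cd2; rewrite /= -{1}su (hA u hu) -/x.
  by have := dmoebK (A (gen u)) hNx (uni_ball uA hu); rewrite opprK => ->.
set m := moeb x z; have mE : A u = m.
  by rewrite /m -su (hA u hu) -/x; have := moebK hNx (uni_ball uA hu); rewrite opprK.
set v' := A v; have [bb [hb hh]] := uni_cj uA.
have Agu : A (gen u) = 2 *: m - cscale (herm m v') v'.
  have -> : gen u = 2 *: u - cscale (herm u v) v.
    rewrite {2}[u]basis /gen; move: (herm u v) (herm u xi) => g1 g2.
    by apply: herm_inj => w; rewrite !herm_simp; ring.
  rewrite (uniB _ _ uA) (uniZ _ _ uA) mE; congr (_ - _).
  by rewrite hb -mE /v' hh.
pose t := Lm x (gen x).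
(* [gen x] is tangent at [x], so after recentring it spans the image [v'] of the tangent line. The
   unknown projection onto [v'] thus becomes the explicit projection onto [t]. *)
have [c2 tE] : exists c2, t = cscale c2 v'.
  pose c0 := herm (M0 (gen x)) v.
  have M0E : M0 (gen x) = cscale c0 v.
    by rewrite {1}[M0 _]basis (Tx _ (gen_tangent Px)) cscale0l addr0.
  have hs0 : hasd (hmap alpha p s) 0 (dmoeb (- x) 0 \o A).
    by have := hasd_hmap hp uA hA (ball0 R); rewrite (uni0 uA).
  have hs0' : hasd (hmap alpha p s) (hmap alpha p s^-1%g x) (dmoeb (- x) 0 \o A) by rewrite y0.
  have hid : hasd id x id by apply: hasd_lin.
  have [d d0 hd] := CH2_open_nrm hxb.
  have e := hasd_eq (hasd_comp hM0 hs0') hid.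
  have {}e : dmoeb (- x) 0 (A (M0 (gen x))) = gen x.
    by apply: e; exists d => // w hw; rewrite /= hmapKV //; exact: hd.
  rewrite M0E hb -/v' in e.
  have e2 := dmoebK (cscale (cj bb c0) v') hNx (ball0 R).
  rewrite e in e2.
  rewrite (moeb_p0 hNx) in e2.
  rewrite opprK in e2.
  rewrite dmoeb_pp in e2.
  exists ((1 - dot x x)%:C * cj bb c0); rewrite -cscaleA -e2 cscaleA mulfV ?cscale1 //.
  exact: mdel_neq0.
have v'1 : herm v' v' = 1.
  rewrite /v' hh nv /cj.
  case: (bb) => //.
  by rewrite conj_simp.
have gx0 : gen x != 0 by apply: contraNneq a0 => h; rewrite /a -gv h herm0l.
have t0 : t != 0 by apply: contraNneq gx0 => h; apply/eqP; exact: (Lm_inj hxb).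
pose E := herm t t; have E0 : E != 0 by rewrite hermuu_eq0.
have c20 : c2 != 0 by apply: contraNneq t0 => h; rewrite tE h cscale0l.
have c2J : conjc c2 != 0 by rewrite -cn_gt0 cnJ cn_gt0.
have EE : E = c2 * conjc c2 by rewrite /E tE hermCl hermCr v'1; ring.
have proj : cscale (herm m v') v' = cscale (herm m t / E) t.
  rewrite EE tE hermCr cscaleA; congr (cscale _ v'); field.
  by rewrite c20 c2J.
pose D := 1 - herm z x; have D0 : D != 0 by exact: den_neq0.
have mL : m = Lm x (cscale D^-1 (z - x)) by rewrite /m moebE LmC.
(* The two directions are the images of [y1] and [y2] under the injective map [Lm x]; the
   coordinates of [y1] and [y2] are explicit in [a], [b] and [c]. *)
pose y1 := cscale (2 / D) (z - x) - cscale (herm m t / E) (gen x).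
pose y2 := cscale D^-1 (gen z + cscale (herm (gen z) x / D) (z - x)).
have dL : cdep (Lm x y1) (Lm x y2).
  have -> : Lm x y1 = A (gen u).
    rewrite Agu proj /y1 /t mL !(LmB, LmC).
    by move: (Lm x z) (Lm x x) (Lm x (gen x)) (herm _ _) => g1 g2 g3 g4; apply: herm_inj => w;
      rewrite !herm_simp; ring.
  have -> // : Lm x y2 = dmoeb x z (gen z).
  rewrite dmoebE -/m -/D mL /y2 !LmC LmD !LmC; congr (cscale _ (_ + _)).
  by rewrite cscaleA.
have sL : semilin (Lm x).
  split; last by exists false => c' w; rewrite LmC.
  by split=> [w1 w2|c' w]; rewrite ?LmD ?LmR.
have dy := cdep_det v xi (cdep_pull sL (Lm_inj hxb) dL).
pose X := a * conjc a; pose Y := b * conjc b.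
have hxx : herm x x = X + Y by rewrite herm_expand.
have hzx : herm z x = c * X + c ^+ 2 * Y by rewrite herm_expand zv zx /X /Y; ring.
have c2c : conjc (2 * b) = 2 * conjc b.
  by rewrite conjM -[2 : R[i]]/(1 + 1) conjD conj1.
have hgzx : herm (gen z) x = c * X + 2 * c ^+ 2 * Y.
  by rewrite herm_expand gv gx zv zx /X /Y -/a -/b; ring.
have hgxx : herm (gen x) x = X + 2 * Y by rewrite herm_expand gv gx -/a -/b /X /Y; ring.
have hxgx : herm x (gen x) = X + 2 * Y by rewrite herm_expand gv gx -/a -/b c2c /X /Y; ring.
have hgxgx : herm (gen x) (gen x) = X + 4 * Y.
  by rewrite herm_expand gv gx -/a -/b c2c /X /Y; ring.
have hzxgx : herm (z - x) (gen x) = (c - 1) * X + 2 * (c ^+ 2 - 1) * Y.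
  by rewrite herm_expand gv gx !hermBl zv zx -/a -/b c2c /X /Y; ring.
have hzxx : herm (z - x) x = (c - 1) * X + (c ^+ 2 - 1) * Y by rewrite hermBl hzx hxx; ring.
have mdx : mdel x = 1 - X - Y.
  by rewrite /mdel rmorphB /= -hermuu hxx rmorph1; ring.
have EX : E = (1 - X - Y) * (X + 4 * Y) + (X + 2 * Y) ^+ 2.
  by rewrite /E /t herm_Lm // mdx hgxgx hgxx hxgx; ring.
have DX : D = 1 - c * X - c ^+ 2 * Y by rewrite /D hzx; ring.
have mt : herm m t = D^-1 * ((1 - X - Y) * ((c - 1) * X + 2 * (c ^+ 2 - 1) * Y) +
    ((c - 1) * X + (c ^+ 2 - 1) * Y) * (X + 2 * Y)).
  by rewrite mL /t LmC hermCl herm_Lm // mdx hzxgx hzxx hxgx.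
have y1v : herm y1 v = D^-1 * a * (2 * (c - 1) - D * herm m t / E).
  by rewrite /y1 hermBl !hermCl hermBl zv gv -/a; field; rewrite D0 E0.
have y1x : herm y1 xi = D^-1 * b * (2 * (c ^+ 2 - 1) - 2 * D * herm m t / E).
  by rewrite /y1 hermBl !hermCl hermBl zx gx -/b; field; rewrite D0 E0.
have y2v : herm y2 v = D^-1 * a * (c + herm (gen z) x / D * (c - 1)).
  by rewrite /y2 hermCl hermDl !hermCl hermBl zv gv zv -/a; field.
have y2x : herm y2 xi = D^-1 * b * (2 * c ^+ 2 + herm (gen z) x / D * (c ^+ 2 - 1)).
  by rewrite /y2 hermCl hermDl !hermCl hermBl zx gx zx -/b; field.
set N := herm (gen z) x in y2v y2x hgzx.
set Mx := (1 - X - Y) * _ + _ in mt.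
have key : a * b * ((2 * (c - 1) * E - Mx) * (2 * c ^+ 2 * D + N * (c ^+ 2 - 1)) -
    (2 * (c ^+ 2 - 1) * E - 2 * Mx) * (c * D + N * (c - 1))) = 0.
  transitivity (D ^+ 3 * E * (herm y1 v * herm y2 xi - herm y1 xi * herm y2 v)).
    rewrite y1v y1x y2v y2x mt; move: (E) (D) (N) (Mx) E0 D0 => E' D' N' M' E0' D0'.
    by field; rewrite D0' E0'.
  by rewrite dy subrr mulr0.
have : (1 - c) ^+ 3 * c * (X ^+ 2 + 4 * Y) * (1 + c * Y) = 0.
  rewrite -rotation_determinant /= -EX -DX -hgzx -/Mx.
  by move/eqP: key; rewrite mulf_eq0 mulf_eq0 (negbTE a0) (negbTE b0) => /eqP.
move/eqP; rewrite mulf_eq0 mulf_eq0 mulf_eq0 expf_eq0 /= subr_eq0 [1 == c]eq_sym (negbTE c1) /=.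
have cc0 : c != 0 by rewrite -cn_gt0 cn1.
have XE : X = (cn a ^+ 2)%:C by rewrite sqr_cn.
have YE : Y = (cn b ^+ 2)%:C by rewrite sqr_cn.
(* Two factors remain: X^2 + 4 Y is positive because [b] is nonzero, and 1 + c Y = 0 would give |b|
   = 1, impossible inside the ball. *)
rewrite (negbTE cc0) /= => /orP[|] /eqP h.
  have e4 : 4 = (4 : R)%:C :> R[i] by rewrite rmorph_nat.
  have hX : X ^+ 2 = ((cn a ^+ 2) ^+ 2)%:C by rewrite XE [RHS]rmorphXn.
  have hY : 4 * Y = (4 * cn b ^+ 2)%:C by rewrite YE [RHS]rmorphM; congr (_ * _); exact: e4.
  have : ((cn a ^+ 2) ^+ 2 + 4 * cn b ^+ 2)%:C = 0 :> R[i] by rewrite -h hX hY [LHS]rmorphD.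
  move/(@complexI R) => h5; have : 0 < cn b ^+ 2 by rewrite exprn_gt0 // cn_gt0.
  move: h5.
  by have := sqr_ge0 (cn a ^+ 2); move=> g1 g2 g3; lra.
have : cn (c * Y) = 1.
  have -> : c * Y = -1 by apply/eqP; rewrite -subr_eq0 opprK addrC h.
  by rewrite cnN -[1]/(1%:C) cnR normr1.
rewrite cnM cn1 mul1r YE cnR ger0_norm ?sqr_ge0 // => h1.
have : cn b < 1.
  by apply: le_lt_trans (cn_herm _ _) _; rewrite nxi mulr1 nrm_lt1.
by rewrite -(@ltr_pXn2r _ 2) ?nnegrE ?cn_ge0 // h1 expr1n ltxx.
Qed.
End ComplexPlane.

(** * Vanishing of the second fundamental form at the origin *)

Section GermVanish.
Variables (R : realType) (G : groupType) (alpha : isometric_action (CH2 R) (bergman R) G).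
Variables (p : 'rV[R]_(2 + 2)) (hp : CH2 R p) (dim1 : covering_dim_le (orbit_space alpha) 1).
Local Notation V := 'rV[R]_(2 + 2).

Lemma plane_vanish (Phi B : 'rV[R]_2 -> V) (Q : 'rV[R]_2 -> 'rV[R]_2 -> V) :
  wlin B -> (forall a, B a = 0 -> a = 0) ->
  (forall a b, Q a b = Q b a) -> (forall a, wlin (Q^~ a)) ->
  (exists2 d : R, 0 < d & forall h, `|h| < d -> exists s, Phi h = hmap alpha p s 0) ->
  (forall e : R, 0 < e -> exists2 d : R, 0 < d & forall h, `|h| < d ->
     nrm (Phi h - B h - 2^-1 *: Q h h) <= e * `|h| ^+ 2) ->
  (forall d : R, 0 < d -> exists2 r : R, 0 < r & forall s, nrm (hmap alpha p s 0) < r ->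
     exists2 h, `|h| < d & hmap alpha p s 0 = Phi h) ->
  (forall xi, herm xi xi = 1 -> normal B xi -> normal B (mul_i xi) ->
     forall a b h, B b = mul_i (B a) -> herm (Q h b) xi = 'i * herm (Q h a) xi) ->
  forall eta a, normal B eta -> dot eta (Q a a) = 0.
Proof.
move=> Bl Binj QC Ql C1 C2 C3 hol eta a he.
pose f (i : 'I_2) := B (delta_mx 0 i).
have nf xi : (forall i, dot xi (f i) = 0) -> normal B xi.
  move=> h b; rewrite (wlin_sum b Bl) big_ord_recl big_ord1 !dot_simp !h; ring.
have [xi n1 hx] := @ortho_exists R 2 f isT; have {}hx := nf xi hx.
have [xi' n2 hx'] := @ortho_exists R 3 (fun i => if unlift ord0 i is Some j then f j else xi) isT.
have n12 : dot xi xi' = 0 by rewrite dotC; have := hx' ord0; rewrite unlift_none.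
have {}hx' : normal B xi'.
  by apply: nf => i; have := hx' (lift ord0 i); rewrite liftK.
have decomp u := plane_decomp u Bl Binj hx hx' n1 n2 n12.
(* For orthonormal normal vectors this square is 1 exactly when the normal plane is a complex
   line. *)
have [kap|kap] := eqVneq (dot (mul_i xi) xi' ^+ 2) 1; last first.
  exact: (second_vanish_real hp dim1 Bl Binj QC Ql C1 C2 C3 hx hx' n1 n2 n12 decomp kap).
pose k := dot (mul_i xi) xi'.
have kk : k * k = 1 by rewrite -expr2.
have Jxi : mul_i xi = k *: xi'.
  apply/eqP; rewrite -subr_eq0 -dot_eq0; apply/eqP.
  by rewrite !dot_simp dot_mul_i n1 n2 [dot xi' _]dotC -/k; lra.
have hJx : normal B (mul_i xi) by move=> b; rewrite Jxi dotZl hx' mulr0.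
have nx : herm xi xi = 1 by rewrite hermuu n1.
have hB b : herm (B b) xi = 0.
  by apply/eqP; rewrite eq_complex /= ![dot (B b) _]dotC hx hJx !eqxx.
pose v0 := f 0.
have v00 : 0 < nrm v0.
  rewrite nrm_gt0; apply/eqP => /Binj /rowP /(_ 0) /eqP; rewrite !mxE !eqxx /= oner_eq0 //.
pose v := (nrm v0)^-1 *: v0.
have v1 : dot v v = 1 by rewrite /v dotZl dotZr -sqr_nrm; field; rewrite gt_eqF.
have nv : herm v v = 1 by rewrite hermuu v1.
have vx : herm v xi = 0 by rewrite /v hermZl hB mulr0.
have hT c : exists a, B a = cscale c v.
  have [b [x [y e]]] := decomp (cscale c v); exists b.
  have h0 : herm (cscale c v) xi = 0 by rewrite hermCl vx mulr0.
  have x0 : x = 0.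
    have : dot (cscale c v) xi = 0 by have := congr1 (@complex.Re R) h0.
    by rewrite e !dot_simp n1 [dot (B b) _]dotC hx [dot xi' xi]dotC n12 => <-; ring.
  have y0 : y = 0.
    have : dot (cscale c v) (mul_i xi) = 0 by have := congr1 (@complex.Im R) h0.
    rewrite Jxi e !dot_simp n2 [dot (B b) _]dotC hx' n12 => h.
    have {}h : k * y = 0 by rewrite -h; ring.
    by rewrite -[y]mul1r -kk -mulrA h mulr0.
  by rewrite e x0 y0 !scale0r !addr0.
have hol' := hol xi nx hx hJx.
have [a1 e1] := hT 1; rewrite cscale1 in e1.
have [kap0|kap0] := eqVneq (herm (Q a1 a1) xi) 0; last first.
  by have := no_complex_germ hp dim1 Bl Binj QC Ql C1 C2 C3 nv nx vx hx hJx hT hol' e1 kap0.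
have ea : B a = cscale (herm (B a) v) v.
  by rewrite {1}(herm_basis (B a) nv nx vx) hB cscale0l addr0.
have h0 := second_scaled Bl Binj QC Ql hT hol' e1 ea; rewrite kap0 mulr0 in h0.
have q1 : dot xi (Q a a) = 0 by have := congr1 (@complex.Re R) h0; rewrite /= dotC.
have q2 : dot xi' (Q a a) = 0.
  have : dot (mul_i xi) (Q a a) = 0 by have := congr1 (@complex.Im R) h0; rewrite /= dotC.
  rewrite Jxi dotZl => h; by rewrite -[LHS]mul1r -kk -mulrA h mulr0.
rewrite (normal_span hx hx' n1 n2 n12 decomp he) !dot_simp q1 q2; ring.
Qed.

Lemma germ_vanish k (Phi B : 'rV[R]_k -> V) (Q : 'rV[R]_k -> 'rV[R]_k -> V) : (k + 2 <= 4)%N ->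
  wlin B -> (forall a, B a = 0 -> a = 0) ->
  (forall a b, Q a b = Q b a) -> (forall a, wlin (Q^~ a)) ->
  (exists2 d : R, 0 < d & forall h, `|h| < d -> exists s, Phi h = hmap alpha p s 0) ->
  (forall e : R, 0 < e -> exists2 d : R, 0 < d & forall h, `|h| < d ->
     nrm (Phi h - B h - 2^-1 *: Q h h) <= e * `|h| ^+ 2) ->
  (forall d : R, 0 < d -> exists2 r : R, 0 < r & forall s, nrm (hmap alpha p s 0) < r ->
     exists2 h, `|h| < d & hmap alpha p s 0 = Phi h) ->
  (forall xi, herm xi xi = 1 -> normal B xi -> normal B (mul_i xi) ->
     forall a b h, B b = mul_i (B a) -> herm (Q h b) xi = 'i * herm (Q h a) xi) ->
  forall eta a, normal B eta -> dot eta (Q a a) = 0.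
Proof.
case: k Phi B Q => [|[|[|k]]] Phi B Q hk Bl Binj QC Ql C1 C2 C3 hol eta a he.
- have -> : a = 0 by apply/rowP => -[].
  by rewrite -(scale0r (0 : 'rV_0)) (Ql _).2 scale0r dotC dot0l.
- exfalso; pose v := B (delta_mx 0 0).
  have v0 : v != 0.
    by apply/eqP => /Binj /rowP /(_ 0) /eqP; rewrite !mxE !eqxx /= oner_eq0.
  apply: (no_line hp dim1 Bl Binj QC Ql C1 C2 C3 v0); first by exists (delta_mx 0 0).
  by move=> b; exists (b 0 0); rewrite (wlin_sum b Bl) big_ord1.
- exact: (plane_vanish Bl Binj QC Ql C1 C2 C3 hol).
- by rewrite addnC in hk.
Qed.
End GermVanish.

(** * The Levi-Civita connection *)

Section Christoffel.
Variable R : realType.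
Local Notation V := 'rV[R]_(2 + 2).
Implicit Types (p u v w y : V).

Lemma derive_line (f : V -> R) p u d : is_derive (0 : R) (1 : R) (fun t : R => f (p + t *: u)) d ->
  'D_u f p = d.
Proof.
move=> [_ <-]; rewrite /derive.
have -> : (fun h : R => h^-1 *: ((f \o shift p) (h *: u) - f p)) =
   (fun h : R => h^-1 *: (((fun t : R => f (p + t *: u)) \o shift 0) (h *: 1) - f (p + 0 *: u))).
  apply/funext => h /=; rewrite scale0r !addr0.
  by rewrite [h%:A]mulr1 [h *: u + p]addrC.
by [].
Qed.

Lemma is_derive_dot_line v p u : is_derive (0 : R) (1 : R) (fun t : R => dot v (p + t *: u)) (dot v u).
Proof.
apply: is_derive_eps => e e0; exists 1 => // t _.
rewrite add0r scale0r addr0 !dot_simp (_ : _ - _ = 0) ?normr0 ?mulr_ge0 ?(ltW e0) //; ring.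
Qed.

Definition bergman1 p u v w : R :=
  4 * ((- 2 * dot p u * dot v w + (dot v u * dot w p + dot v p * dot w u) +
      (dot v (mul_i u) * dot w (mul_i p) + dot v (mul_i p) * dot w (mul_i u))) / (1 - dot p p) ^+ 2 +
    4 * dot p u * ((1 - dot p p) * dot v w + (dot v p * dot w p + dot v (mul_i p) * dot w (mul_i p)))
      / (1 - dot p p) ^+ 3).

Lemma derive_bergman p u v w : CH2 R p ->
  'D_u (fun y => bergman R y v w) p = bergman1 p u v w.
Proof.
move=> hp; have d0 : 0 < 1 - dot p p by rewrite subr_gt0.
apply: derive_line.
have hv := is_derive_dot_line v p u; have hw := is_derive_dot_line w p u.
have hJ x : is_derive (0 : R) (1 : R) (fun t : R => dot x (mul_i (p + t *: u))) (dot x (mul_i u)).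
  have -> : (fun t : R => dot x (mul_i (p + t *: u))) = (fun t => dot x (mul_i p + t *: mul_i u)).
    by apply/funext => t; rewrite mul_iD mul_iZ.
  exact: is_derive_dot_line.
have hq : is_derive (0 : R) (1 : R) (fun t : R => 1 - dot (p + t *: u) (p + t *: u))
    (- (2 * dot p u)).
  have -> : (fun t : R => 1 - dot (p + t *: u) (p + t *: u)) =
      (fun t => (1 - dot p p) - (t * (2 * dot p u) - t * (t * - dot u u))).
    by apply/funext => t; rewrite !dot_simp [dot u p]dotC; ring.
  have h := is_derive_sub (is_derive_cst (1 - dot p p) (0 : R) (1 : R)) (is_derive_sub (is_derive_scl 0 (2 * dot p u))
    (is_derive_mul (is_derive_id (0 : R) (1 : R)) (is_derive_scl 0 (- dot u u)))).
  by apply: (is_derive_eq h); rewrite !mul0r mulr0; ring.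
have e0 : p + 0 *: u = p by rewrite scale0r addr0.
have q0 : 1 - dot (p + 0 *: u) (p + 0 *: u) != 0 by rewrite e0 gt_eqF.
have hi := is_derive_inv hq q0.
have hN := is_derive_sub (is_derive_mul hq (is_derive_cst (dot v w) (0 : R) (1 : R)))
  (is_derive_sub (is_derive_cst 0 (0 : R) (1 : R)) (is_derive_sub (is_derive_mul hv hw)
     (is_derive_sub (is_derive_cst 0 (0 : R) (1 : R)) (is_derive_mul (hJ v) (hJ w))))).
have hB := is_derive_mul (is_derive_cst (4 : R) (0 : R) (1 : R)) (is_derive_mul hN (is_derive_mul hi hi)).
have -> : (fun t : R => bergman R (p + t *: u) v w) = (fun t : R => let z := p + t *: u in
    4 * (((1 - dot z z) * dot v w - (0 - (dot v z * dot w z - (0 - dot v (mul_i z) * dot w (mul_i z)))))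
      * ((1 - dot z z)^-1 * (1 - dot z z)^-1))); last first.
  apply: (is_derive_eq hB); rewrite e0 /bergman1 !mulr0 !add0r /cst.
  by field; rewrite gt_eqF.
apply/funext => t; rewrite /bergman expr2 invfM -!mulrA; congr (4 * (_ * _)); ring.
Qed.

(** The vector representing the Christoffel symbols consists of exactly the terms that [chart2] adds
    to the second derivative; thus recentring turns the covariant derivative into an ordinary second
    derivative. *)
Lemma christoffelE p u v w : CH2 R p ->
  christoffel (bergman R) p u v w =
  bergman R p (cscale ((1 - dot p p)%:C^-1 * herm v p) u + cscale ((1 - dot p p)%:C^-1 * herm u p) v) w.
Proof.
move=> hp; have d0 : 0 < 1 - dot p p by rewrite subr_gt0.
rewrite /christoffel !derive_bergman // /bergman /bergman1.
rewrite -rmorphV ?unitfE ?gt_eqF //=.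
have cE (a : R) x y : cscale (a%:C * herm x p) y = (a * dot x p) *: y + (a * dot x (mul_i p)) *: mul_i y.
  by rewrite cscale.unlock /herm /=; congr (_ *: _ + _ *: _); ring.
rewrite !cE !dot_simp !dotJl !mul_iK !dotNr.
rewrite [dot v u]dotC [dot w u]dotC [dot w v]dotC [dot p u]dotC [dot p v]dotC [dot p w]dotC.
have J x y : dot x (mul_i y) = - dot y (mul_i x) by rewrite -dotJl dotC.
rewrite (J v u) (J w u) (J w v).
by field; rewrite gt_eqF.
Qed.
End Christoffel.

Lemma polarization (R : realType) k (Q : 'rV[R]_k -> 'rV[R]_k -> 'rV[R]_(2 + 2)) eta :
  (forall a b, Q a b = Q b a) -> (forall a, wlin (Q^~ a)) ->
  (forall a, dot eta (Q a a) = 0) -> forall a b, dot eta (Q a b) = 0.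
Proof.
move=> QC Ql h a b; have := h (a + b).
rewrite (Ql (a + b)).1 (QC a) (QC b (a + b)) (Ql a).1 (Ql b).1 (QC b a) !dotDr (h a) (h b).
by move: (dot _ _) => q; lra.
Qed.

(** * From the recentred germ back to the orbit *)

Section OrbitGerm.
Variables (R : realType) (G : groupType) (alpha : isometric_action (CH2 R) (bergman R) G).
Hypothesis dim1 : covering_dim_le (orbit_space alpha) 1.
Local Notation V := 'rV[R]_(2 + 2).
Variables (p0 : CH2 R) (k : nat) (U : set 'rV[R]_k) (F : 'rV[R]_k -> V).
Hypotheses (hk : (k + 2 <= 4)%N) (loc : local_parametrization (orbit_in_chart alpha p0) U F).
Local Notation N := (orbit_in_chart alpha p0).
Variables (x0 : 'rV[R]_k) (Ux : U x0).
Local Notation p := (F x0).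

Let oU : open U. Proof. by case: loc. Qed.
Let F1 x : U x -> differentiable F x. Proof. by case: loc => _ /(_ 1%N)[h _] _ _; exact: h. Qed.
Let F2 a : differentiable ('D_a F) x0.
Proof. by case: loc => _ /(_ 2%N)[_ /(_ a)[h _]] _ _; exact: h. Qed.
Let Finj a : 'D_a F x0 = 0 -> a = 0. Proof. by case: loc => _ _ h _; exact: h. Qed.

Lemma param_orbit x : U x -> N (F x).
Proof.
case: loc => _ _ _ [W [h [_ FU _ _]]] hx.
by have : (F @` U) (F x) by [exists x]; rewrite FU => -[].
Qed.

Lemma orbit_ball z : N z -> CH2 R z.
Proof. by case=> q _ <-; exact: set_valP. Qed.

Let hp : CH2 R p. Proof. by apply: orbit_ball; exact: param_orbit. Qed.

Lemma orbit_gmap z : N z -> exists s, gmap alpha s p = z.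
Proof.
have [q [s _ sq] qp] := param_orbit Ux; case=> q' [t _ tq] <-.
exists (t * s^-1)%g; rewrite (gmap_act _ _ hp); congr set_val.
have -> : inCH hp = q by apply: val_inj; rewrite /= -qp.
by rewrite -sq -tq actM -(actM alpha s^-1%g) mulVg act1.
Qed.

Lemma gmap_orbit s : N (gmap alpha s p).
Proof.
have [q [t _ tq] qp] := param_orbit Ux.
exists (alpha s q); first by exists (s * t)%g => //; rewrite actM tq.
rewrite (gmap_act _ _ hp); congr (set_val (alpha s _)).
by apply: val_inj; rewrite /= -qp.
Qed.

Lemma hmap0 s : hmap alpha p s 0 = moeb p (gmap alpha s p).
Proof. by rewrite /hmap (moeb_p0 (ballN hp)) opprK. Qed.

Let Fh h := F (x0 + h).
Let d1 a := 'D_a F x0.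
Let d2 h a := 'D_h ('D_a F) x0.

Lemma germ_orbit : exists2 d : R, 0 < d & forall h, `|h| < d ->
  exists s, chart p Fh h = hmap alpha p s 0.
Proof.
have [d d0 hd] := open_ball_norm oU Ux; exists d => // h hh.
have [s hs] := orbit_gmap (param_orbit (hd h hh)).
by exists s; rewrite hmap0 hs.
Qed.

(** This is where embeddedness enters: continuity of the inverse parametrization excludes orbit
    points near the origin that belong to other sheets. *)
Lemma orbit_germ (d : R) : 0 < d -> exists2 r : R, 0 < r & forall s, nrm (hmap alpha p s 0) < r ->
  exists2 h, `|h| < d & hmap alpha p s 0 = chart p Fh h.
Proof.
move=> d0; case: (loc) => _ _ _ [W [f [oW FU fc fF]]].
have pNW : (N `&` W) p by rewrite -FU; exists x0.
have fp := (subspace_continuousP _ _).1 fc p pNW.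
have : \forall y \near within (N `&` W) (nbhs p), `|f p - f y| < d.
  by move/cvgrPdist_lt: fp; exact.
rewrite near_withinE => /nbhs_ballP[r1 /= r10 hr1].
have /nbhs_ballP[r2 /= r20 hr2] : nbhs p W by apply: open_nbhs_nbhs; split=> //; case: pNW.
have r0 : 0 < Num.min r1 r2 by rewrite lt_min r10.
have [d' d'0 hd'] := hasd_cont (hasd_moeb (ballN hp) (ball0 R)) r0.
exists d' => // s hs; have hy := gmap_orbit s.
have yb := orbit_ball hy.
have := hd' _ hs; rewrite add0r (moeb_p0 (ballN hp)) opprK hmap0 (moebK hp yb) => hn.
have := le_lt_trans (norm_le_nrm _) hn; rewrite -normrN opprB lt_min => /andP[n1 n2].
have yW : W (gmap alpha s p) by apply: hr2; rewrite -ball_normE.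
have : (F @` U) (gmap alpha s p) by rewrite FU.
case=> x hx xE; exists (x - x0).
  have := hr1 (gmap alpha s p); rewrite -ball_normE /= => /(_ n1 (conj hy yW)).
  by rewrite -xE !fF // -normrN opprB.
by rewrite /chart /Fh [x0 + _]addrC subrK xE.
Qed.

Let Bl : wlin d1.
Proof. by split=> [a b|c a]; [exact: (deriveD_dir F1) | exact: (deriveZ_dir F1)]. Qed.

Let d2C a b : d2 a b = d2 b a. Proof. exact: (Q_sym oU Ux F1 F2). Qed.

Let d2l a : wlin (d2^~ a).
Proof. by split=> [h h'|c h]; [exact: (QDl F2) | exact: (QZl F2)]. Qed.

Let tay (e : R) : 0 < e -> exists2 d : R, 0 < d & forall h, `|h| < d ->
  nrm (Fh h - p - d1 h - 2^-1 *: d2 h h) <= e * `|h| ^+ 2.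
Proof. exact: (taylor2 oU Ux F1 F2). Qed.

Let B := chart1 p d1.
Let Q := chart2 p d1 d2.

Let Bl' : wlin B. Proof. exact: chart1_lin. Qed.
Let Binj a : B a = 0 -> a = 0. Proof. exact: (chart1_inj hp Finj). Qed.
Let QC a b : Q a b = Q b a. Proof. exact: chart2C. Qed.
Let Ql a : wlin (Q^~ a). Proof. exact: chart2_lin. Qed.
Let C2 (e : R) : 0 < e -> exists2 d : R, 0 < d & forall h, `|h| < d ->
  nrm (chart p Fh h - B h - 2^-1 *: Q h h) <= e * `|h| ^+ 2.
Proof. exact: (chart_taylor hp Bl d2C d2l tay). Qed.

Lemma param_tangent x b : U x -> TanC N (F x) ('D_b F x).
Proof.
move=> hx e e0; have [d1' d10 hd1] := open_ball_norm oU hx.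
have b1 : 0 < 1 + `|b| by rewrite ltr_pwDl.
have ee : 0 < e / (2 * (1 + `|b|)) by rewrite divr_gt0 // mulr_gt0.
have [d d0 hd] := differentiable_eps (F1 hx) ee.
pose t := Num.min e (Num.min d d1' / (1 + `|b|)) / 2.
have m0 : 0 < Num.min e (Num.min d d1' / (1 + `|b|)).
  by rewrite lt_min e0 divr_gt0 // lt_min d0.
have t0 : 0 < t by rewrite divr_gt0.
have : t < Num.min e (Num.min d d1' / (1 + `|b|)).
  by rewrite /t ltr_pdivrMr // mulr_natr mulr2n ltrDl.
rewrite lt_min ltr_pdivlMr // => /andP[te tm].
have hn : `|t *: b| <= t * (1 + `|b|) by rewrite normrZ gtr0_norm // ler_pM2l // lerDr.
have := le_lt_trans hn tm; rewrite lt_min => /andP[td td1].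
exists (F (x + t *: b)), t%:C; rewrite cnR gtr0_norm //; split=> //.
  by apply: param_orbit; exact: hd1.
rewrite cscaleR (deriveE b (F1 hx)); have := hd _ td; rewrite linearZ /= => h.
apply: le_trans (nrm_le_norm _) _.
apply: le_trans (ler_wpM2l _ h) _ => //.
apply: (@le_trans _ _ (2 * (e / (2 * (1 + `|b|)) * (t * (1 + `|b|))))).
  by rewrite ler_pM2l // ler_pM2l.
by rewrite le_eqVlt; apply/orP; left; apply/eqP; field; rewrite gt_eqF.
Qed.

(** The orbit is homogeneous: an isometry moves F x to the base point with a semilinear derivative,
    so the tangent space at F x is carried into the complex line orthogonal to [xi]. *)
Lemma tangent_dependent v xi x a b : herm v v = 1 -> herm xi xi = 1 -> herm v xi = 0 ->
  normal B xi -> normal B (mul_i xi) -> U x -> cdep ('D_a F x) ('D_b F x).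
Proof.
move=> nv nx vx hx hJx Hx.
have nxi : nrm xi = 1.
  have n1 : dot xi xi = 1 by rewrite (_ : dot xi xi = complex.Re (herm xi xi)) // nx.
  by rewrite /nrm n1 sqrtr1.
have [K K0 hK] := star_closure Bl' Binj QC Ql C2 orbit_germ.
have [s hs] := orbit_gmap (param_orbit Hx).
have hb := orbit_ball (param_orbit Hx).
have hy := moeb_ball hp hb.
have [A uA hA] := hmap_form alpha hp s^-1%g.
have hy2 : CH2 R (- hmap alpha p s^-1%g 0) by apply: ballN; apply: hmap_ball hp _ _ (ball0 R).
have hM := hasd_comp (hasd_moeb hp hb) (hasd_hmap hp uA hA hy).
set M := (X in hasd _ _ X) in hM.
have sM : semilin M.
  exact: semilin_comp (semilin_comp (semilin_dmoeb _ _) (semilin_uni uA)) (semilin_dmoeb _ _).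
have iM w : M w = 0 -> w = 0.
  move=> h; have h2 := dmoeb_inj hy2 (uni_ball uA hy) h.
  by apply: (dmoeb_inj hp hb); apply/eqP; rewrite -nrm_eq0 -(uni_nrm _ uA) h2 nrm0.
have NP z : N z -> inP alpha p ((hmap alpha p s^-1%g \o moeb p) z).
  by move=> /orbit_gmap[t <-]; rewrite /= -hmap0; apply: inP_hmap => //; exact: inP_orbit.
have F0 : (hmap alpha p s^-1%g \o moeb p) (F x) = 0.
  by rewrite /= -hs -hmap0 hmapVK //; exact: ball0.
have T0 c : herm (M ('D_c F x)) xi = 0.
  have := TanC_push NP hM sM (param_tangent c Hx); rewrite F0.
  apply: (@TanC_sub _ _ _ K) => z Pz; first by have := hK z xi Pz hx; rewrite nxi mulr1.
  by have := hK z _ Pz hJx; rewrite nrm_mul_i nxi mulr1.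
exact: (cdep_pull sM iM (cdep_perp nv nx vx (T0 a) (T0 b))).
Qed.

Lemma second_holomorphic xi : herm xi xi = 1 -> normal B xi -> normal B (mul_i xi) ->
  forall a b h, B b = mul_i (B a) -> herm (Q h b) xi = 'i * herm (Q h a) xi.
Proof.
move=> nx hx hJx a b h hab.
have Qr g : wlin (Q g) by have [D Z] := Ql g; split=> *; rewrite !(QC g) ?D ?Z.
have Q0 g : Q g 0 = 0 by rewrite -(scale0r (0 : 'rV_k)) (Qr g).2 scale0r.
have hB c : herm (B c) xi = 0.
  by apply/eqP; rewrite eq_complex /= ![dot (B c) _]dotC hx hJx !eqxx.
have [B0|B0] := eqVneq (B a) 0.
  have a0 := Binj B0; rewrite B0 mul_i0 in hab; have b0 := Binj hab.
  by rewrite a0 b0 Q0 herm0l mulr0.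
have b0 : 0 < nrm (B a) by rewrite nrm_gt0.
pose v := (nrm (B a))^-1 *: B a.
have nv : herm v v = 1.
  by rewrite hermuu /v dotZl dotZr -sqr_nrm (_ : _ * _ = 1) //; field; rewrite gt_eqF.
have vx : herm v xi = 0 by rewrite /v hermZl hB mulr0.
have a0 : d1 a != 0.
  by apply: contraNneq B0 => /Finj ->; rewrite -(scale0r (0 : 'rV_k)) Bl'.2 scale0r.
apply: (@chart2_complex R k p d1 d2 (fun h a => 'D_a F (x0 + h)) hp) => //.
- by move=> c g g'; exact: (d2l g').2.
- exact: (derive_dir_first_order oU Ux F1 F2).
have [d d0 hd] := open_ball_norm oU Ux; exists d => // g g1 g2 hg.
by apply: (tangent_dependent _ _ nv nx vx hx hJx); exact: hd.
Qed.

Lemma orbit_covariant_derivative xi a b : normal_vector (bergman R) F x0 xi ->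
  covariant_derivative_along (bergman R) F x0 a b xi = 0.
Proof.
move=> hxi; pose M := dmoeb p p.
(* [dmoeb p p] is, up to the factor 4, an isometry from the metric at p to the Euclidean product at
   the origin, so normality becomes Euclidean normality to the recentred orbit. *)
have bM X Y : bergman R p X Y = 4 * dot (M X) (M Y).
  rewrite -(bergman_dmoeb X Y hp hp) moeb_pp /bergman.
  have d0r w : dot w 0 = 0 by rewrite dotC dot0l.
  by rewrite mul_i0 !d0r -/M; field.
have nM : normal B (M xi).
  by move=> c; have := hxi c; rewrite bM dotC => /eqP; rewrite mulf_eq0 pnatr_eq0 => /eqP.
have van c := germ_vanish hp dim1 hk Bl' Binj QC Ql germ_orbit C2 orbit_germ second_holomorphic c nM.
have Qab : dot (M xi) (Q a b) = 0 := polarization QC Ql van a b.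
rewrite /covariant_derivative_along christoffelE //.
have bD X Y : bergman R p X xi + bergman R p Y xi = bergman R p (X + Y) xi.
  by rewrite !bM /M (is_lin_dmoeb p p).1 dotDl mulrDr.
rewrite bD bM.
suff -> : M (d2 a b + (cscale ((1 - dot p p)%:C^-1 * herm (d1 b) p) (d1 a) +
    cscale ((1 - dot p p)%:C^-1 * herm (d1 a) p) (d1 b))) = Q a b.
  by rewrite dotC Qab mulr0.
by rewrite /Q /chart2 /M addrA.
Qed.
End OrbitGerm.

Theorem corollary4p3 (R : realType) (G : groupType)
    (alpha : isometric_action (CH2 R) (bergman R) G) :
  cohomogeneity_one alpha ->
  forall p : CH2 R, singular_orbit alpha p ->
  totally_geodesic (CH2 R) (bergman R) (orbit_in_chart alpha p).
Proof.
move=> [dim1 _] p [k [hk emb]]; split; first by move=> z; exact: orbit_ball.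
exists k; split=> // U F loc x Ux xi hxi a b.
exact: (orbit_covariant_derivative dim1 hk loc Ux a b hxi).
Qed.
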